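(* Let $p\in(1,\infty)$, $q\in[1,\infty)$, $s\in\mathbb{Z}_+$ and $\alpha\in[0,\infty)$, and let $\mathcal{X}$ be $\mathbb{R}^n$ or a cube $Q_0\subsetneqq\mathbb{R}^n$. Then: (i) $jn_{(p,q,s)_{\alpha}}(\mathcal{X})\subset JN_{(p,q,s)_{\alpha}}(\mathcal{X})$ (continuously: there is a constant $C>0$ with $\|f\|_{JN_{(p,q,s)_{\alpha}}(\mathcal{X})}\le C\|f\|_{jn_{(p,q,s)_{\alpha}}(\mathcal{X})}$ for all $f\in jn_{(p,q,s)_{\alpha}}(\mathcal{X})$); (ii) if $Q_0\subsetneqq\mathbb{R}^n$ is a cube, then $JN_{(p,q,s)_{\alpha}}(Q_0)=jn_{(p,q,s)_{\alpha}}(Q_0)/\mathcal{P}_s(Q_0)$ with equivalent norms; (iii) $L^p(\mathbb{R})\subsetneqq jn_p(\mathbb{R})\subsetneqq JN_p(\mathbb{R})$.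
   Context: $\mathbb{Z}_+=\{0,1,2,\dots\}$. A cube $Q\subset\mathbb{R}^n$ has edges parallel to the coordinate axes and finite positive side length $\ell(Q)$, and is not necessarily closed (for $n=1$, a bounded interval); $\ell(\mathbb{R}^n):=\infty$. $\fint_Q f:=\frac1{|Q|}\int_Q f$. Functions are measurable and identified when equal almost everywhere. $L^q_{\mathrm{loc}}(\mathcal{X})$ is the set of measurable $f$ with $f\mathbf{1}_E\in L^q(\mathcal{X})$ for every bounded $E\subset\mathcal{X}$. For normed (or seminormed) spaces, $\mathbb{X}_1\subset\mathbb{X}_2$ means set inclusion together with $\|f\|_{\mathbb{X}_2}\le C\|f\|_{\mathbb{X}_1}$ for all $f\in\mathbb{X}_1$, with $C$ independent of $f$. $\mathcal{P}_s(Q)$ is the set of polynomials of degree at most $s$ on $Q$. For $f\in L^1(Q)$, $P^{(s)}_Q(f)\in\mathcal{P}_s(Q)$ is the unique polynomial with $\int_Q[f(x)-P^{(s)}_Q(f)(x)]x^\beta\,dx=0$ for all $\beta\in\mathbb{Z}_+^n$, $|\beta|\le s$. Fix $c_0\in(0,\ell(\mathcal{X}))$. Let $P^{(s)}_{Q,c_0}(f):=P^{(s)}_Q(f)$ if $\ell(Q)<c_0$ and $P^{(s)}_{Q,c_0}(f):=0$ if $\ell(Q)\ge c_0$. $jn_{(p,q,s)_\alpha}(\mathcal{X})$ is the set of all $f\in L^q_{\mathrm{loc}}(\mathcal{X})$ with $$\|f\|_{jn_{(p,q,s)_\alpha}(\mathcal{X})}:=\sup\Big[\sum_{j}|Q_j|\Big\{|Q_j|^{-\alpha}\Big[\fint_{Q_j}|f-P^{(s)}_{Q_j,c_0}(f)|^q\Big]^{1/q}\Big\}^p\Big]^{1/p}<\infty,$$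 the supremum being over all countable (finite or infinite) collections $\{Q_j\}_j$ of cubes in $\mathcal{X}$ with pairwise disjoint interiors. $JN_{(p,q,s)_\alpha}(\mathcal{X})$ and $\|\cdot\|_{JN_{(p,q,s)_\alpha}(\mathcal{X})}$ (a seminorm vanishing on polynomials of degree at most $s$) are defined in the same way with $P^{(s)}_{Q_j,c_0}(f)$ replaced by $P^{(s)}_{Q_j}(f)$. $jn_p(\mathcal{X}):=jn_{(p,1,0)_0}(\mathcal{X})$ and $JN_p(\mathcal{X}):=JN_{(p,1,0)_0}(\mathcal{X})$. $jn_{(p,q,s)_\alpha}(Q_0)/\mathcal{P}_s(Q_0)$ denotes the set of all $f\in jn_{(p,q,s)_\alpha}(Q_0)$ equipped with $\|f\|_{jn_{(p,q,s)_\alpha}(Q_0)/\mathcal{P}_s(Q_0)}:=\inf_{a\in\mathcal{P}_s(Q_0)}\|f+a\|_{jn_{(p,q,s)_\alpha}(Q_0)}$ (note $\mathcal{P}_s(Q_0)\subset jn_{(p,q,s)_\alpha}(Q_0)$). *)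

(* Defs.v *)
From HB Require Import structures.
From mathcomp Require Import all_boot all_order all_algebra.
(* Both mpoly and all_analysis declare notations at incompatible levels. *)
From mathcomp Require Import -(notations) mpoly.
From mathcomp Require Import all_classical all_reals all_analysis.

Set Implicit Arguments.
Unset Strict Implicit.
Unset Printing Implicit Defensive.

Import Order.TTheory GRing.Theory Num.Theory.
Import numFieldNormedType.Exports.

Local Open Scope classical_set_scope.
Local Open Scope ring_scope.

(* R^n, with the Borel (= product) sigma-algebra.  Function spaces below are
   sets of Borel representatives: every Lebesgue measurable function is a.e.
   equal to a Borel one, and all the notions involved are a.e. invariant. *)
Notation Rn R n := (n.-tuple (measurableTypeR R)).

Section lebesgue_cons.
Context (R : realType) (n : nat).
Variable m : {sigma_finite_measure set (Rn R n) -> \bar R}.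
Local Open Scope ereal_scope.

Definition cons_pair (x : measurableTypeR R * Rn R n) : Rn R n.+1 :=
  [tuple of x.1 :: x.2].

Lemma measurable_cons_pair : measurable_fun [set: _] cons_pair.
Proof. exact: measurable_cons. Qed.

Definition lebesgue_cons : set (Rn R n.+1) -> \bar R :=
  pushforward (@lebesgue_measure R \x m) cons_pair.

Let mu : {measure set (measurableTypeR R * Rn R n)%type -> \bar R} :=
  @lebesgue_measure R \x m.

Let lebesgue_cons0 : lebesgue_cons set0 = 0.
Proof. by rewrite /lebesgue_cons /pushforward preimage_set0 measure0. Qed.

Let lebesgue_cons_ge0 A : 0 <= lebesgue_cons A.
Proof. exact: (measure_ge0 mu). Qed.

Let mpre A : measurable A -> measurable (cons_pair @^-1` A).
Proof. by move=> mA; rewrite -[X in measurable X]setTI; exact: measurable_cons_pair. Qed.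

Let lebesgue_cons_semi_sigma_additive : semi_sigma_additive lebesgue_cons.
Proof.
move=> F mF tF mUF; rewrite /lebesgue_cons /pushforward preimage_bigcup.
apply: measure_semi_sigma_additive.
- by move=> k; exact: mpre.
- apply/trivIsetP => /= i j _ _ ij; rewrite -preimage_setI.
  by move/trivIsetP : tF => /(_ _ _ _ _ ij) ->//; rewrite preimage_set0.
- by rewrite -preimage_bigcup; exact: mpre.
Qed.

HB.instance Definition _ := isMeasure.Build _ _ _ lebesgue_cons
  lebesgue_cons0 lebesgue_cons_ge0 lebesgue_cons_semi_sigma_additive.

Let lebesgue_cons_sigma_finite : sigma_finite setT lebesgue_cons.
Proof.
have /sigma_finiteP[F [TF ndF Foo]] := sigma_finiteT (@lebesgue_measure R).
have /sigma_finiteP[G [TG ndG Goo]] := sigma_finiteT m.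
pose g (t : Rn R n.+1) : measurableTypeR R * Rn R n :=
  (thead t, [tuple of behead t]).
have gK : cancel g cons_pair by move=> t; rewrite /cons_pair /=; exact/esym/tuple_eta.
have Kg : cancel cons_pair g.
  by case=> a t; rewrite /g theadE; congr pair; exact/val_inj.
have mtnth (i : 'I_n.+1) : measurable_fun [set: Rn R n.+1] (fun t => tnth t i).
  exact: measurable_tnth.
have mg : measurable_fun [set: Rn R n.+1] g.
  apply/measurable_fun_pair => /=; first exact: mtnth.
  apply/measurable_fun_tnthP => i.
  rewrite (_ : _ \o _ = fun t => tnth t (lift ord0 i)); first exact: mtnth.
  by apply/funext => t /=; rewrite [t in RHS]tuple_eta tnthS.
exists (fun k => g @^-1` (F k `*` G k)).
  rewrite -preimage_bigcup; apply/esym/seteqP; split=> // t _ /=.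
  have [i _ Fi] : (\bigcup_i F i) (g t).1 by rewrite -TF.
  have [j _ Gj] : (\bigcup_i G i) (g t).2 by rewrite -TG.
  exists (maxn i j) => //; split.
  - by move: Fi; exact/subsetPset/ndF/leq_maxl.
  - by move: Gj; exact/subsetPset/ndG/leq_maxr.
move=> k; have [mFk Fk] := Foo k; have [mGk Gk] := Goo k; split.
  by rewrite -[X in measurable X]setTI; apply: mg => //; exact: measurableX.
rewrite /lebesgue_cons /pushforward -comp_preimage (_ : g \o cons_pair = id); last first.
  by apply/funext => x /=; rewrite Kg.
by rewrite preimage_id product_measure1E// lte_mul_pinfty// ge0_fin_numE.
Qed.

HB.instance Definition _ := Measure_isSigmaFinite.Build _ _ _ lebesgue_cons
  lebesgue_cons_sigma_finite.

End lebesgue_cons.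

Fixpoint leb (R : realType) (n : nat) :
    {sigma_finite_measure set (Rn R n) -> \bar R} :=
  match n with
  | 0%N => @dirac _ (Rn R 0) [tuple] R
  | n'.+1 => lebesgue_cons (leb R n')
  end.

(* A product of intervals [c_i, c_i + side]; [lface i] (resp. [uface i]) tells
   whether the lower (resp. upper) face in direction i belongs to the cube. *)
Record cube (R : realType) (n : nat) := Cube {
  corner : Rn R n ;
  side : R ;
  lface : 'I_n -> bool ;
  uface : 'I_n -> bool ;
  side_gt0 : 0 < side }.

Definition cube_set (R : realType) (n : nat) (Q : cube R n) : set (Rn R n) :=
  [set x | forall i : 'I_n,
    tnth x i \in Interval (BSide (lface Q i) (tnth (corner Q) i))
                          (BSide (~~ uface Q i) (tnth (corner Q) i + side Q))].

Definition cube_interior (R : realType) (n : nat) (Q : cube R n) :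
    set (Rn R n) :=
  [set x | forall i : 'I_n,
    tnth x i \in `]tnth (corner Q) i, tnth (corner Q) i + side Q[].

Inductive domain (R : realType) (n : nat) :=
  | WholeSpace
  | CubeDomain of cube R n.
Arguments WholeSpace {R n}.

Definition domain_set (R : realType) (n : nat) (X : domain R n) :
    set (Rn R n) :=
  match X with WholeSpace => [set: _] | CubeDomain Q => cube_set Q end.

Definition domain_side (R : realType) (n : nat) (X : domain R n) : \bar R :=
  match X with WholeSpace => +oo%E | CubeDomain Q => (side Q)%:E end.

Definition bounded_subset (R : realType) (n : nat) (E : set (Rn R n)) : Prop :=
  exists M : R, forall x, E x -> forall i, `|tnth x i| <= M.

(* Countable collections are indexed by an arbitrary set [F.1] of naturals. *)
Definition cube_family (R : realType) (n : nat) (X : domain R n) :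
    set (set nat * (nat -> cube R n)) :=
  [set F | (forall j, F.1 j -> cube_set (F.2 j) `<=` domain_set X) /\
           trivIset F.1 (fun j => cube_interior (F.2 j))].

Definition poly_le (R : realType) (n s : nat) : set (mpoly n R) :=
  [set a | (msize a <= s.+1)%N].

Definition polyfun (R : realType) (n : nat) (a : mpoly n R) :
    Rn R n -> R :=
  fun x => meval (tnth x) a.

Definition monomial (R : realType) (n : nat) (b : multinom n)
    (x : Rn R n) : R :=
  \prod_(i < n) (tnth x i : R) ^+ b i.

(* For f integrable on Q exactly one polynomial satisfies the moment conditions
   (n > 0); the default 0 of [xget] is only reached for non-integrable f. *)
Definition proj_poly (R : realType) (n s : nat) (Q : cube R n)
    (f : Rn R n -> R) : Rn R n -> R :=
  polyfun (xget 0 [set a | poly_le s a /\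
    forall b : multinom n, (mdeg b <= s)%N ->
      (\int[leb R n]_(x in cube_set Q)
         ((f x - polyfun a x) * monomial b x)%:E)%E = 0%E]).

Definition proj_poly_cut (R : realType) (n s : nat) (c0 : R) (Q : cube R n)
    (f : Rn R n -> R) : Rn R n -> R :=
  if side Q < c0 then proj_poly s Q f else cst 0.

(* Membership and norm never depend on the values of a function off the domain,
   so a function on X is represented by any extension of it to R^n. *)
Record fspace (R : realType) (n : nat) := FSpace {
  carrier : set (Rn R n -> R) ;
  fnorm : (Rn R n -> R) -> \bar R }.

Definition cembed (R : realType) (n : nat) (A B : fspace R n) : Prop :=
  carrier A `<=` carrier B /\
  exists2 C : R, 0 < C & forall f, carrier A f -> (fnorm B f <= C%:E * fnorm A f)%E.

Definition strict_cembed (R : realType) (n : nat) (A B : fspace R n) : Prop :=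
  cembed A B /\ carrier A <> carrier B.

Definition eq_equiv_norms (R : realType) (n : nat) (A B : fspace R n) : Prop :=
  carrier A = carrier B /\
  exists2 C : R, 0 < C & forall f, carrier A f ->
    (fnorm B f <= C%:E * fnorm A f)%E /\ (fnorm A f <= C%:E * fnorm B f)%E.

Section spaces.
Context (R : realType) (n : nat).
Implicit Types (p q alpha : R) (s : nat) (X : domain R n) (f : Rn R n -> R).

Definition Lp_norm p X f : \bar R :=
  'N[leb R n]_p%:E [EFin \o (f \* \1_(domain_set X))%R]%E.

Definition Lp p X : fspace R n :=
  FSpace [set f : Rn R n -> R | measurable_fun (domain_set X) f /\ (Lp_norm p X f < +oo)%E]
         (Lp_norm p X).

Definition Lq_loc q X : set (Rn R n -> R) :=
  [set f : Rn R n -> R | measurable_fun (domain_set X) f /\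
    forall E, measurable E -> E `<=` domain_set X -> bounded_subset E ->
      carrier (Lp q X) (f \* \1_E)].

Local Open Scope ereal_scope.

Definition mean (Q : cube R n) (g : Rn R n -> \bar R) : \bar R :=
  (fine (leb R n (cube_set Q)))^-1%:E * \int[leb R n]_(x in cube_set Q) g x.

Definition cube_term p q alpha (P : cube R n -> (Rn R n -> R) -> Rn R n -> R)
    f (Q : cube R n) : \bar R :=
  let m := leb R n (cube_set Q) in
  m * (m `^ (- alpha) *
       (mean Q (fun x => (`|f x - P Q f x| `^ q)%:E)) `^ q^-1) `^ p.

Definition JN_sup p q alpha (P : cube R n -> (Rn R n -> R) -> Rn R n -> R) X f
    : \bar R :=
  ereal_sup [set (\esum_(j in F.1) cube_term p q alpha P f (F.2 j)) `^ p^-1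
            | F in cube_family X].

Definition JN_space p q alpha (P : cube R n -> (Rn R n -> R) -> Rn R n -> R) X
    : fspace R n :=
  FSpace [set f : Rn R n -> R | Lq_loc q X f /\ JN_sup p q alpha P X f < +oo]
         (JN_sup p q alpha P X).

Definition JN p q s alpha X : fspace R n :=
  JN_space p q alpha (proj_poly s) X.

Definition jn p q s alpha (c0 : R) X : fspace R n :=
  JN_space p q alpha (proj_poly_cut s c0) X.

Definition jn_quot p q s alpha (c0 : R) X : fspace R n :=
  FSpace (carrier (jn p q s alpha c0 X))
    (fun f => ereal_inf [set fnorm (jn p q s alpha c0 X) (f \+ polyfun a)%R
                        | a in @poly_le R n s]).

Definition JNp p X : fspace R n := JN p 1 0 0 X.

Definition jnp p (c0 : R) X : fspace R n := jn p 1 0 0 c0 X.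

End spaces.

(* Main.v *)
(* On polynomials of degree at most s the supremum over a cube is controlled by the mean, uniformly
   in the cube: in dimension one this is Lagrange interpolation, and the general case follows by
   slicing. Hence the moment projection is, up to a constant, the best polynomial approximation in
   every L^q mean. Comparing it with 0 gives (i); comparing it with f + b for a polynomial b, and
   observing that cubes of side at least c0 in Q0 have volume comparable with that of Q0, gives (ii).

   For (iii), constants lie in JN_p but not in jn_p of the line. The function in jn_p and not in L^p
   is the fixed point f of
     f = 1 on the middle third of [0, 1], f = r f(3x) and r f(3x - 2) on the outer thirds,
   with 2 r^p = 3: every generation contributes the same amount to the integral of f^p, which
   diverges, while |Q| (mean oscillation of f on Q)^p is at most a multiple of the increment across Q
   of an approximation of the Cantor function, and the increments over disjoint intervals add up to
   at most 1. *)

(* The ratio r is forced by scaling. Dividing a length L by 3 and an increment v by 2 multiplies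
   L^(1 - 1/p) v^(1/p) by r / 3, which is also the factor by which an integral changes when f is
   copied into an outer third. A bound of the oscillation by this weighted geometric mean therefore
   survives the recursion with the same constant, and can be proved by induction on the generation.
   As p > 1, one has r < 3/2: the L^1 masses of the generations decrease by the factor 2 r / 3 < 1,
   and f is integrable although its p-th power is not.

   The induction needs a first generation, so it is run on approximants of f, paired with piecewise
   linear approximations of the Cantor function. Their L^1 distance to f cannot be summed over
   infinitely many intervals, but the sum is a supremum over finite subfamilies, and the generation
   is chosen after the subfamily.

   For polynomials the obstacle is uniformity in the cube. The interpolation nodes are chosen inside
   the cube at hand, so its side enters only through ratios of lengths. *)
Require Import Defs.
From mathcomp Require Import all_boot all_order all_algebra.
From mathcomp Require Import -(notations) mpoly.
From mathcomp Require Import finmap.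
From mathcomp Require Import all_classical all_reals all_analysis measurable_realfun.
From mathcomp Require Import zify ring lra.

Set Implicit Arguments.
Unset Strict Implicit.
Unset Printing Implicit Defensive.

Import Order.TTheory GRing.Theory Num.Theory.
Import numFieldNormedType.Exports.

Local Open Scope classical_set_scope.
Local Open Scope ring_scope.

(** * Slicing cubes *)

Section lebesgue_cube.
Context {R : realType}.
Local Notation mu := (@lebesgue_measure R).

Lemma ge0_integral_leb_cons n (u : Rn R n.+1 -> \bar R) :
  measurable_fun [set: Rn R n.+1] u -> (forall x, 0 <= u x)%E ->
  (\int[leb R n.+1]_x u x =
   \int[mu]_t \int[leb R n]_y u (cons_pair (t, y)))%E.
Proof.
move=> mu_ u0.
rewrite -(fubini_tonelli1 (fun x => u (cons_pair x))) //; last first.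
  exact: measurableT_comp mu_ (@measurable_cons_pair R n).
by rewrite -(ge0_integral_pushforward (@measurable_cons_pair R n) _
  measurableT mu_).
Qed.

Definition slice_itv n (Q : cube R n.+1) : set R :=
  [set` Interval (BSide (lface Q ord0) (tnth (corner Q) ord0))
     (BSide (~~ uface Q ord0) (tnth (corner Q) ord0 + side Q))].

Definition slice_cube n (Q : cube R n.+1) : cube R n :=
  Cube [tuple of behead (corner Q)] (fun i => lface Q (lift ord0 i))
    (fun i => uface Q (lift ord0 i)) (side_gt0 Q).

Lemma tnth_behead_lift n (T : Type) (t : n.+1.-tuple T) (i : 'I_n) :
  tnth [tuple of behead t] i = tnth t (lift ord0 i).
Proof. by rewrite [t in RHS]tuple_eta tnthS. Qed.

Lemma cube_set_cons n (Q : cube R n.+1) t (y : Rn R n) :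
  cube_set Q (cons_pair (t, y)) <->
  slice_itv Q t /\ cube_set (slice_cube Q) y.
Proof.
split=> [Qty|[Jt Qy] i].
  split; first by have := Qty ord0; rewrite /slice_itv /= tnth0.
  by move=> i; have := Qty (lift ord0 i); rewrite /= tnthS tnth_behead_lift.
case: (unliftP ord0 i) => [j ->|->]; last by rewrite tnth0.
by rewrite /= tnthS; have := Qy j; rewrite /= tnth_behead_lift.
Qed.

Lemma measurable_tnthR n (i : 'I_n) :
  measurable_fun [set: Rn R n] (fun x => tnth x i).
Proof. exact: measurable_tnth. Qed.

Lemma measurable_cube n (Q : cube R n) : measurable (cube_set Q).
Proof.
rewrite (_ : cube_set Q = \bigcap_(i in [set: 'I_n])
    ((fun x : Rn R n => tnth x i) @^-1`
      [set` Interval (BSide (lface Q i) (tnth (corner Q) i))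
        (BSide (~~ uface Q i) (tnth (corner Q) i + side Q))])).
  apply: fin_bigcap_measurable => // i _.
  by rewrite -[X in measurable X]setTI; exact: measurable_tnthR.
by apply/seteqP; split => [x Qx i _|x Qx i]; [exact: Qx | exact: (Qx i)].
Qed.
#[local] Hint Resolve measurable_cube : core.

Lemma ge0_integral_cube_cons n (Q : cube R n.+1) (u : Rn R n.+1 -> \bar R) :
  measurable_fun [set: Rn R n.+1] u -> (forall x, 0 <= u x)%E ->
  (\int[leb R n.+1]_(x in cube_set Q) u x = \int[mu]_(t in slice_itv Q)
     \int[leb R n]_(y in cube_set (slice_cube Q)) u (cons_pair (t, y)))%E.
Proof.
move=> mu_ u0; rewrite integral_mkcond ge0_integral_leb_cons; first last.
- by move=> x; rewrite erestrict_ge0.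
- apply: (iffLR (measurable_restrictT u (measurable_cube Q))). exact: measurable_funTS.
rewrite [RHS]integral_mkcond; apply: eq_integral => t _.
rewrite patchE; case: ifPn => [/set_mem Jt|/negP Jt].
  rewrite [RHS]integral_mkcond; apply: eq_integral => y _.
  rewrite !patchE; congr (if _ then _ else _).
  apply/idP/idP => [/set_mem/cube_set_cons[_ Qy]|/set_mem Qy]; apply/mem_set => //.
  exact/cube_set_cons.
rewrite integral0_eq // => y _; rewrite patchE ifF //; apply/negP => /set_mem.
by rewrite cube_set_cons => -[Jt' _]; apply: Jt; exact/mem_set.
Qed.

Lemma lebesgue_slice_itv n (Q : cube R n.+1) : mu (slice_itv Q) = (side Q)%:E.
Proof.
by rewrite lebesgue_measure_itv /= lte_fin ltrDl side_gt0 -EFinD addrAC subrr add0r.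
Qed.

Lemma measurable_slice_itv n (Q : cube R n.+1) :
  measurable (slice_itv Q : set (measurableTypeR R)).
Proof. exact: measurable_itv. Qed.

Lemma leb_cube n (Q : cube R n) : leb R n (cube_set Q) = (side Q ^+ n)%:E.
Proof.
elim: n Q => [Q|n IH Q].
  rewrite expr0 /= diracE mem_set //.
  by case.
transitivity (\int[leb R n.+1]_(x in cube_set Q) cst 1%E x)%E.
  by rewrite (integral_cst _ (measurable_cube Q)) mul1e.
rewrite ge0_integral_cube_cons //.
transitivity (\int[mu]_(t in slice_itv Q) (cst (side Q ^+ n)%:E) t)%E.
  apply: eq_integral => t _.
  by rewrite (integral_cst _ (measurable_cube (slice_cube Q))) mul1e; exact: IH.
rewrite integral_cst; last exact: measurable_slice_itv.
by rewrite exprSr EFinM; congr (_ * _)%E; exact: lebesgue_slice_itv.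
Qed.

End lebesgue_cube.

(** * Integrals over [Rn R 1] as integrals over the real line *)

Section one_dimension.
Context {R : realType}.
Local Notation mu := (@lebesgue_measure R).

Lemma integral_leb0 (A : set (Rn R 0)) (k : \bar R) : measurable A -> A [tuple] ->
  (0 <= k)%E -> (\int[leb R 0]_(y in A) (fun=> k) y = k)%E.
Proof.
move=> mA A0 k0; rewrite (integral_cst _ mA) /leb.
by rewrite [X in (_ * X)%E]diracE mem_set // mule1.
Qed.

Lemma ge0_integral_leb1 (v : R -> \bar R) : measurable_fun [set: R] v ->
  (forall t, 0 <= v t)%E ->
  (\int[leb R 1]_x v (tnth x ord0) = \int[mu]_t v t)%E.
Proof.
move=> mv v0; rewrite (ge0_integral_leb_cons (u := fun x => v (tnth x ord0))) //; last first.
  exact: measurableT_comp mv (@measurable_tnthR R 1 ord0).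
apply: eq_integral => t _.
transitivity (\int[leb R 0]_(y in setT) (fun=> v t) y)%E; last exact: integral_leb0.
by apply: eq_integral => y _; rewrite tnth0.
Qed.

Lemma ge0_integral_cube1 (Q : cube R 1) (v : R -> \bar R) : measurable_fun [set: R] v ->
  (forall t, 0 <= v t)%E ->
  (\int[leb R 1]_(x in cube_set Q) v (tnth x ord0) = \int[mu]_(t in slice_itv Q) v t)%E.
Proof.
move=> mv v0; rewrite (ge0_integral_cube_cons Q (u := fun x => v (tnth x ord0))) //; last first.
  exact: measurableT_comp mv (@measurable_tnthR R 1 ord0).
apply: eq_integral => t _.
transitivity (\int[leb R 0]_(y in cube_set (slice_cube Q)) (fun=> v t) y)%E.
  by apply: eq_integral => y _; rewrite tnth0.
by apply: integral_leb0 => //; [exact: measurable_cube|case].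
Qed.

(** Passing to the closed interval forgets which end points belong to the cube. *)
Lemma ge0_integral_cube1_le (Q : cube R 1) (v : R -> \bar R) : measurable_fun [set: R] v ->
  (forall t, 0 <= v t)%E ->
  (\int[leb R 1]_(x in cube_set Q) v (tnth x ord0) <=
   \int[mu]_(t in `[tnth (corner Q) ord0, (tnth (corner Q) ord0 + side Q)%R]) v t)%E.
Proof.
move=> mv v0; rewrite ge0_integral_cube1 //; apply: ge0_subset_integral => //.
- exact: measurable_slice_itv.
- exact: measurable_funTS.
move=> t; rewrite /slice_itv /= !in_itv /= => /andP[h1 h2]; apply/andP; split.
  by case: (lface Q ord0) h1 => // /ltW.
by case: (uface Q ord0) h2 => // /ltW.
Qed.

End one_dimension.

(** * Supremum and mean of a polynomial *)

Section lagrange.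
Variables (F : fieldType) (N : nat) (t : 'I_N -> F).
Hypothesis t_inj : injective t.

Definition lagrange_basis (i : 'I_N) : {poly F} :=
  \prod_(j | j != i) ((t i - t j)^-1 *: ('X - (t j)%:P)).

Lemma lagrange_basis_eval i j : (lagrange_basis i).[t j] = (i == j)%:R.
Proof.
rewrite /lagrange_basis horner_prod; case: eqVneq => [<-|ij].
  rewrite big1 // => k ki; rewrite !hornerE mulVf // subr_eq0.
  by apply: contra ki => /eqP/t_inj ->.
by rewrite (bigD1 j) 1?eq_sym //= !hornerE subrr mulr0 mul0r.
Qed.

Lemma size_lagrange_basis i : (size (lagrange_basis i) <= N)%N.
Proof.
rewrite (leq_trans (size_poly_prod_leq _ _)) //.
have h : (\sum_(j | j != i) size ((t i - t j)^-1 *: ('X - (t j)%:P))%R <=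
          \sum_(j | j != i) 2)%N.
  by apply: leq_sum => j _; rewrite (leq_trans (size_scale_leq _ _)) // size_XsubC.
move: h; rewrite sum_nat_const (_ : #|_| = N.-1) ?cardC1 ?card_ord //.
by have := ltn_ord i; move: (\sum_(j | _) _)%N => S; lia.
Qed.

(** The difference of the two sides has size at most [N] and vanishes at [N] distinct nodes. *)
Lemma lagrange_interpolation (p : {poly F}) : (size p <= N)%N ->
  p = \sum_i p.[t i] *: lagrange_basis i.
Proof.
move=> sp; apply/eqP; rewrite -subr_eq0; apply/eqP.
apply: (@roots_geq_poly_eq0 _ _ [seq t i | i <- enum 'I_N]).
- apply/allP => _ /mapP[j _ ->]; rewrite /root !hornerE horner_sum subr_eq0.
  rewrite (bigD1 j) //= hornerE lagrange_basis_eval eqxx mulr1 big1 ?addr0 //.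
  by move=> i ij; rewrite hornerE lagrange_basis_eval (negbTE ij) mulr0.
- by rewrite map_inj_uniq ?enum_uniq.
- rewrite size_map size_enum_ord (leq_trans (size_polyD _ _)) // geq_max sp size_polyN.
  apply: (leq_trans (size_sum _ _ _)); apply/bigmax_leqP => i _.
  exact: leq_trans (size_scale_leq _ _) (size_lagrange_basis i).
Qed.

End lagrange.

Section polynomial_sup_mean.
Context {R : realType}.
Local Notation mu := (@lebesgue_measure R).

(** Each basis polynomial has [N.-1] factors, of absolute value at most [l / d] at [x], and there
    are [N] of them. *)
Lemma lagrange_bound N (t : 'I_N -> R) (p : {poly R}) (x l d K : R) :
  (size p <= N)%N -> 0 < d -> (forall i j, i != j -> d <= `|t i - t j|) ->
  (forall i, `|x - t i| <= l) -> (forall i, `|p.[t i]| <= K) ->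
  `|p.[x]| <= (l / d) ^+ N.-1 * N%:R * K.
Proof.
move=> sp d0 td xl pK.
have t_inj : injective t.
  move=> i j tij; apply/eqP; apply/negPn/negP => /td.
  by rewrite tij subrr normr0 leNgt d0.
rewrite {1}(lagrange_interpolation t_inj sp) horner_sum.
apply: (le_trans (ler_norm_sum _ _ _)).
apply: (@le_trans _ _ (\sum_(i < N) (l / d) ^+ N.-1 * K)); last first.
  by rewrite sumr_const card_ord -mulrA -[in X in _ <= X]mulr_natl -mulr_natl; lra.
apply: ler_sum => i _; rewrite hornerE normrM mulrC.
have l0 : 0 <= l := le_trans (normr_ge0 _) (xl i).
apply: ler_pM => //; rewrite /lagrange_basis horner_prod normr_prod.
have -> : N.-1 = #|[pred j | j != i]| by rewrite cardC1 card_ord.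
rewrite -prodr_const; apply: ler_prod => j ji.
rewrite normr_ge0 /= !hornerE normrM mulrC ler_pM // normfV.
rewrite lef_pV2 ?posrE //; first by rewrite td // eq_sym.
by rewrite (lt_le_trans d0) // td // eq_sym.
Qed.

Lemma measurable_poly_eval (p : {poly R}) :
  measurable_fun [set: R] (fun x => p.[x]).
Proof.
exact: continuous_measurable_fun (@continuous_horner _ p).
Qed.

(** Otherwise [|f|] exceeds [K] on the whole interval, and its integral is at least [K * (b - a)],
    which is larger than [I]. *)
Lemma exists_le_mean (f : R -> R) (a b I K : R) (D : set R) :
  measurable D -> `]a, b[ `<=` D ->
  measurable_fun [set: R] f -> a < b -> I / (b - a) < K ->
  (\int[mu]_(t in D) `|f t|%:E <= I%:E)%E ->
  exists2 t, t \in `]a, b[ & `|f t| <= K.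
Proof.
move=> mD JD mf ab IK fI; apply: contrapT => h.
have mf' : measurable_fun D (EFin \o (Num.norm \o f)).
  by apply/measurable_EFinP/measurableT_comp => //; exact: measurable_funTS.
have : ((K * (b - a))%:E <= I%:E)%E.
  apply: (le_trans _ fI).
  apply: (@le_trans _ _ (\int[mu]_(t in `]a, b[) `|f t|%:E)%E); last first.
    by apply: ge0_subset_integral.
  rewrite (_ : (K * (b - a))%:E = (\int[mu]_(t in `]a, b[) (cst K%:E) t)%E).
    have K0 : 0 <= K.
      apply: le_trans (ltW IK); apply: divr_ge0; last by rewrite subr_ge0 ltW.
      rewrite -lee_fin; apply: le_trans fI; apply: integral_ge0 => x _.
      by rewrite lee_fin.
    apply: ge0_le_integral => //=.
    - by apply: measurable_funS mf'.
    - move=> t tab; rewrite lee_fin leNgt; apply/negP => ftK.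
      by apply: h; exists t => //; exact: ltW.
  rewrite integral_cst //= lebesgue_measure_itv /= lte_fin ab.
  by rewrite -EFinD -EFinM.
rewrite lee_fin leNgt => /negP; apply.
by rewrite -ltr_pdivrMr // subr_gt0.
Qed.

(* The nodes are chosen in [s + 1] separated subintervals, each at a point where the polynomial
   does not exceed its mean. *)
Lemma poly_sup_mean1 (s : nat) : exists2 C : R, 0 < C &
  forall (p : {poly R}) (c l I x : R) (b1 b2 : bool), (size p <= s.+1)%N ->
    0 < l -> x \in `[c, c + l] ->
    (\int[mu]_(t in [set` Interval (BSide b1 c) (BSide b2 (c + l)%R)]) `|p.[t]|%:E
      <= I%:E)%E ->
    `|p.[x]| <= C / l * I.
Proof.
(* The interval is cut into [2 * N] pieces of length [l / m], and the nodes lie in the pieces of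
   even index: distinct nodes are then at least one piece apart. *)
pose N := s.+1; pose m : R := (2 * N)%:R.
have m0 : 0 < m by rewrite ltr0n.
exists (m ^+ s * N%:R * m); first by rewrite !mulr_gt0 ?exprn_gt0 // ltr0n.
move=> p c l I x b1 b2 sp l0 xcl pI.
have d0 : 0 < l / m by rewrite divr_gt0.
apply/ler_addgt0Pr => e e0.
pose B := m ^+ s * N%:R : R.
have B0 : 0 < B by rewrite mulr_gt0 ?exprn_gt0 // ltr0n.
(* [m / l * I] bounds the mean over one piece. The slack provides the strict inequality of
   [exists_le_mean], and becomes exactly [e] after multiplication by the factor [B] of
   [lagrange_bound]. *)
pose K := m / l * I + e / B.
have nodes_in (i : 'I_N) : 0 <= l / m * (2 * i)%:R /\
    l / m * (2 * i)%:R + l / m <= l.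
  split; first by rewrite mulr_ge0 // ltW.
  rewrite -{2}[l / m]mulr1 -mulrDr natr1.
  rewrite -[leRHS](divfK (lt0r_neq0 m0)) ler_pM2l // ler_nat.
  by have := ltn_ord i; rewrite /N; lia.
have nodes (i : 'I_N) : exists2 t,
    t \in `]c + l / m * (2 * i)%:R, c + l / m * (2 * i)%:R + l / m[ & `|p.[t]| <= K.
  apply: (@exists_le_mean _ _ _ I _ _ _ _ (measurable_poly_eval p) _ _ pI) => //.
  - move=> t /=; rewrite !in_itv /= => /andP[t1 t2].
    have [i1 i2] := nodes_in i.
    have t1' : c < t by lra.
    have t2' : t < c + l by lra.
    by case: (b1); case: (b2); rewrite /= ?t1' ?t2' ?(ltW t1') ?(ltW t2').
  - by rewrite ltrDl.
  - by rewrite addrAC subrr add0r /K invf_div mulrC ltrDl divr_gt0.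
pose t i := sval (cid2 (nodes i)).
have tP (i : 'I_N) : c + l / m * (2 * i)%:R < t i < c + l / m * (2 * i)%:R + l / m.
  by rewrite /t; case: cid2 => /= y; rewrite in_itv.
have tK i : `|p.[t i]| <= K by rewrite /t; case: cid2.
have dist (i j : 'I_N) : (i < j)%N -> l / m <= `|t i - t j|.
  move=> ij; rewrite distrC; apply: le_trans (ler_norm _).
  have /andP[_ ti] := tP i; have /andP[tj _] := tP j.
  have : l / m * (2 * i)%:R + l / m *+ 2 <= l / m * (2 * j)%:R.
    by rewrite -(mulr_natr (l / m) 2) -mulrDr -natrD ler_pM2l // ler_nat; lia.
  by rewrite mulr2n; lra.
have := @lagrange_bound N t p x l (l / m) K sp d0 _ _ tK.
have -> : l / (l / m) = m by rewrite invf_div mulrCA divff ?mulr1 ?lt0r_neq0.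
have -> : m ^+ N.-1 * N%:R * K = m ^+ s * N%:R * m / l * I + e.
  by rewrite /K mulrDr [_ * (e / B)]mulrCA divff ?mulr1 ?lt0r_neq0 // !mulrA.
apply=> [i j|i].
  by rewrite -val_eqE /= neq_ltn => /orP[/dist //|/dist]; rewrite distrC.
have /andP[t1 t2] := tP i; have [i1 i2] := nodes_in i.
by move: xcl; rewrite in_itv /= ler_norml => /andP[x1 x2]; apply/andP; split; lra.
Qed.

End polynomial_sup_mean.

Section polynomial_functions.
Context {R : realType}.
Local Notation mu := (@lebesgue_measure R).

Lemma measurable_slice_integral n (A : set (Rn R n)) (f : Rn R n.+1 -> \bar R) :
  measurable A -> measurable_fun [set: Rn R n.+1] f -> (forall x, 0 <= f x)%E ->
  measurable_fun [set: measurableTypeR R]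
    (fun t => \int[leb R n]_(y in A) f (cons_pair (t, y)))%E.
Proof.
move=> mA mf f0.
pose g (z : measurableTypeR R * Rn R n) := ((f \o @cons_pair R n) \_ (setT `*` A)) z.
have mTA : measurable ([set: measurableTypeR R] `*` A) by exact: measurableX.
have mg : measurable_fun setT g.
  apply: (iffLR (measurable_restrictT (f \o @cons_pair R n) mTA)).
  apply: measurable_funTS; exact: measurableT_comp mf (@measurable_cons_pair R n).
have g0 z : (0 <= g z)%E by apply: erestrict_ge0 => y _; exact: f0.
apply: eq_measurable_fun (measurable_fun_fubini_tonelli_F (m2 := leb R n) g mg g0).
move=> t _; rewrite /fubini_F [RHS]integral_mkcond; apply: eq_integral => y _.
rewrite /g !patchE; congr (if _ then _ else _).
by apply/idP/idP => /set_mem => [[]|] /=; move=> *; apply/mem_set.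
Qed.

(* The functions of degree at most [s] in each variable separately: stable under
   slicing, unlike total degree bounds on [mpoly]. *)
Fixpoint poly_slices (s n : nat) : (Rn R n -> R) -> Prop :=
  match n return (Rn R n -> R) -> Prop with
  | 0 => fun _ => True
  | n'.+1 => fun u =>
     (forall y, exists2 p : {poly R}, (size p <= s.+1)%N &
        forall t, u (cons_pair (t, y)) = p.[t]) /\
     (forall t, @poly_slices s n' (fun y => u (cons_pair (t, y))))
  end.

(** Induction on the dimension. At a fixed [y0], the value [u (t, y0)] is bounded for each [t] by
    the mean of the slice over [t]; as a function of [t] it is a polynomial in one variable, bounded
    by its own mean, and the two means combine by Tonelli. *)
Lemma poly_slices_sup_mean (s n : nat) : exists2 C : R, 0 < C &
  forall (u : Rn R n -> R) (Q : cube R n) (I : R) x,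
    measurable_fun [set: Rn R n] u -> poly_slices s u -> cube_set Q x ->
    (\int[leb R n]_(y in cube_set Q) `|u y|%:E <= I%:E)%E ->
    `|u x| <= C / side Q ^+ n * I.
Proof.
elim: n => [|n [C C0 IH]].
  exists 1 => // u Q I x mu_ _ Qx; rewrite expr0 divr1 mul1r.
  have mu' : measurable_fun (cube_set Q) (fun y : Rn R 0 => `|u y|%:E).
    by apply/measurable_EFinP/measurableT_comp => //; exact: measurable_funTS.
  rewrite [leb R 0]/= integral_dirac //; last exact: measurable_cube.
  rewrite diracE mem_set ?mul1e; last by case.
  by rewrite lee_fin (_ : [tuple] = x) //; exact/esym/tuple0.
have [D D0 dim1] := @poly_sup_mean1 R s.
exists (D * C); first exact: mulr_gt0.
move=> u Q I x mu_ [su1 su2] Qx; rewrite ge0_integral_cube_cons; first last.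
- by move=> y; rewrite lee_fin.
- exact/measurable_EFinP/measurableT_comp.
pose t0 := thead x; pose y0 : Rn R n := [tuple of behead x].
have xE : x = cons_pair (t0, y0) by exact: tuple_eta.
move: Qx; rewrite xE => /cube_set_cons[Jt0 Qy0] uI.
have [p sp pE] := su1 y0.
have l0 := side_gt0 Q.
have ln0 : 0 < side Q ^+ n by rewrite exprn_gt0.
pose J t := (\int[leb R n]_(y in cube_set (slice_cube Q)) `|u (cons_pair (t, y))|%:E)%E.
have J0 t : (0 <= J t)%E by apply: integral_ge0 => y _; rewrite lee_fin.
have mJ : measurable_fun [set: measurableTypeR R] J.
  apply: (measurable_slice_integral (f := fun z => `|u z|%:E)).
  - exact: measurable_cube.
  - exact/measurable_EFinP/measurableT_comp.
  - by move=> z; rewrite lee_fin.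
have pJ t : (`|p.[t]|%:E <= (C / side Q ^+ n)%:E * J t)%E.
  rewrite -pE; have [Jfin|] := boolP (J t \is a fin_num); last first.
    rewrite ge0_fin_numE // -leNgt leye_eq => /eqP ->.
    by rewrite gt0_muley ?leey // lte_fin divr_gt0.
  rewrite -(fineK Jfin) -EFinM lee_fin.
  apply: (IH (fun y => u (cons_pair (t, y))) (slice_cube Q)) => //.
  - apply: (measurableT_comp mu_).
    apply: (measurableT_comp (@measurable_cons_pair R n)).
    exact: measurable_fun_pair.
  - exact: su2.
  - by rewrite fineK.
rewrite pE exprS invfM mulrACA -(mulrA (D / _)).
apply: (dim1 p (tnth (corner Q) ord0) (side Q) _ t0 (lface Q ord0) (~~ uface Q ord0)) => //.
  move: Jt0; rewrite /slice_itv /=; rewrite !in_itv /= => /andP[].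
  by case: (lface Q ord0); case: (uface Q ord0) => /= a b; rewrite ?a ?b ?(ltW a) ?(ltW b).
apply: (@le_trans _ _ (\int[mu]_(t in slice_itv Q) ((C / side Q ^+ n)%:E * J t))%E).
  apply: ge0_le_integral.
  - exact: measurable_slice_itv.
  - by move=> t _; rewrite lee_fin.
  - apply/measurable_EFinP/measurableT_comp => //; apply: measurable_funTS.
    exact: measurable_poly_eval.
  - by apply: measurable_funeM; exact: measurable_funTS.
  - by move=> t _; exact: pJ.
rewrite ge0_integralZl //.
- by rewrite (EFinM _ I); apply: lee_wpmul2l => //; rewrite lee_fin ltW // divr_gt0.
- exact: measurable_slice_itv.
- exact: measurable_funTS.
- by rewrite lee_fin divr_ge0 // ltW.
Qed.

End polynomial_functions.

(** * The moment projection *)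

Section mpoly_functions.
Context {R : realType}.

(** Coefficients and exponents are indexed by an arbitrary list because slicing multiplies the
    coefficients by powers of [t] and may leave several terms with equal exponents; this form is
    preserved. *)
Lemma poly_slices_monomials (s n : nat) (J : Type) (L : seq J) (c : J -> R)
    (e : J -> 'I_n -> nat) : (forall j i, (e j i <= s)%N) ->
  poly_slices s (fun x : Rn R n => \sum_(j <- L) c j * \prod_i (tnth x i : R) ^+ e j i).
Proof.
elim: n c e => [//|n IH] c e es; split.
  move=> y; pose k j := c j * \prod_(i < n) (tnth y i : R) ^+ e j (lift ord0 i).
  exists (\sum_(j <- L) k j *: 'X^(e j ord0)).
    apply: (big_ind (fun p : {poly R} => size p <= s.+1)%N); first by rewrite size_poly0.
      by move=> p r sp sr; rewrite (leq_trans (size_polyD _ _)) // geq_max sp.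
    by move=> j _; rewrite (leq_trans (size_scale_leq _ _)) // size_polyXn ltnS.
  move=> t; rewrite horner_sum; apply: eq_bigr => j _.
  rewrite hornerZ hornerXn big_ord_recl tnth0 /k mulrCA [RHS]mulrC.
  by congr (_ * (_ * _)); apply: eq_bigr => i _; rewrite tnthS.
move=> t; set v := fun y => _.
have -> : v = fun y => \sum_(j <- L) (c j * t ^+ e j ord0) *
    \prod_(i < n) (tnth y i : R) ^+ (e j (lift ord0 i)).
  apply/funext => y; apply: eq_bigr => j _; rewrite big_ord_recl tnth0 mulrA.
  by congr (_ * _); apply: eq_bigr => i _; rewrite tnthS.
exact: IH.
Qed.

Variable n : nat.
Implicit Types a b : mpoly n R.

Lemma polyfunE a (x : Rn R n) :
  polyfun a x = \sum_(m <- msupp a) mcoeff m a * monomial m x.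
Proof. exact: mevalE. Qed.

Lemma polyfunD a b (x : Rn R n) : polyfun (a + b) x = polyfun a x + polyfun b x.
Proof. exact: mevalD. Qed.

Lemma polyfunB a b (x : Rn R n) : polyfun (a - b) x = polyfun a x - polyfun b x.
Proof. exact: mevalB. Qed.

Lemma polyfunM a b (x : Rn R n) : polyfun (a * b) x = polyfun a x * polyfun b x.
Proof. exact: mevalM. Qed.

Lemma polyfunX (m : multinom n) (x : Rn R n) :
  polyfun (mpolyX R m) x = monomial m x.
Proof. by rewrite /polyfun mevalX. Qed.

Lemma poly_le0 s : poly_le s (0 : mpoly n R).
Proof. by rewrite /poly_le /= mmeasure0. Qed.

Lemma poly_leD s a b : poly_le s a -> poly_le s b -> poly_le s (a + b).
Proof.
rewrite /poly_le /= => sa sb; apply: (leq_trans (mmeasureD_le _ _ _)).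
by rewrite geq_max sa sb.
Qed.

Lemma poly_leN s a : poly_le s a -> poly_le s (- a).
Proof. by rewrite /poly_le /= mmeasureN. Qed.

Lemma poly_leB s a b : poly_le s a -> poly_le s b -> poly_le s (a - b).
Proof. by move=> sa sb; apply: poly_leD => //; exact: poly_leN. Qed.

Lemma poly_le_sumX s (I : finType) (c : I -> R) (m : I -> multinom n) :
  (forall i, (mdeg (m i) <= s)%N) ->
  poly_le s (\sum_i c i *: mpolyX R (m i)).
Proof.
move=> ms; rewrite /poly_le /=; apply: (leq_trans (mmeasure_sum _ _ _ _)).
apply/bigmax_leqP => i _; apply: (leq_trans (mmeasureZ_le _ _ _)).
by rewrite mmeasureX; exact: ms.
Qed.

Lemma poly_le_mdeg s a m : poly_le s a -> m \in msupp a -> (mdeg m <= s)%N.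
Proof. by move=> sa /(mmeasure_mnm_lt mdeg) h; rewrite -ltnS; exact: leq_trans sa. Qed.

Lemma poly_slices_polyfun s a : poly_le s a -> poly_slices s (@polyfun R n a).
Proof.
(* [poly_slices_monomials] wants the exponents bounded for every index. They are replaced by 0 above
   degree [s], which never happens on the support of [a]. *)
move=> sa; rewrite (_ : polyfun a = fun x : Rn R n => \sum_(m <- msupp a)
    mcoeff m a * \prod_i (tnth x i : R) ^+ (if (mdeg m <= s)%N then m i else 0%N)).
  apply: poly_slices_monomials => m i; case: ifP => // ms.
  by apply: leq_trans ms; rewrite mdegE (bigD1 i) //= leq_addr.
apply/funext => x; rewrite polyfunE big_seq_cond [RHS]big_seq_cond.
apply: eq_bigr => m; rewrite andbT => ma; congr (_ * _).
by apply: eq_bigr => i _; rewrite (poly_le_mdeg sa ma).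
Qed.

Lemma measurable_monomial m : measurable_fun [set: Rn R n] (@monomial R n m).
Proof.
apply: measurable_prod => i _; apply: measurable_funX; exact: measurable_tnthR.
Qed.

Lemma measurable_polyfun a : measurable_fun [set: Rn R n] (@polyfun R n a).
Proof.
apply: (@eq_measurable_fun _ _ _ _ _
  (fun x => \sum_(m <- msupp a) mcoeff m a * monomial m x)).
  by move=> x _; rewrite polyfunE.
apply: measurable_sum => m; apply: measurable_funM => //.
exact: measurable_monomial.
Qed.

Lemma polyfun_bounded a (M : R) : exists B : R, forall x : Rn R n,
  (forall i, `|tnth x i| <= M) -> `|polyfun a x| <= B.
Proof.
exists (\sum_(m <- msupp a) `|mcoeff m a| * \prod_(i < n) M ^+ m i) => x xM.
rewrite polyfunE; apply: (le_trans (ler_norm_sum _ _ _)).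
apply: ler_sum => m _; rewrite normrM ler_pM // /monomial normr_prod.
by apply: ler_prod => i _; rewrite normr_ge0 normrX /= lerXn2r // ?nnegrE // (le_trans _ (xM i)).
Qed.

Lemma cube_bounded (Q : cube R n) : bounded_subset (cube_set Q).
Proof.
pose M := \sum_(i < n) (`|tnth (corner Q) i| + side Q).
exists M => x Qx i; have l0 := side_gt0 Q.
apply: (@le_trans _ _ (`|tnth (corner Q) i| + side Q)).
  have := ler_norm (tnth (corner Q) i); have := ler_norm (- tnth (corner Q) i).
  rewrite normrN; have := Qx i; rewrite in_itv /= => /andP[h1 h2].
  have {h1} : tnth (corner Q) i <= tnth x i by case: (lface Q i) h1 => // /ltW.
  have {h2} : tnth x i <= tnth (corner Q) i + side Q by case: (uface Q i) h2 => // /ltW.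
  by move=> h1 h2 h3 h4; rewrite ler_norml; apply/andP; split; lra.
by rewrite /M (bigD1 i) //= lerDl sumr_ge0 // => j _; rewrite addr_ge0 // ltW.
Qed.

Lemma polyfun_cube_bounded a (Q : cube R n) : exists B : R, forall x,
  cube_set Q x -> `|polyfun a x| <= B.
Proof.
have [M QM] := cube_bounded Q; have [B aB] := polyfun_bounded a M.
by exists B => x Qx; apply: aB; exact: QM.
Qed.

Lemma integrable_mul_polyfun (Q : cube R n) (f : Rn R n -> R) a :
  (leb R n).-integrable (cube_set Q) (EFin \o f) ->
  (leb R n).-integrable (cube_set Q) (EFin \o (f \* polyfun a)).
Proof.
move=> fi; have [B aB] := polyfun_cube_bounded a Q.
have mf := measurable_int _ fi.
have fB := integrableZl (measurable_cube Q) B fi.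
apply: (le_integrable (measurable_cube Q) _ _ fB).
  apply/measurable_EFinP; apply: measurable_funM; first exact/measurable_EFinP.
  by apply: measurable_funTS; exact: measurable_polyfun.
move=> x Qx /=; rewrite lee_fin !normrM mulrC; apply: ler_pM => //.
exact: le_trans (aB _ Qx) (ler_norm _).
Qed.

Lemma integrable_polyfun (Q : cube R n) a :
  (leb R n).-integrable (cube_set Q) (EFin \o polyfun a).
Proof.
have h : (leb R n).-integrable (cube_set Q) (EFin \o (cst 1 : Rn R n -> R)).
  apply: measurable_bounded_integrable => //; first exact: measurable_cube.
  - by rewrite [X in (X < _)%E]leb_cube ltry.
  - by exists 1; split => // y y1 x _ /=; rewrite normr1 ltW.
apply: (eq_integrable (measurable_cube Q) _ _ _ (integrable_mul_polyfun a h)).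
by move=> x _; rewrite /= mul1r.
Qed.

End mpoly_functions.

Section moment_projection.
Context {R : realType} (n : nat).
Implicit Types (Q : cube R n) (f : Rn R n -> R) (a b : mpoly n R).

Definition pairing Q f a : R :=
  \int[leb R n]_(x in cube_set Q) (f x * polyfun a x).

Lemma pairingD Q f a b : (leb R n).-integrable (cube_set Q) (EFin \o f) ->
  pairing Q f (a + b) = pairing Q f a + pairing Q f b.
Proof.
move=> fi; rewrite /pairing -RintegralD; first last.
- exact: integrable_mul_polyfun.
- exact: integrable_mul_polyfun.
- exact: measurable_cube.
by apply: eq_Rintegral => x _; rewrite polyfunD mulrDr.
Qed.

Lemma pairingZ Q f c a : (leb R n).-integrable (cube_set Q) (EFin \o f) ->
  pairing Q f (c *: a) = c * pairing Q f a.
Proof.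
move=> fi; rewrite /pairing -RintegralZl; first last.
- exact: integrable_mul_polyfun.
- exact: measurable_cube.
by apply: eq_Rintegral => x _; rewrite /polyfun mevalZ mulrCA.
Qed.

Lemma pairing_sum Q f (I : Type) (r : seq I) (c : I -> R) (F : I -> mpoly n R) :
  (leb R n).-integrable (cube_set Q) (EFin \o f) ->
  pairing Q f (\sum_(i <- r) c i *: F i) = \sum_(i <- r) c i * pairing Q f (F i).
Proof.
move=> fi; rewrite (big_morph (pairing Q f) (id1 := 0) (op1 := +%R)).
- by apply: eq_bigr => i _; rewrite pairingZ.
- by move=> a b; exact: pairingD.
- by rewrite -(scale0r (0 : mpoly n R)) pairingZ // mul0r.
Qed.

Lemma pairingBl Q f g a : (leb R n).-integrable (cube_set Q) (EFin \o f) ->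
  (leb R n).-integrable (cube_set Q) (EFin \o g) ->
  pairing Q (fun x => f x - g x) a = pairing Q f a - pairing Q g a.
Proof.
move=> fi gi; rewrite /pairing -RintegralB; first last.
- exact: integrable_mul_polyfun.
- exact: integrable_mul_polyfun.
- exact: measurable_cube.
by apply: eq_Rintegral => x _; rewrite mulrBl.
Qed.

(** The comparison is applied to the square of the polynomial, so that the mean is an L^2 pairing,
    to which orthogonality applies. The degree bound [(s.+1).*2] for the square is generous and
    affects only the constant. *)
Lemma polyfun_sqr_sup_mean (s : nat) : exists2 C : R, 0 < C &
  forall Q a x, poly_le s a -> cube_set Q x ->
    polyfun a x ^+ 2 <= C / side Q ^+ n * pairing Q (polyfun a) a.
Proof.
have [C C0 CP] := @poly_slices_sup_mean R (s.+1).*2 n.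
exists C => // Q a x sa Qx.
have saa : poly_le (s.+1).*2 (a * a).
  move: sa; rewrite /poly_le /= => sa; apply: (leq_trans (msizeM_le _ _)).
  by rewrite ltnS -addnn leq_add.
have := CP (polyfun (a * a)) Q (pairing Q (polyfun a) a) x.
rewrite polyfunM -expr2 ger0_norm ?sqr_ge0 //; apply => //.
- exact: measurable_polyfun.
- exact: poly_slices_polyfun.
have ii := integrable_mul_polyfun a (integrable_polyfun Q a).
rewrite /pairing /Rintegral fineK.
  rewrite le_eqVlt; apply/orP; left; apply/eqP; apply: eq_integral => y _.
  by rewrite polyfunM -expr2 ger0_norm ?sqr_ge0.
by apply: integrable_fin_num => //; exact: measurable_cube.
Qed.

Lemma moments_orthogonal s Q f a :
  (leb R n).-integrable (cube_set Q) (EFin \o f) -> poly_le s a ->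
  (forall b : multinom n, (mdeg b <= s)%N -> pairing Q f (mpolyX R b) = 0) ->
  pairing Q f a = 0.
Proof.
move=> fi sa f0.
rewrite [a]mpolyE pairing_sum // big_seq big1 // => m ma.
by rewrite f0 ?mulr0 //; exact: poly_le_mdeg ma.
Qed.

(** These are the normal equations [v *m G = w], with [G] the Gram matrix of the monomials of degree
    at most [s]. They are solvable because [w] annihilates every vector killed by [G]. *)
Lemma moments_solvable s Q f :
  (leb R n).-integrable (cube_set Q) (EFin \o f) ->
  exists2 a, poly_le s a &
    forall b : multinom n, (mdeg b <= s)%N ->
      pairing Q f (mpolyX R b) = pairing Q (polyfun a) (mpolyX R b).
Proof.
move=> fi; pose N := #|{: bmultinom n s.+1}|.
pose X (i : 'I_N) := mpolyX R (bmnm (enum_val i)).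
have XsP (c : 'I_N -> R) : poly_le s (\sum_i c i *: X i).
  by apply: poly_le_sumX => i; rewrite -ltnS; exact: bmdeg.
pose G := \matrix_(i < N, j < N) pairing Q (polyfun (X i)) (X j).
pose w := \row_(j < N) pairing Q f (X j).
have pairing_suml (c : 'I_N -> R) b :
    pairing Q (polyfun (\sum_i c i *: X i)) b = \sum_i c i * pairing Q (polyfun (X i)) b.
  have pC u v : pairing Q (polyfun u) v = pairing Q (polyfun v) u.
    by apply: eq_Rintegral => x _; rewrite mulrC.
  rewrite pC pairing_sum; last exact: integrable_polyfun.
  by apply: eq_bigr => i _; rewrite pC.
have wG : (w <= G)%MS.
  (* a vector killed by the Gram matrix is a polynomial of zero L^2 norm, hence
     vanishes on the cube and pairs to zero with [f] *)
  rewrite submxE; apply/eqP/matrixP => i k; rewrite !mxE.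
  pose K := cokermx G; pose c j := K j k; pose a := \sum_j c j *: X j.
  have Gc j : \sum_l G j l * c l = 0.
    transitivity ((G *m K) j k); last by rewrite mulmx_coker mxE.
    by rewrite [RHS]mxE.
  have a0 : pairing Q (polyfun a) a = 0.
    rewrite pairing_suml big1 // => j _; rewrite pairing_sum; last exact: integrable_polyfun.
    transitivity (c j * \sum_l G j l * c l); last by rewrite Gc mulr0.
    by congr (_ * _); apply: eq_bigr => l _; rewrite mxE mulrC.
  have [C C0 CP] := polyfun_sqr_sup_mean s.
  have aQ x : cube_set Q x -> polyfun a x = 0.
    move=> Qx; have := CP Q a x (XsP c) Qx; rewrite a0 mulr0 => h.
    by apply/eqP; rewrite -sqrf_eq0 eq_le h sqr_ge0.
  transitivity (pairing Q f a).
    by rewrite [RHS]pairing_sum //; apply: eq_bigr => j _; rewrite mxE mulrC.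
  rewrite /pairing; transitivity (\int[leb R n]_(x in cube_set Q) (cst 0 x : R)).
    by apply: eq_Rintegral => x /set_mem Qx; rewrite aQ // mulr0.
  by rewrite /Rintegral integral0_eq.
have /submxP[v wv] := wG.
exists (\sum_i v ord0 i *: X i); first exact: XsP.
move=> b bs; have bs' : (mdeg b < s.+1)%N by rewrite ltnS.
have -> : mpolyX R b = X (enum_rank (BMultinom bs')) by rewrite /X enum_rankK.
rewrite pairing_suml.
have /matrixP/(_ ord0 (enum_rank (BMultinom bs'))) := wv; rewrite !mxE => ->.
by apply: eq_bigr => i _; rewrite mxE.
Qed.

(** A solution exists, so the [xget] in the projection returns a solution and not its default;
    linearity carries orthogonality from monomials to all polynomials of degree at most [s]. *)
Lemma proj_polyP s Q f : (leb R n).-integrable (cube_set Q) (EFin \o f) ->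
  exists a, [/\ poly_le s a, proj_poly s Q f = polyfun a &
    forall b, poly_le s b -> pairing Q (fun x => f x - polyfun a x) b = 0].
Proof.
move=> fi; set S := [set a | poly_le s a /\ forall b : multinom n, (mdeg b <= s)%N ->
  (\int[leb R n]_(x in cube_set Q)
     ((f x - polyfun a x) * monomial b x)%:E)%E = 0%E].
have fai a : (leb R n).-integrable (cube_set Q) (EFin \o (fun x => f x - polyfun a x)).
  have := integrableB (measurable_cube Q) fi (integrable_polyfun Q a).
  by apply: (eq_integrable (measurable_cube Q)) => x _.
have SE a (b : multinom n) : (\int[leb R n]_(x in cube_set Q)
     ((f x - polyfun a x) * monomial b x)%:E)%E =
     (pairing Q (fun x => f x - polyfun a x) (mpolyX R b))%:E.
  rewrite /pairing /Rintegral fineK.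
    by apply: eq_integral => x _; rewrite polyfunX.
  apply: integrable_fin_num; first exact: measurable_cube.
  exact: (integrable_mul_polyfun (mpolyX R b) (fai a)).
have [a0 sa0 a0P] := moments_solvable s fi.
have Sa0 : S a0.
  split=> // b bs; rewrite SE pairingBl ?a0P ?subrr //; exact: integrable_polyfun.
have : S (xget 0 S) by exact: (xgetPex 0 (ex_intro _ a0 Sa0)).
move=> [sP PP]; exists (xget 0 S); split=> // b sb.
apply: (moments_orthogonal (fai _) sb) => m ms.
by apply/eqP; rewrite -eqe -SE; apply/eqP; exact: PP.
Qed.

(* With [g = f - b], the polynomial [a = proj f - b] satisfies [mean a^2 = mean (g a)]; comparing
   the supremum of [a^2] with its mean gives [sup |a|^2 <= C sup |a| mean |g|]. *)
Lemma proj_poly_sup_bound (s : nat) : exists2 C : R, 0 < C &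
  forall Q f b, (leb R n).-integrable (cube_set Q) (EFin \o f) -> poly_le s b ->
    exists2 a, proj_poly s Q f = polyfun a &
    forall x, cube_set Q x -> `|polyfun a x - polyfun b x| <=
     C / side Q ^+ n * \int[leb R n]_(x in cube_set Q) `|f x - polyfun b x|.
Proof.
have [C C0 CP] := polyfun_sqr_sup_mean s.
exists C => // Q f b fi sb; have [P [sP PE P0]] := proj_polyP s fi.
exists P => //; pose a := P - b.
have sa : poly_le s a by exact: poly_leB.
pose g := fun x => f x - polyfun b x; rewrite -/g.
have sub_int (u v : Rn R n -> R) : (leb R n).-integrable (cube_set Q) (EFin \o u) ->
    (leb R n).-integrable (cube_set Q) (EFin \o v) ->
    (leb R n).-integrable (cube_set Q) (EFin \o (fun x => u x - v x)).
  move=> ui vi; have := integrableB (measurable_cube Q) ui vi.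
  by apply: (eq_integrable (measurable_cube Q)) => x _.
have gi : (leb R n).-integrable (cube_set Q) (EFin \o g).
  by apply: sub_int => //; exact: integrable_polyfun.
have fPi : (leb R n).-integrable (cube_set Q) (EFin \o (fun x => f x - polyfun P x)).
  by apply: sub_int => //; exact: integrable_polyfun.
have agE : pairing Q (polyfun a) a = pairing Q g a.
  rewrite -[RHS]subr0 -(P0 a sa) -pairingBl //.
  by apply: eq_Rintegral => x _; rewrite /g /a polyfunB; congr (_ * _); lra.
set T := C / side Q ^+ n * _.
pose S := sup [set `|polyfun a x| | x in cube_set Q].
have [B aB] := polyfun_cube_bounded a Q.
have aS x : cube_set Q x -> `|polyfun a x| <= S.
  move=> Qx; apply: ub_le_sup; last by exists x.
  by exists B => _ [y Qy <-]; exact: aB.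
have T0 : 0 <= T.
  rewrite mulr_ge0 //; last by apply: Rintegral_ge0.
  by rewrite divr_ge0 // ?ltW // exprn_gt0 // side_gt0.
have gaT : C / side Q ^+ n * pairing Q g a <= S * T.
  rewrite /T mulrCA ler_pM2l; last by rewrite divr_gt0 // exprn_gt0 // side_gt0.
  have gi' : (leb R n).-integrable (cube_set Q) (EFin \o (fun x => `|g x|)).
    exact: (integrable_norm gi).
  rewrite -RintegralZl //; last exact: measurable_cube.
  apply: le_Rintegral; first exact: measurable_cube.
  - exact: integrable_mul_polyfun.
  - have := integrableZl (measurable_cube Q) S gi'.
    by apply: (eq_integrable (measurable_cube Q)) => x _; rewrite /= EFinM.
  - move=> x Qx; apply: le_trans (ler_norm _) _; rewrite normrM mulrC ler_pM //.
    exact: aS.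
have ST x : cube_set Q x -> polyfun a x ^+ 2 <= S * T.
  by move=> Qx; apply: le_trans gaT; rewrite -agE; exact: CP.
move=> x Qx; rewrite -polyfunB -/a; apply: (le_trans (aS _ Qx)).
have S0 : 0 <= S := le_trans (normr_ge0 _) (aS _ Qx).
(* The bound on the squares gives [S ^+ 2 <= S * T] for the supremum through square roots, and a
   factor [S] cancels unless it is 0. *)
have Ssqrt : S <= Num.sqrt (S * T).
  apply: ge_sup; first by exists (`|polyfun a x|), x.
  by move=> _ [y Qy <-]; rewrite -sqrtr_sqr ler_wsqrtr // ST.
move: S0; rewrite le_eqVlt => /predU1P[<- //|S0].
have ST0 : 0 <= S * T by exact: mulr_ge0 (ltW S0) T0.
rewrite -(ler_pM2l S0) -[leRHS](sqr_sqrtr ST0) -expr2.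
by rewrite lerXn2r ?nnegrE ?(ltW S0) ?sqrtr_ge0.
Qed.

End moment_projection.

(** * Means over cubes *)

Section poweR_facts.
Context {R : realType}.
Local Open Scope ereal_scope.

Lemma le_poweR (r : R) (x y : \bar R) : (0 <= r)%R -> 0 <= x -> x <= y ->
  x `^ r <= y `^ r.
Proof.
move=> r0 x0 xy; apply: gt0_ler_poweR => //; rewrite in_itv /= leey andbT //.
exact: le_trans xy.
Qed.

Lemma poweRK (r : R) (x : \bar R) : r != 0%R -> 0 <= x -> (x `^ r) `^ r^-1 = x.
Proof. by move=> r0 x0; rewrite -poweRrM divff // poweRe1. Qed.

Lemma poweRVK (r : R) (x : \bar R) : r != 0%R -> 0 <= x -> (x `^ r^-1) `^ r = x.
Proof. by move=> r0 x0; rewrite -poweRrM mulVf // poweRe1. Qed.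

Lemma esum_le_scale (T : choiceType) (I : set T) (c : \bar R) (a b : T -> \bar R) :
  0 <= c -> (forall i, 0 <= b i) -> (forall i, I i -> a i <= c * b i) ->
  \esum_(i in I) a i <= c * \esum_(i in I) b i.
Proof.
move=> c0 b0 ab; apply: ge_ereal_sup => _ [A [finA AI] <-].
apply: (@le_trans _ _ (\sum_(i \in A) c * b i)).
  by apply: lee_fsum => // i Ai; exact/ab/AI.
rewrite -ge0_mule_fsumr //; apply: lee_wpmul2l => //.
by apply: esum_ge; exists A.
Qed.

End poweR_facts.

Section mean_facts.
Context {R : realType} (n : nat).
Implicit Types (Q : cube R n) (f g : Rn R n -> R).
Local Open Scope ereal_scope.

Lemma cube_vol_gt0 Q : (0 < side Q ^+ n)%R.
Proof. by rewrite exprn_gt0 // side_gt0. Qed.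

Lemma meanE Q (u : Rn R n -> \bar R) :
  mean Q u = ((side Q ^+ n)^-1)%:E * \int[leb R n]_(x in cube_set Q) u x.
Proof. by rewrite /mean [X in fine X]leb_cube. Qed.

Lemma integral_meanE Q (u : Rn R n -> \bar R) :
  \int[leb R n]_(x in cube_set Q) u x = (side Q ^+ n)%:E * mean Q u.
Proof.
by rewrite meanE muleA -EFinM divff ?mul1e // gt_eqF // cube_vol_gt0.
Qed.

Lemma mean_ge0 Q (u : Rn R n -> \bar R) : (forall x, 0 <= u x) -> 0 <= mean Q u.
Proof.
move=> u0; rewrite meanE mule_ge0 //; last by apply: integral_ge0.
by rewrite lee_fin invr_ge0 ltW // cube_vol_gt0.
Qed.

Lemma le_mean Q (u v : Rn R n -> \bar R) :
  measurable_fun (cube_set Q) u -> measurable_fun (cube_set Q) v ->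
  (forall x, cube_set Q x -> 0 <= u x <= v x) -> mean Q u <= mean Q v.
Proof.
move=> mu_ mv uv; rewrite !meanE; apply: lee_wpmul2l.
  by rewrite lee_fin invr_ge0 ltW // cube_vol_gt0.
apply: ge0_le_integral => //; first exact: measurable_cube.
- by move=> x /uv/andP[].
- by move=> x /uv/andP[].
Qed.

Lemma mean_cst Q (c : R) : mean Q (cst c%:E) = c%:E.
Proof.
rewrite meanE integral_cst; last exact: measurable_cube.
rewrite [X in _ * (_ * X)]leb_cube -!EFinM mulrCA mulVf ?mulr1 //.
by rewrite gt_eqF // cube_vol_gt0.
Qed.

Lemma ge0_meanD Q (u v : Rn R n -> \bar R) :
  measurable_fun (cube_set Q) u -> measurable_fun (cube_set Q) v ->
  (forall x, 0 <= u x) -> (forall x, 0 <= v x) ->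
  mean Q (fun x => u x + v x) = mean Q u + mean Q v.
Proof.
move=> mu_ mv u0 v0; rewrite !meanE ge0_integralD //; last exact: measurable_cube.
by rewrite ge0_muleDr //; exact: integral_ge0.
Qed.

Lemma ge0_meanZl Q (c : R) (u : Rn R n -> \bar R) :
  measurable_fun (cube_set Q) u -> (forall x, 0 <= u x) -> (0 <= c)%R ->
  mean Q (fun x => c%:E * u x) = c%:E * mean Q u.
Proof.
move=> mu_ u0 c0; rewrite !meanE ge0_integralZl //; last exact: measurable_cube.
by rewrite muleCA.
Qed.

Lemma measurable_norm_powR (D : set (Rn R n)) f (q : R) :
  measurable_fun D f -> measurable_fun D (fun x => (`|f x| `^ q)%:E).
Proof.
move=> mf; apply/measurable_EFinP.
exact: (measurableT_comp (measurable_powR q) (measurableT_comp (@normr_measurable R setT) mf)).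
Qed.

End mean_facts.

Section jensen.
Context {R : realType} (n : nat).
Implicit Types (Q : cube R n) (f g : Rn R n -> R).

(** A rough form of the tangent line inequality for the convex power [q]: above the level [l], the
    factor [x^(1 - q)] is at most [l^(1 - q)]. *)
Lemma powR_tangent (q l x : R) : 1 <= q -> 0 < l -> 0 <= x ->
  x <= l + l `^ (1 - q) * x `^ q.
Proof.
move=> q1 l0 x0; have [xl|lx] := leP x l.
  by rewrite (le_trans xl) // lerDl mulr_ge0 // powR_ge0.
apply: (@le_trans _ _ (l `^ (1 - q) * x `^ q)); last by rewrite lerDr ltW.
have x0' : 0 < x := lt_trans l0 lx.
rewrite -{1}[x]powRr1 // -[in leLHS](subrK q 1) powRD; last by rewrite (gt_eqF x0') implybT.
apply: ler_wpM2r; first exact: powR_ge0.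
rewrite -(opprB q 1) !powRN lef_pV2 ?posrE ?powR_gt0 //.
by apply: ge0_ler_powR; rewrite ?nnegrE ?subr_ge0 ?(ltW lx) ?(ltW l0).
Qed.

Local Open Scope ereal_scope.

(** Jensen's inequality up to a factor 2. Averaging [powR_tangent] gives the bound
    [l + l^(1 - q) m], and at [l = m^(1/q)] both terms equal [m^(1/q)]. *)
Lemma mean_le_poweR_mean Q g (q : R) : (1 <= q)%R ->
  measurable_fun (cube_set Q) g ->
  mean Q (fun x => `|g x|%:E) <= 2%:E * mean Q (fun x => (`|g x| `^ q)%:E) `^ q^-1.
Proof.
move=> q1 mg; have q0 : (0 < q)%R by exact: lt_le_trans q1.
set m := mean Q (fun x => (`|g x| `^ q)%:E).
have m0 : 0 <= m by apply: mean_ge0 => x; rewrite lee_fin powR_ge0.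
have mg1 : measurable_fun (cube_set Q) (fun x => `|g x|%:E).
  by apply/measurable_EFinP; exact: (measurableT_comp (@normr_measurable R setT) mg).
have mgq := measurable_norm_powR q mg.
have tangent (l : R) : (0 < l)%R ->
    mean Q (fun x => `|g x|%:E) <= l%:E + (l `^ (1 - q))%:E * m.
  move=> l0; rewrite /m -ge0_meanZl ?powR_ge0 //.
  rewrite -(mean_cst Q l) -ge0_meanD //; last 3 first.
  - exact: measurable_funeM.
  - by move=> x; rewrite lee_fin ltW.
  - by move=> x; rewrite -EFinM lee_fin mulr_ge0 // powR_ge0.
  apply: le_mean => //.
    by apply: emeasurable_funD => //; exact: measurable_funeM.
  by move=> x _; rewrite lee_fin normr_ge0 /= -EFinM -EFinD lee_fin powR_tangent.
(* For [m = 0] the best level is not positive; there every [l > 0] bounds the mean, which is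
   therefore 0. *)
have [m_eq0|mneq0] := eqVneq m 0.
  rewrite m_eq0 poweR0r ?invr_eq0 ?gt_eqF // mule0; apply/lee_addgt0Pr => e e0.
  by have := tangent _ e0; rewrite m_eq0 mule0 adde0 add0e.
have [mfin|] := boolP (m \is a fin_num); last first.
  rewrite ge0_fin_numE // -leNgt leye_eq => /eqP ->.
  by rewrite poweRyr ?invr_eq0 ?gt_eqF // gt0_muley ?leey.
rewrite -(fineK mfin) poweR_EFin.
set r := fine m; have r0 : (0 < r)%R by rewrite fine_gt0 // lt0e mneq0 m0 /= -ge0_fin_numE.
have l0 : (0 < r `^ q^-1)%R by rewrite powR_gt0.
apply: (le_trans (tangent _ l0)).
rewrite -(fineK mfin) -/r -!EFinM -EFinD lee_fin.
have -> : ((r `^ q^-1) `^ (1 - q) * r = r `^ q^-1)%R; last lra.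
rewrite -powRrM -{2}(powRr1 (ltW r0)) -powRD; last by rewrite (gt_eqF r0) implybT.
by rewrite mulrBr mulr1 mulVf ?gt_eqF // subrK.
Qed.

End jensen.

Section near_best.
Context {R : realType} (n : nat).
Implicit Types (Q : cube R n) (f g : Rn R n -> R).

(** The sum is at most twice the larger term. *)
Lemma powR_add_le (q x y : R) : 0 <= q -> 0 <= x -> 0 <= y ->
  (x + y) `^ q <= 2 `^ q * (x `^ q + y `^ q).
Proof.
move=> q0; wlog xy : x y / x <= y => [h x0 y0|x0 y0].
  have [xy|/ltW yx] := leP x y; first exact: h.
  by rewrite addrC [X in _ * X]addrC h.
apply: (@le_trans _ _ ((2 * y) `^ q)).
  by apply: ge0_ler_powR; rewrite ?nnegrE ?addr_ge0 ?mulr_ge0 //; lra.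
by rewrite powRM // ler_wpM2l ?powR_ge0 // lerDr powR_ge0.
Qed.

Lemma measurable_sub_polyfun Q f (a : mpoly n R) : measurable_fun (cube_set Q) f ->
  measurable_fun (cube_set Q) (fun x => f x - polyfun a x).
Proof.
move=> mf; apply: measurable_funB => //; apply: measurable_funTS.
exact: measurable_polyfun.
Qed.

(** The distance from the projection to [b] is bounded uniformly on [Q] by a multiple of the mean of
    [|f - b|], hence of the [1/q] power of the mean of [|f - b|^q]. The triangle inequality for
    [q]-th powers can then be applied pointwise. *)
Lemma mean_proj_poly_le (s : nat) (q : R) : 1 <= q -> exists2 K : R, 0 < K &
  forall Q f (b : mpoly n R), (leb R n).-integrable (cube_set Q) (EFin \o f) ->
    poly_le s b ->
  (mean Q (fun x => (`|f x - proj_poly s Q f x| `^ q)%:E) <=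
   K%:E * mean Q (fun x => (`|f x - polyfun b x| `^ q)%:E))%E.
Proof.
move=> q1; have q0 : 0 < q by exact: lt_le_trans q1.
have [C C0 CP] := @proj_poly_sup_bound R n s.
exists (2 `^ q * (1 + (2 * C) `^ q)).
  by rewrite mulr_gt0 ?powR_gt0 // ltr_pwDl // powR_ge0.
move=> Q f b fi sb; have [a aE aP] := CP Q f b fi sb; rewrite aE.
have mf : measurable_fun (cube_set Q) f by apply/measurable_EFinP; exact: measurable_int fi.
have mg := measurable_sub_polyfun b mf.
set m := mean Q _; set m' := mean Q _.
have m'0 : (0 <= m')%E by apply: mean_ge0 => x; rewrite lee_fin powR_ge0.
have K0 : 0 < 2 `^ q * (1 + (2 * C) `^ q).
  by rewrite mulr_gt0 ?powR_gt0 // ltr_pwDl // powR_ge0.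
have [mfin|] := boolP (m' \is a fin_num); last first.
  by rewrite ge0_fin_numE // -leNgt leye_eq => /eqP ->; rewrite gt0_muley ?leey ?lte_fin.
pose t := C * (2 * fine m' `^ q^-1).
have r0 : 0 <= fine m' by exact: fine_ge0.
have t0 : 0 <= t by rewrite !mulr_ge0 ?powR_ge0 // ltW.
have at_ x : cube_set Q x -> `|polyfun a x - polyfun b x| <= t.
  move=> Qx; apply: (le_trans (aP x Qx)).
  rewrite -mulrA ler_pM2l // -lee_fin.
  have := mean_le_poweR_mean q1 mg; rewrite -/m' -(fineK mfin) poweR_EFin -EFinM.
  apply: le_trans; rewrite meanE EFinM; apply: lee_wpmul2l.
    by rewrite lee_fin invr_ge0 ltW // cube_vol_gt0.
  rewrite /Rintegral fineK //; apply: integrable_fin_num; first exact: measurable_cube.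
  apply: (integrable_norm (f := fun x => f x - polyfun b x)).
  have := integrableB (measurable_cube Q) fi (integrable_polyfun Q b).
  by apply: (eq_integrable (measurable_cube Q)) => y _.
have tq : t `^ q = (2 * C) `^ q * fine m'.
  have C2 : 0 <= 2 * C by rewrite mulr_ge0 // ltW.
  rewrite /t mulrA (mulrC C) (powRM q C2 (powR_ge0 _ _)) -powRrM.
  by rewrite mulVf ?gt_eqF // powRr1.
apply: (@le_trans _ _ (mean Q (fun x => (2 `^ q)%:E *
    ((`|f x - polyfun b x| `^ q)%:E + (t `^ q)%:E)))%E).
  apply: le_mean.
  - exact: (measurable_norm_powR q (measurable_sub_polyfun a mf)).
  - apply: measurable_funeM; apply: emeasurable_funD => //.
    exact: (measurable_norm_powR q mg).
  - move=> x Qx; rewrite lee_fin powR_ge0 /= -EFinD -EFinM lee_fin.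
    apply: le_trans (powR_add_le (ltW q0) (normr_ge0 _) t0).
    apply: ge0_ler_powR; rewrite ?nnegrE ?addr_ge0 ?(ltW q0) //.
    rewrite (_ : f x - polyfun a x = (f x - polyfun b x) - (polyfun a x - polyfun b x)).
      by rewrite (le_trans (ler_normB _ _)) // lerD2l at_.
    by lra.
have mgq := measurable_norm_powR q mg.
have gq0 x : (0 <= (`|f x - polyfun b x| `^ q)%:E)%E by rewrite lee_fin powR_ge0.
have tq0 (x : Rn R n) : (0 <= (t `^ q)%:E)%E by rewrite lee_fin powR_ge0.
rewrite ge0_meanZl ?powR_ge0 //; first last.
- move=> x. exact: adde_ge0 (gq0 _) (tq0 x).
- by apply: emeasurable_funD => //.
rewrite ge0_meanD //.
rewrite mean_cst -/m' -(fineK mfin) tq -EFinD -!EFinM lee_fin /= -mulrA.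
by rewrite ler_pM2l ?powR_gt0 // [leRHS]mulrDl mul1r.
Qed.

End near_best.

(** * Summing integrals over cubes with disjoint interiors *)

Section disjoint_cubes.
Context {R : realType} (n : nat).
Implicit Types (Q : cube R n) (X : domain R n).
Local Open Scope ereal_scope.

Definition interior_cube Q : cube R n :=
  Cube (corner Q) (fun=> false) (fun=> false) (side_gt0 Q).

Lemma cube_interiorE Q : cube_interior Q = cube_set (interior_cube Q).
Proof. by []. Qed.

Lemma cube_interior_sub Q : cube_interior Q `<=` cube_set Q.
Proof.
move=> x Qx i; have := Qx i; rewrite !in_itv /= => /andP[h1 h2].
by case: (lface Q i); case: (uface Q i); rewrite /= ?h1 ?h2 ?(ltW h1) ?(ltW h2).
Qed.

(** A cube and its interior have the same finite volume, so the boundary is negligible. *)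
Lemma integral_cube_interior Q (u : Rn R n -> \bar R) :
  measurable_fun (cube_set Q) u -> (forall x, 0 <= u x) ->
  \int[leb R n]_(x in cube_set Q) u x = \int[leb R n]_(x in cube_interior Q) u x.
Proof.
move=> mu_ u0; have mQ := measurable_cube Q.
have mI : measurable (cube_interior Q) by exact: (measurable_cube (interior_cube Q)).
have IQ := @cube_interior_sub Q.
rewrite (@ge0_negligible_integral _ _ _ _ _ (cube_set Q `\` cube_interior Q)) //.
- by rewrite setDD setIidr.
- exact: measurableD.
rewrite measureD //; last by rewrite [X in X < _]leb_cube ltry.
by rewrite setIidr // cube_interiorE [X in X - _]leb_cube [X in _ - X]leb_cube subee.
Qed.

Lemma measurable_domain X : measurable (domain_set X).
Proof. by case: X => [|Q] //=; exact: measurable_cube. Qed.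

(** The cubes may share parts of their faces, so the integrals are moved to the interiors, where
    additivity over a finite subfamily applies. *)
Lemma esum_integral_cubes X F (u : Rn R n -> \bar R) : cube_family X F ->
  measurable_fun (domain_set X) u -> (forall x, 0 <= u x) ->
  \esum_(j in F.1) \int[leb R n]_(x in cube_set (F.2 j)) u x <=
  \int[leb R n]_(x in domain_set X) u x.
Proof.
move=> [FX Ft] mu_ u0; apply: ge_ereal_sup => _ [A [finA AF] <-].
rewrite fsbig_finite //.
pose G j := cube_interior (F.2 j).
have mG j : measurable (G j) by exact: (measurable_cube (interior_cube (F.2 j))).
have inA j : j \in fset_set A -> F.1 j.
  by move=> jA; apply: AF; move: jA; rewrite in_fset_set // => /set_mem.
have GX : \big[setU/set0]_(j <- fset_set A) G j `<=` domain_set X.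
  rewrite -bigcup_seq => x [j /= jA Gx]; apply: (FX j (inA j jA)).
  exact: cube_interior_sub.
have mX := measurable_domain X.
rewrite (_ : \sum_(j <- fset_set A) _ =
    \int[leb R n]_(x in \big[setU/set0]_(j <- fset_set A) G j) u x).
  apply: ge0_subset_integral => //.
  by apply: bigsetU_measurable => j _; exact: mG.
rewrite ge0_integral_bigsetU //=.
- rewrite big_seq [RHS]big_seq; apply: eq_bigr => j jA.
  rewrite integral_cube_interior //; apply: measurable_funS mu_ => //.
  exact: FX (inA j jA).
- by apply: sub_trivIset Ft => j /=; exact: inA.
- by apply: measurable_funS mu_.
Qed.

End disjoint_cubes.

Local Opaque leb.

(** * Parts (i) and (ii) *)

Section embeddings.
Context {R : realType} (n : nat).
Implicit Types (Q : cube R n) (X : domain R n) (f g : Rn R n -> R).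
Implicit Types (p q alpha c K : R) (s : nat).

Lemma lte_EFin_mul c (x : \bar R) : 0 <= c -> (x < +oo)%E -> (c%:E * x < +oo)%E.
Proof. by move=> c0 xoo; rewrite lte_mul_pinfty ?lee_fin. Qed.

Lemma Lp_normE p X f : 0 < p ->
  (Lp_norm p X f = (\int[leb R n]_(x in domain_set X) (`|f x| `^ p)%:E) `^ p^-1)%E.
Proof.
move=> p0; rewrite /Lp_norm unlock; apply: (congr1 (fun z => (z `^ p^-1)%E)).
rewrite [RHS]integral_mkcond; apply: eq_integral => x _ /=.
rewrite patchE indicE; have [xX|xX] := boolP (x \in domain_set X); rewrite /=.
  by rewrite mulr1 -poweR_EFin.
by rewrite mulr0 normr0 powR0 ?gt_eqF.
Qed.

Lemma Lp_norm_lty p X f : 0 < p ->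
  (Lp_norm p X f < +oo)%E =
  (\int[leb R n]_(x in domain_set X) (`|f x| `^ p)%:E < +oo)%E.
Proof.
move=> p0; rewrite Lp_normE //; apply/idP/idP; last exact: poweR_lty.
by apply: lty_poweRy; rewrite invr_eq0 gt_eqF.
Qed.

Lemma integral_restrict_powR q X (E : set (Rn R n)) f : 0 < q ->
  E `<=` domain_set X ->
  (\int[leb R n]_(x in domain_set X) (`|(f \* \1_E) x| `^ q)%:E =
   \int[leb R n]_(x in E) (`|f x| `^ q)%:E)%E.
Proof.
move=> q0 EX; rewrite integral_mkcond [RHS]integral_mkcond.
apply: eq_integral => x _; rewrite !patchE /= indicE.
have [xE|xE] := boolP (x \in E).
  by rewrite mulr1 ifT //; apply/mem_set/EX/set_mem.
by rewrite mulr0 normr0 powR0 ?gt_eqF //; case: ifP.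
Qed.

Lemma Lq_loc_cube q X f Q : 0 < q -> Lq_loc q X f -> cube_set Q `<=` domain_set X ->
  measurable_fun (cube_set Q) f /\
  (\int[leb R n]_(x in cube_set Q) (`|f x| `^ q)%:E < +oo)%E.
Proof.
move=> q0 [mf fq] QX; split.
  by apply: measurable_funS mf => //; exact: measurable_domain.
have [_] := fq _ (measurable_cube Q) QX (cube_bounded Q).
move=> h; have {}h : (Lp_norm q X (f \* \1_(cube_set Q))%R < +oo)%E := h.
rewrite (Lp_norm_lty _ _ q0) in h.
rewrite -(integral_restrict_powR f q0 QX).
exact: h.
Qed.

Lemma powR_integrable q Q f : 1 <= q -> measurable_fun (cube_set Q) f ->
  (\int[leb R n]_(x in cube_set Q) (`|f x| `^ q)%:E < +oo)%E ->
  (leb R n).-integrable (cube_set Q) (EFin \o f).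
Proof.
move=> q1 mf fq; apply/integrableP; split; first exact/measurable_EFinP.
have := mean_le_poweR_mean q1 mf; rewrite meanE => h.
have mfin : (mean Q (fun x => (`|f x| `^ q)%:E) < +oo)%E.
  rewrite meanE; apply: lte_EFin_mul fq.
  by rewrite invr_ge0 ltW // cube_vol_gt0.
have mfin' : (2%:E * mean Q (fun x => (`|f x| `^ q)%:E) `^ q^-1 < +oo)%E.
  by apply: lte_EFin_mul (ler0n _ 2) _; exact: poweR_lty mfin.
have {h} := le_lt_trans h mfin'.
rewrite -/(mean _ _) -meanE => h.
have -> : (\int[leb R n]_(x in cube_set Q) `|(EFin \o f) x| =
  (side Q ^+ n)%:E * mean Q (fun x => `|f x|%:E))%E by rewrite -integral_meanE.
exact: lte_EFin_mul (ltW (cube_vol_gt0 Q)) h.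
Qed.

Lemma Lq_loc_integrable q X f Q : 1 <= q -> Lq_loc q X f ->
  cube_set Q `<=` domain_set X -> (leb R n).-integrable (cube_set Q) (EFin \o f).
Proof.
move=> q1 fq QX; have q0 : 0 < q by exact: lt_le_trans q1.
by have [mf fQ] := Lq_loc_cube q0 fq QX; exact: powR_integrable fQ.
Qed.

(** Isolates the dependence of a summand on the [q]-mean, so that an inequality between means
    becomes one between summands. *)
Definition scaled_mean p q alpha Q (m : \bar R) : \bar R :=
  let V := leb R n (cube_set Q) in (V * (V `^ (- alpha) * m `^ q^-1) `^ p)%E.

Lemma scaled_mean_ge0 p q alpha Q m : (0 <= scaled_mean p q alpha Q m)%E.
Proof. by rewrite mule_ge0 // poweR_ge0. Qed.

Lemma scaled_mean_le p q alpha Q K (m1 m2 : \bar R) : 0 < p -> 0 < q -> 0 <= K ->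
  (0 <= m1)%E -> (0 <= m2)%E -> (m1 <= K%:E * m2)%E ->
  (scaled_mean p q alpha Q m1 <=
   ((K `^ q^-1) `^ p)%:E * scaled_mean p q alpha Q m2)%E.
Proof.
move=> p0 q0 K0 m10 m20 m12; rewrite /scaled_mean muleCA; apply: lee_wpmul2l => //.
rewrite -poweR_EFin -poweRM ?lee_fin ?powR_ge0 //; last first.
  by rewrite mule_ge0 // poweR_ge0.
apply: le_poweR; [exact: ltW|by rewrite mule_ge0 // poweR_ge0|].
rewrite muleCA; apply: lee_wpmul2l; first exact: poweR_ge0.
rewrite -poweR_EFin -poweRM ?lee_fin //.
by apply: le_poweR => //; rewrite invr_ge0 ltW.
Qed.

Lemma cube_termE p q alpha P f Q : cube_term p q alpha P f Q =
  scaled_mean p q alpha Q (mean Q (fun x => (`|f x - P Q f x| `^ q)%:E)).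
Proof. by []. Qed.

Lemma cube_term_ge0 p q alpha P f Q : (0 <= cube_term p q alpha P f Q)%E.
Proof. exact: scaled_mean_ge0. Qed.

(** The empty family is admissible, so the supremum is not over an empty set. *)
Lemma JN_sup_ge0 p q alpha P X f : (0 <= JN_sup p q alpha P X f)%E.
Proof.
pose Q0 : cube R n := @Cube R n [tuple (0 : R) | i < n] 1 xpred0 xpred0 ltr01.
pose t := ((\esum_(j in (set0 : set nat)) cube_term p q alpha P f Q0) `^ p^-1)%E.
have t0 : (0 <= t)%E by exact: poweR_ge0.
apply: (le_trans t0).
apply: ereal_sup_ubound; exists (set0, fun=> Q0) => //=.
by split=> [j []|i j []].
Qed.

Lemma esum_le_JN_sup p q alpha P X f F : 0 < p -> cube_family X F ->
  (\esum_(j in F.1) cube_term p q alpha P f (F.2 j) <=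
   JN_sup p q alpha P X f `^ p)%E.
Proof.
move=> p0 XF; rewrite -[leLHS](@poweRVK _ p) ?gt_eqF //; last first.
  by apply: esum_ge0 => j _; exact: cube_term_ge0.
apply: le_poweR; [exact: ltW|exact: poweR_ge0|].
by apply: ereal_sup_ubound; exists F.
Qed.

Lemma cube_term_le_JN_sup p q alpha P X f Q : 0 < p ->
  cube_set Q `<=` domain_set X ->
  (cube_term p q alpha P f Q <= JN_sup p q alpha P X f `^ p)%E.
Proof.
move=> p0 QX; have := @esum_le_JN_sup p q alpha P X f ([set 0%N], fun=> Q) p0.
rewrite /= esum_set1 ?cube_term_ge0 //; apply; split=> // i j -> -> //.
Qed.

Lemma JN_sup_le_scale p q alpha P1 P2 X f g c : 0 < p -> 0 <= c ->
  (forall Q, cube_set Q `<=` domain_set X ->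
    (cube_term p q alpha P1 f Q <= c%:E * cube_term p q alpha P2 g Q)%E) ->
  (JN_sup p q alpha P1 X f <= (c `^ p^-1)%:E * JN_sup p q alpha P2 X g)%E.
Proof.
move=> p0 c0 PQ; apply: ge_ereal_sup => _ [F XF <-].
apply: (@le_trans _ _ ((c%:E * \esum_(j in F.1) cube_term p q alpha P2 g (F.2 j)) `^ p^-1)%E).
  apply: le_poweR; first by rewrite invr_ge0 ltW.
  - by apply: esum_ge0 => j _; exact: cube_term_ge0.
  - apply: esum_le_scale => [|j|j Fj]; [by rewrite lee_fin|exact: cube_term_ge0|].
    by apply: PQ; case: XF => + _; exact.
rewrite poweRM ?lee_fin //; last by apply: esum_ge0 => j _; exact: cube_term_ge0.
rewrite poweR_EFin; apply: lee_wpmul2l; first by rewrite lee_fin powR_ge0.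
by apply: ereal_sup_ubound; exists F.
Qed.

Lemma proj_poly_cutP s c0 Q f : (leb R n).-integrable (cube_set Q) (EFin \o f) ->
  exists2 b, poly_le s b & proj_poly_cut s c0 Q f = polyfun b.
Proof.
move=> fi; rewrite /proj_poly_cut; case: ifP => _.
  by have [a [sa aE _]] := proj_polyP s fi; exists a.
by exists 0; [exact: poly_le0|apply/funext => x; rewrite /polyfun meval0].
Qed.

Lemma add_polyfun0 f : (f \+ polyfun 0)%R = f.
Proof. by apply/funext => x; rewrite /= /polyfun meval0 addr0. Qed.

(** If [b] is what the truncated projection subtracts from [f + a], be it a projection or 0, then
    [b - a] is a competitor for the projection of [f], with the same remainder. Taking [a = 0] gives
    (i); letting [a] vary gives one inequality of (ii). *)
Lemma JN_le_jn_add p q s alpha : 0 < p -> 1 <= q -> exists2 C : R, 0 < C &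
  forall X c0 f (a : mpoly n R), Lq_loc q X f -> poly_le s a ->
  (JN_sup p q alpha (proj_poly s) X f <=
   C%:E * JN_sup p q alpha (proj_poly_cut s c0) X (f \+ polyfun a)%R)%E.
Proof.
move=> p0 q1; have q0 : 0 < q by exact: lt_le_trans q1.
have [K K0 KP] := @mean_proj_poly_le R n s q q1.
exists ((((K `^ q^-1) `^ p)) `^ p^-1); first by rewrite !powR_gt0.
move=> X c0 f a fq sa; apply: JN_sup_le_scale => //; first exact: powR_ge0.
move=> Q QX; have fi := Lq_loc_integrable q1 fq QX.
have fai : (leb R n).-integrable (cube_set Q) (EFin \o (f \+ polyfun a)).
  have := integrableD (measurable_cube Q) fi (integrable_polyfun Q a).
  by apply: (eq_integrable (measurable_cube Q)) => x _.
have [b sb bE] := proj_poly_cutP s c0 fai.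
rewrite !cube_termE; apply: scaled_mean_le => //; first exact: ltW.
- by apply: mean_ge0 => x; rewrite lee_fin powR_ge0.
- by apply: mean_ge0 => x; rewrite lee_fin powR_ge0.
suff -> : (fun x => (`|(f \+ polyfun a) x - proj_poly_cut s c0 Q (f \+ polyfun a) x| `^ q)%:E)
    = fun x => (`|f x - polyfun (b - a) x| `^ q)%:E.
  exact: (KP Q f (b - a) fi (poly_leB sb sa)).
apply/funext => x; rewrite bE polyfunB /=.
by rewrite opprB addrCA addrA [polyfun a x + _]addrC.
Qed.

Lemma jn_cembed_JN p q s alpha X c0 : 0 < p -> 1 <= q ->
  cembed (jn p q s alpha c0 X) (JN p q s alpha X).
Proof.
move=> p0 q1; have [C C0 CP] := @JN_le_jn_add p q s alpha p0 q1.
have le f : Lq_loc q X f -> (JN_sup p q alpha (proj_poly s) X f <=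
    C%:E * JN_sup p q alpha (proj_poly_cut s c0) X f)%E.
  move=> fq; apply: (le_trans (CP X c0 f 0 fq (@poly_le0 R n s))).
  rewrite le_eqVlt; apply/orP; left; apply/eqP; congr (_ * JN_sup _ _ _ _ _ _)%E.
  by apply/funext => x; rewrite /= /polyfun meval0 addr0.
split=> [f [fq fs]|]; last by exists C => // f [fq _]; exact: le.
split; first exact: fq.
exact: le_lt_trans (le f fq) (lte_EFin_mul (ltW C0) fs).
Qed.

(** The right-hand side is [c^(- alpha)], written so as to display the weight of the ambient volume
    [V0]. *)
Lemma powRN_le_ratio alpha (V0 V c : R) : 0 <= alpha -> 0 < V0 -> 0 < c -> c <= V ->
  V `^ (- alpha) <= (V0 / c) `^ alpha * V0 `^ (- alpha).
Proof.
move=> a0 V00 c0 cV; have V1 : 0 < V := lt_le_trans c0 cV.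
have ci0 : 0 <= c^-1 by rewrite invr_ge0 ltW.
rewrite (powRM alpha (ltW V00) ci0) mulrAC -powRD; last by rewrite (gt_eqF V00) implybT.
rewrite subrr powRr0 mul1r -(powR_inv1 (ltW c0)) -powRrM mulN1r !powRN.
rewrite lef_pV2 ?posrE ?powR_gt0 //.
by apply: ge0_ler_powR; rewrite ?nnegrE ?(ltW c0) ?(ltW V1).
Qed.

(** Cubes of side less than [c0] are handled by near-best approximation. The others contribute at
    most a constant times their volume, and the volumes of cubes with disjoint interiors add up to
    at most that of [Q0]; this produces the second term on the right. *)
Lemma jn_sup_le_JN p q s alpha Q0 c0 : 0 < p -> 1 <= q -> 0 <= alpha -> 0 < c0 ->
  exists2 C : R, 0 < C & forall f (b : mpoly n R),
    Lq_loc q (CubeDomain Q0) f -> poly_le s b ->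
  (JN_sup p q alpha (proj_poly_cut s c0) (CubeDomain Q0) (f \+ polyfun b)%R <=
   (C%:E * (JN_sup p q alpha (proj_poly s) (CubeDomain Q0) f `^ p +
     scaled_mean p q alpha Q0
       (mean Q0 (fun x => (`|f x + polyfun b x| `^ q)%:E)))) `^ p^-1)%E.
Proof.
move=> p0 q1 alpha0 c00; have q0 : 0 < q by exact: lt_le_trans q1.
have [K K0 KP] := @mean_proj_poly_le R n s q q1.
(* A subcube of side at least [c0] has volume at least that of [Q0] divided by [th]: replacing it by
   [Q0] costs a factor [th] in the mean and [th^alpha] in the weight. *)
pose th := side Q0 ^+ n / c0 ^+ n.
have c0n : 0 < c0 ^+ n by rewrite exprn_gt0.
have V00 := cube_vol_gt0 Q0.
have th0 : 0 < th by rewrite divr_gt0.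
pose c := (K `^ q^-1) `^ p; pose rho := (th `^ alpha * th `^ q^-1) `^ p.
have c_ge0 : 0 <= c by exact: powR_ge0.
have rho_ge0 : 0 <= rho by exact: powR_ge0.
exists (1 + c + rho); first by rewrite -addrA ltr_pwDl // addr_ge0.
move=> f b fq sb; set X := CubeDomain Q0.
set g := (f \+ polyfun b)%R.
pose m0 := mean Q0 (fun x => (`|g x| `^ q)%:E); rewrite -/m0.
have gE x : g x = f x + polyfun b x by [].
(* The density of the bound for large cubes: such a cube contributes at most [W] times its
   volume. *)
pose W := (rho%:E * (((side Q0 ^+ n) `^ (- alpha))%:E * m0 `^ q^-1) `^ p)%E.
have m00 : (0 <= m0)%E by apply: mean_ge0 => x; rewrite lee_fin powR_ge0.
have W0 : (0 <= W)%E by rewrite mule_ge0 ?lee_fin // poweR_ge0.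
have WE : ((side Q0 ^+ n)%:E * W = rho%:E * scaled_mean p q alpha Q0 m0)%E.
  by rewrite /W muleCA /scaled_mean leb_cube poweR_EFin.
have fi Q : cube_set Q `<=` cube_set Q0 -> (leb R n).-integrable (cube_set Q) (EFin \o f).
  by move=> QX; exact: (Lq_loc_integrable q1 fq QX).
have gi Q : cube_set Q `<=` cube_set Q0 -> (leb R n).-integrable (cube_set Q) (EFin \o g).
  clearbody g; move=> QX.
  have := integrableD (measurable_cube Q) (fi Q QX) (integrable_polyfun Q b).
  by apply: (eq_integrable (measurable_cube Q)) => x _; rewrite /= gE.
clearbody g.
have mgq : measurable_fun (cube_set Q0) (fun x => (`|g x| `^ q)%:E).
  apply: measurable_norm_powR; apply/measurable_EFinP.
  exact: measurable_int (gi Q0 (fun _ => id)).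
have step Q : cube_set Q `<=` cube_set Q0 ->
    (cube_term p q alpha (proj_poly_cut s c0) g Q <=
     c%:E * cube_term p q alpha (proj_poly s) f Q + W * leb R n (cube_set Q))%E.
  move=> QX; have [Qc0|c0Q] := ltP (side Q) c0.
    apply: (@le_trans _ _ (c%:E * cube_term p q alpha (proj_poly s) f Q)%E); last first.
      by rewrite leeDl // mule_ge0.
    rewrite !cube_termE; apply: scaled_mean_le => //; first exact: ltW.
    - by apply: mean_ge0 => x; rewrite lee_fin powR_ge0.
    - by apply: mean_ge0 => x; rewrite lee_fin powR_ge0.
    have [a [sa aE _]] := proj_polyP s (fi Q QX).
    rewrite /proj_poly_cut Qc0.
    (* The competitor [a + b] for [g = f + b] leaves the remainder of [f] by its own projection
       [a]. *)
    have E : (fun x => (`|g x - polyfun (a + b) x| `^ q)%:E) =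
        fun x => (`|f x - proj_poly s Q f x| `^ q)%:E.
      apply/funext => x; rewrite aE polyfunD gE.
      by rewrite opprD addrACA subrr addr0.
    exact: (eq_ind _ (fun z => (_ <= K%:E * mean Q z)%E)
      (KP Q g (a + b) (gi Q QX) (poly_leD sa sb)) _ E).
  apply: (@le_trans _ _ (W * leb R n (cube_set Q))%E); last first.
    by rewrite leeDr // mule_ge0 ?lee_fin // cube_term_ge0.
  rewrite cube_termE /scaled_mean leb_cube [leRHS]muleC; apply: lee_wpmul2l.
    by rewrite lee_fin ltW // cube_vol_gt0.
  have VV : c0 ^+ n <= side Q ^+ n by rewrite lerXn2r // ?nnegrE ltW // side_gt0.
  set m := mean Q _.
  have m_ge0 : (0 <= m)%E by apply: mean_ge0 => x; rewrite lee_fin powR_ge0.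
  have mm0 : (m <= th%:E * m0)%E.
    rewrite /m0 (meanE Q0) muleA -EFinM /th mulrAC divff ?gt_eqF // mul1r /m (meanE Q).
    apply: lee_pmul.
    - by rewrite lee_fin invr_ge0 ltW // cube_vol_gt0.
    - by apply: integral_ge0 => x _; rewrite lee_fin powR_ge0.
    - by rewrite lee_fin lef_pV2 ?posrE // cube_vol_gt0.
    under eq_integral do rewrite /proj_poly_cut ltNge c0Q /= subr0.
    apply: ge0_subset_integral.
    - exact: measurable_cube.
    - exact: measurable_cube.
    - exact: mgq.
    - by move=> x _; rewrite lee_fin powR_ge0.
    - exact: QX.
  rewrite /W /rho -poweR_EFin -poweRM ?mule_ge0 ?poweR_ge0 ?lee_fin ?mulr_ge0 ?powR_ge0 //.
  apply: le_poweR; [exact: ltW|by rewrite mule_ge0 ?poweR_ge0|].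
  rewrite EFinM muleACA; apply: lee_pmul; rewrite ?poweR_ge0 //.
    by rewrite poweR_EFin -EFinM lee_fin; exact: powRN_le_ratio.
  rewrite -poweR_EFin -poweRM ?lee_fin ?(ltW th0) //.
  by apply: le_poweR => //; rewrite invr_ge0 ltW.
apply: ge_ereal_sup => _ [F XF <-]; apply: le_poweR.
- by rewrite invr_ge0 ltW.
- by apply: esum_ge0 => j _; exact: cube_term_ge0.
set S := JN_sup p q alpha (proj_poly s) X f.
have FX j : F.1 j -> cube_set (F.2 j) `<=` cube_set Q0 by case: XF => + _; exact.
apply: (@le_trans _ _ (\esum_(j in F.1) (c%:E * cube_term p q alpha (proj_poly s) f (F.2 j) +
    W * leb R n (cube_set (F.2 j))))%E).
  by apply: le_esum => j Fj; exact/step/FX.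
rewrite esumD; first last.
- by move=> j _; rewrite mule_ge0.
- by move=> j _; rewrite mule_ge0 ?lee_fin // cube_term_ge0.
have e1 : (\esum_(j in F.1) (c%:E * cube_term p q alpha (proj_poly s) f (F.2 j)) <=
    c%:E * S `^ p)%E.
  apply: (@le_trans _ _ (c%:E * \esum_(j in F.1) cube_term p q alpha (proj_poly s) f (F.2 j))%E).
    by apply: esum_le_scale => // j; rewrite ?lee_fin // cube_term_ge0.
  by apply: lee_wpmul2l; [rewrite lee_fin|exact: esum_le_JN_sup].
have e2 : (\esum_(j in F.1) (W * leb R n (cube_set (F.2 j))) <=
    rho%:E * scaled_mean p q alpha Q0 m0)%E.
  rewrite -WE muleC; apply: (@le_trans _ _ (W * \esum_(j in F.1) leb R n (cube_set (F.2 j)))%E).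
    exact: esum_le_scale.
  apply: lee_wpmul2l => //; rewrite -(leb_cube Q0).
  have int1 Q : (\int[leb R n]_(x in cube_set Q) cst 1%E x = leb R n (cube_set Q))%E.
    by rewrite (integral_cst _ (measurable_cube Q)) mul1e.
  (* For the constant function 1 the integrals are volumes. *)
  have := @esum_integral_cubes R n X F (cst 1%E) XF.
  rewrite [domain_set X]/(cube_set Q0) int1 (eq_esum (fun j _ => int1 (F.2 j))).
  by apply.
apply: (le_trans (leeD e1 e2)).
have Sp0 : (0 <= S `^ p)%E by exact: poweR_ge0.
have sm0 := scaled_mean_ge0 p q alpha Q0 m0.
rewrite ge0_muleDr //; apply: leeD; apply: lee_wpmul2r => //; rewrite lee_fin; lra.
Qed.

Lemma JN_eq_jn_quot p q s alpha Q0 c0 : 0 < p -> 1 <= q -> 0 <= alpha -> 0 < c0 ->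
  eq_equiv_norms (JN p q s alpha (CubeDomain Q0))
                 (jn_quot p q s alpha c0 (CubeDomain Q0)).
Proof.
move=> p0 q1 alpha0 c00; have q0 : 0 < q by exact: lt_le_trans q1.
set X := CubeDomain Q0.
have [C C0 CP] := @jn_sup_le_JN p q s alpha Q0 c0 p0 q1 alpha0 c00.
have [D D0 DP] := @JN_le_jn_add p q s alpha p0 q1.
have sub0 : cube_set Q0 `<=` domain_set X by [].
have JN_jn f : carrier (JN p q s alpha X) f -> carrier (jn_quot p q s alpha c0 X) f.
  move=> [fq fJN]; split; first exact: fq.
  (* For [b = 0] the extra term is a [q]-mean of [f] over [Q0], finite because [Q0] is bounded and
     [f] is locally in L^q. *)
  have := CP f 0 fq (@poly_le0 R n s).
  rewrite add_polyfun0.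
  move/le_lt_trans; apply; apply: poweR_lty; apply: lte_EFin_mul (ltW C0) _.
  apply: lte_add_pinfty; first exact: poweR_lty.
  have [_ fQ0] := Lq_loc_cube q0 fq sub0.
  rewrite /scaled_mean leb_cube; apply: lte_EFin_mul (ltW (cube_vol_gt0 Q0)) _.
  apply: poweR_lty; rewrite poweR_EFin; apply: lte_EFin_mul (powR_ge0 _ _) _.
  apply: poweR_lty; rewrite meanE; apply: lte_EFin_mul.
    by rewrite invr_ge0 ltW // cube_vol_gt0.
  by under eq_integral do rewrite /polyfun meval0 addr0.
split.
  apply/seteqP; split => f; first exact: JN_jn.
  move=> [fq fjn]; split; first exact: fq.
  have := DP X c0 f 0 fq (@poly_le0 R n s).
  rewrite add_polyfun0.
  by move/le_lt_trans; apply; exact: lte_EFin_mul (ltW D0) fjn.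
exists (Num.max ((C * 2) `^ p^-1) D); first by rewrite lt_max D0 orbT.
move=> f [fq fJN]; split.
  (* The infimum is tested at the opposite of the projection on [Q0]. The extra term of [CP] is then
     the contribution of the single cube [Q0] to the JN supremum, which explains the factor 2. *)
  have [a [sa aE _]] := proj_polyP s (Lq_loc_integrable q1 fq sub0).
  rewrite /fnorm /=.
  apply: (@le_trans _ _ (JN_sup p q alpha (proj_poly_cut s c0) X (f \+ polyfun (- a))%R)).
    by apply: ereal_inf_lbound; exists (- a) => //=; exact: poly_leN.
  apply: (le_trans (CP f (- a) fq (poly_leN sa))).
  set S := JN_sup p q alpha (proj_poly s) X f.
  have S0 : (0 <= S)%E by exact: JN_sup_ge0.
  have Sp0 : (0 <= S `^ p)%E by exact: poweR_ge0.
  apply: (@le_trans _ _ (((C * 2)%:E * S `^ p) `^ p^-1)%E).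
    apply: le_poweR; first by rewrite invr_ge0 ltW.
      by rewrite mule_ge0 ?lee_fin ?(ltW C0) // adde_ge0 // scaled_mean_ge0.
    rewrite EFinM -muleA; apply: lee_wpmul2l; first by rewrite lee_fin ltW.
    rewrite mule_natl mule2n; apply: leeD; first exact: lexx.
    apply: le_trans (cube_term_le_JN_sup q alpha (proj_poly s) f p0 sub0).
    rewrite cube_termE; suff -> : (fun x => (`|f x - proj_poly s Q0 f x| `^ q)%:E) =
        fun x => (`|f x + polyfun (- a) x| `^ q)%:E by exact: lexx.
    by apply/funext => x; rewrite aE /polyfun mevalN.
  rewrite poweRM ?lee_fin ?mulr_ge0 ?(ltW C0) // poweRK ?gt_eqF // poweR_EFin.
  by apply: lee_wpmul2r => //; rewrite lee_fin le_max lexx.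
apply: (@le_trans _ _ (D%:E * fnorm (jn_quot p q s alpha c0 X) f)%E); last first.
  apply: lee_wpmul2r; last by rewrite lee_fin le_max lexx orbT.
  by apply: le_ereal_inf_tmp => _ [a _ <-]; exact: JN_sup_ge0.
rewrite -lee_pdivrMl //.
apply: le_ereal_inf_tmp => _ [a sa <-]; rewrite lee_pdivrMl //.
exact: DP.
Qed.

End embeddings.

(** * The Cantor-type function *)

Section affine_change_of_variable.
Context {R : realType}.
Local Notation mu := (@lebesgue_measure R).

(** For [b = 0] and [b = 2] this blows the left and the right third of the unit interval up to the
    whole of it. *)
Definition trisect (b x : R) : R := 3 * x - b.

Lemma measurable_trisect b : measurable_fun [set: measurableTypeR R]
  (trisect b : measurableTypeR R -> measurableTypeR R).
Proof. exact: measurable_funB. Qed.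

(** Three times the pushforward under [trisect b] gives half-open intervals their length, so it is
    Lebesgue measure by uniqueness. *)
Lemma lebesgue_trisect b (A : set R) : measurable (A : set (measurableTypeR R)) ->
  mu A = (3%:E * mu (trisect b @^-1` A))%E.
Proof.
pose push := measure_function_pushforward__canonical__measure_function_Measure
  mu (measurable_trisect b).
pose nu : {measure set (measurableTypeR R) -> \bar R} :=
  mscale (NngNum (ler0n R 3)) push.
move=> mA; rewrite (@lebesgue_measure_unique R nu) //.
move=> _ [[c d]] _ <-.
have E : trisect b @^-1` `]c, d] = `](c + b) / 3, (d + b) / 3]%classic.
  apply/seteqP; split => x /=; rewrite /trisect !in_itv /= => /andP[h1 h2].
    by apply/andP; split; lra.
  by apply/andP; split; lra.
transitivity (3%:E * mu (trisect b @^-1` `]c, d]))%E; last by [].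
rewrite E.
rewrite !lebesgue_measure_itv /= !lte_fin ltr_pM2r ?invr_gt0 // ltrD2r.
case: ifPn => _; last by rewrite mule0.
rewrite -!EFinD -EFinM; congr EFin; lra.
Qed.

Lemma ge0_integral_trisect b (D : set R) (u : R -> \bar R) :
  measurable (D : set (measurableTypeR R)) -> measurable_fun [set: R] u ->
  (forall x, 0 <= u x)%E ->
  (\int[mu]_(x in trisect b @^-1` D) u (trisect b x) =
   (3^-1)%:E * \int[mu]_(y in D) u y)%E.
Proof.
move=> mD mu_ u0.
have mu' : measurable_fun (D : set (measurableTypeR R)) u by exact: measurable_funTS.
rewrite -(ge0_integral_pushforward (measurable_trisect b) mu mD mu') //.
have third_ge0 : 0 <= (3 : R)^-1 by rewrite invr_ge0.
rewrite -[RHS](@ge0_integral_mscale _ _ _ mu D mD (NngNum third_ge0)) //.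
apply: eq_measure_integral; first exact: measurable_trisect.
move=> ? A mA _; transitivity ((3^-1)%:E * mu A)%E; last by [].
by rewrite (lebesgue_trisect b mA) muleA -EFinM mulVf ?mul1e.
Qed.

End affine_change_of_variable.

Section cantor_function.
Context {R : realType} (p : R) (p_gt1 : 1 < p).
Local Notation mu := (@lebesgue_measure R).

Let p_gt0 : 0 < p. Proof. exact: lt_trans p_gt1. Qed.

(* [cantor_ratio ^ p = 3 / 2]: passing to a third of the length multiplies the values by
   [cantor_ratio] and halves the mass, so the [L^p] mass is the same at every scale. *)
Definition cantor_ratio : R := (3 / 2) `^ p^-1.

Lemma cantor_ratio_powR : cantor_ratio `^ p = 3 / 2.
Proof. by rewrite /cantor_ratio -powRrM mulVf ?gt_eqF // powRr1. Qed.

Lemma cantor_ratio_gt0 : 0 < cantor_ratio.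
Proof. by rewrite powR_gt0 // divr_gt0. Qed.

Lemma cantor_ratio_ge1 : 1 <= cantor_ratio.
Proof.
apply: (@le_trans _ _ (1 `^ p^-1)); first by rewrite powR1.
apply: ge0_ler_powR; rewrite ?nnegrE //; try lra.
by rewrite invr_ge0 ltW.
Qed.

(** As [p > 1], [r^p = r * r^(p - 1)] with [r > 1] exceeds [r]. This is what makes the L^1 masses of
    the generations summable. *)
Lemma cantor_ratio_lt : cantor_ratio < 3 / 2.
Proof.
have cantor_ratio_gt1 : 1 < cantor_ratio.
  apply: (@le_lt_trans _ _ (1 `^ p^-1)); first by rewrite powR1.
  apply: gt0_ltr_powR; rewrite ?nnegrE ?invr_gt0 //; lra.
rewrite -cantor_ratio_powR -mulr_powRB1 ?(ltW cantor_ratio_gt0) // -[ltLHS]mulr1.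
rewrite ltr_pM2l ?cantor_ratio_gt0 //.
apply: (@le_lt_trans _ _ (1 `^ (p - 1))); first by rewrite powR1.
apply: gt0_ltr_powR => //.
- by rewrite subr_gt0.
- by rewrite nnegrE.
- by rewrite nnegrE ltW // cantor_ratio_gt0.
Qed.

(** Written as a sum over the whole line, so that integrals and differences split. For [u] vanishing
    off the unit interval the supports of the three terms are disjoint, the middle third being
    open. *)
Definition cantor_step (u : R -> R) (x : R) : R :=
  \1_(`]3^-1, 2 / 3[%classic) x + cantor_ratio * u (trisect 0 x) + cantor_ratio * u (trisect 2 x).

Definition supp01 (u : R -> R) := forall x, (x < 0) || (1 < x) -> u x = 0.

Lemma cantor_step_left u x : supp01 u -> x <= 3^-1 ->
  cantor_step u x = cantor_ratio * u (trisect 0 x).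
Proof.
move=> su x3; rewrite /cantor_step (su (trisect 2 x)) ?mulr0 ?addr0; last first.
  by rewrite /trisect; apply/orP; left; lra.
rewrite indicE (_ : (x \in _) = false) ?add0r //.
by apply/negP => /set_mem /=; rewrite in_itv /= => /andP[h _]; lra.
Qed.

Lemma cantor_step_right u x : supp01 u -> 2 / 3 <= x ->
  cantor_step u x = cantor_ratio * u (trisect 2 x).
Proof.
move=> su x3; rewrite /cantor_step (su (trisect 0 x)) ?mulr0 ?addr0; last first.
  by rewrite /trisect; apply/orP; right; lra.
rewrite indicE (_ : (x \in _) = false) ?add0r //.
by apply/negP => /set_mem /=; rewrite in_itv /= => /andP[_ h]; lra.
Qed.

Lemma cantor_step_mid u x : supp01 u -> 3^-1 < x < 2 / 3 -> cantor_step u x = 1.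
Proof.
move=> su /andP[x1 x2]; rewrite /cantor_step (su (trisect 0 x)) ?(su (trisect 2 x)).
- by rewrite mulr0 !addr0 indicE mem_set //= in_itv /= x1.
- by rewrite /trisect; apply/orP; left; lra.
- by rewrite /trisect; apply/orP; right; lra.
Qed.

Variant cantor_step_spec (u : R -> R) (x : R) : R -> Prop :=
  | CantorLeft of x <= 3^-1 : cantor_step_spec u x (cantor_ratio * u (trisect 0 x))
  | CantorMid of 3^-1 < x < 2 / 3 : cantor_step_spec u x 1
  | CantorRight of 2 / 3 <= x : cantor_step_spec u x (cantor_ratio * u (trisect 2 x)).

Lemma cantor_stepP u x : supp01 u -> cantor_step_spec u x (cantor_step u x).
Proof.
move=> su; have [x3|x3] := leP x 3^-1.
  by rewrite cantor_step_left //; constructor.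
have [x4|x4] := leP (2 / 3) x.
  by rewrite cantor_step_right //; constructor.
by rewrite cantor_step_mid ?x3 ?x4 //; constructor; rewrite x3.
Qed.

Lemma supp01_cantor_step u : supp01 u -> supp01 (cantor_step u).
Proof.
move=> su x /orP x01; case: cantor_stepP => // h.
- by rewrite su ?mulr0 // /trisect; apply/orP; case: x01 => ?; [left|right]; lra.
- by case: x01 => ?; lra.
- by rewrite su ?mulr0 // /trisect; apply/orP; case: x01 => ?; [left|right]; lra.
Qed.

Lemma cantor_step_ge0 u : (forall x, 0 <= u x) -> forall x, 0 <= cantor_step u x.
Proof.
move=> u0 x; rewrite /cantor_step !addr_ge0 ?mulr_ge0 ?(ltW cantor_ratio_gt0) //.
Qed.

Lemma measurable_comp_trisect b (u : R -> R) : measurable_fun [set: R] u ->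
  measurable_fun [set: R] (fun x => u (trisect b x)).
Proof. by move=> mu_; exact: measurableT_comp mu_ (measurable_trisect b). Qed.

Lemma measurable_cantor_step u : measurable_fun [set: R] u ->
  measurable_fun [set: R] (cantor_step u).
Proof.
move=> mu_; apply: measurable_funD; first apply: measurable_funD.
- exact: measurable_indic.
- by apply: measurable_funM => //; exact: measurable_comp_trisect.
- by apply: measurable_funM => //; exact: measurable_comp_trisect.
Qed.

Lemma integral_scaled_trisect k b (D : set R) (u : R -> R) : 0 <= k ->
  measurable (D : set (measurableTypeR R)) -> measurable_fun [set: R] u ->
  (forall x, 0 <= u x) ->
  (\int[mu]_(x in trisect b @^-1` D) (k * u (trisect b x))%:E =
   (k / 3)%:E * \int[mu]_(y in D) (u y)%:E)%E.
Proof.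
move=> k0 mD mu_ u0; have mD' : measurable (trisect b @^-1` D : set (measurableTypeR R)).
  by rewrite -[X in measurable X]setTI; exact: measurable_trisect.
under eq_integral do rewrite EFinM.
rewrite ge0_integralZl //.
- rewrite (@ge0_integral_trisect R b D (EFin \o u)) ?muleA //.
    exact/measurable_EFinP.
- by apply/measurable_EFinP; apply: measurable_funTS; exact: measurable_comp_trisect.
- by move=> x _; rewrite lee_fin.
Qed.

(** The coefficient is free in order to serve twice: [k = cantor_ratio] for the L^1 mass, and
    [k = 3 / 2] for the integral of the [p]-th power. *)
Lemma integral_bump_trisect k (u : R -> R) : 0 <= k ->
  measurable_fun [set: R] u -> (forall x, 0 <= u x) ->
  (\int[mu]_x (\1_(`]3^-1, 2 / 3[%classic) x + k * u (trisect 0 x) +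
     k * u (trisect 2 x))%:E =
   (3^-1)%:E + (2 * k / 3)%:E * \int[mu]_x (u x)%:E)%E.
Proof.
move=> k0 mu_ u0.
have m1 b : measurable_fun [set: R] (fun x => (k * u (trisect b x))%:E).
  by apply/measurable_EFinP/measurable_funM => //; exact: measurable_comp_trisect.
have i1 b : (\int[mu]_x (k * u (trisect b x))%:E =
    (k / 3)%:E * \int[mu]_x (u x)%:E)%E.
  by rewrite -(@integral_scaled_trisect k b setT) // preimage_setT.
have e1 : (\int[mu]_x (\1_(`]3^-1, 2 / 3[%classic) x : R)%:E = (3^-1)%:E)%E.
  rewrite integral_indic // setIT.
  transitivity (mu `]3^-1, 2 / 3[%classic); first by [].
  rewrite lebesgue_measure_itv /= lte_fin ifT; last lra.
  by rewrite -EFinD; congr EFin; lra.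
transitivity (\int[mu]_x (((\1_(`]3^-1, 2 / 3[%classic) x : R)%:E +
    (k * u (trisect 0 x))%:E) + (k * u (trisect 2 x))%:E))%E.
  by apply: eq_integral => x _; rewrite -!EFinD.
have mI : measurable_fun [set: R] (fun x => (\1_(`]3^-1, 2 / 3[%classic) x : R)%:E).
  by apply/measurable_EFinP; exact: measurable_indic.
have p1 b x : (0 <= (k * u (trisect b x))%:E)%E by rewrite lee_fin mulr_ge0.
have I0 (x : R) : (0 <= (\1_(`]3^-1, 2 / 3[%classic) x : R)%:E)%E by rewrite lee_fin.
rewrite (ge0_integralD mu measurableT (fun x _ => adde_ge0 (I0 x) (p1 0 x))
  (emeasurable_funD mI (m1 0)) (fun x _ => p1 2 x) (m1 2)).
rewrite (ge0_integralD mu measurableT (fun x _ => I0 x) mI (fun x _ => p1 0 x) (m1 0)).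
rewrite e1 !i1 -addeA -ge0_muleDl ?lee_fin ?divr_ge0 // -EFinD.
by congr (_ + _%:E * _)%E; lra.
Qed.

Lemma integral_cantor_step (u : R -> R) : measurable_fun [set: R] u -> (forall x, 0 <= u x) ->
  (\int[mu]_x (cantor_step u x)%:E =
   (3^-1)%:E + (2 * cantor_ratio / 3)%:E * \int[mu]_x (u x)%:E)%E.
Proof. by move=> mu_ u0; rewrite integral_bump_trisect // ltW // cantor_ratio_gt0. Qed.

(* An interval of length [L] on which the oscillation integral is [hmean L v] contributes
   [L (hmean L v / L) ^ p = v] to the [jn_p] sum. *)
Definition hmean (L v : R) := L `^ (1 - p^-1) * v `^ p^-1.

Let pV_gt0 : 0 < p^-1. Proof. by rewrite invr_gt0. Qed.

Let pV_lt1 : 0 < 1 - p^-1. Proof. by rewrite subr_gt0 invf_lt1. Qed.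

Lemma hmean_ge0 L v : 0 <= hmean L v.
Proof. by rewrite mulr_ge0 // powR_ge0. Qed.

Lemma hmean_le L v L' v' : 0 <= L -> L <= L' -> 0 <= v -> v <= v' ->
  hmean L v <= hmean L' v'.
Proof.
move=> L0 LL v0 vv; apply: ler_pM; rewrite ?powR_ge0 //.
  by apply: ge0_ler_powR; rewrite ?nnegrE ?(ltW pV_lt1) // (le_trans L0).
by apply: ge0_ler_powR; rewrite ?nnegrE ?(ltW pV_gt0) // (le_trans v0).
Qed.

Lemma hmean_diag v : 0 <= v -> hmean v v = v.
Proof.
rewrite /hmean le_eqVlt => /predU1P[<-|v0].
  by rewrite powR0 ?mul0r // gt_eqF.
by rewrite -powRD ?subrK ?powRr1 ?(ltW v0) // (gt_eqF v0) implybT.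
Qed.

(** [cantor_ratio / 3] is also the factor of an integral in [integral_scaled_trisect], so estimates
    by [hmean] pass to the next generation without loss. *)
Lemma hmean_third L v : 0 <= L -> 0 <= v ->
  hmean (L / 3) (v / 2) = cantor_ratio / 3 * hmean L v.
Proof.
have c3 : (3^-1 : R) `^ (1 - p^-1) = 3^-1 * 3 `^ p^-1.
  rewrite powRD; last by rewrite invr_eq0 pnatr_eq0 implybT.
  rewrite powRr1 ?invr_ge0 // powRN; congr (_ * _).
  by rewrite -[in LHS](powR_inv1 (ler0n R 3)) -powRrM mulN1r powRN invrK.
have r_E : cantor_ratio = 3 `^ p^-1 * 2^-1 `^ p^-1 by rewrite /cantor_ratio powRM ?invr_ge0.
move=> L0 v0; rewrite /hmean !powRM ?invr_ge0 // c3 r_E.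
ring.
Qed.

(** The distribution function of the uniform probability on the [N]-th stage of the Cantor set:
    piecewise linear, with the Cantor function as limit. *)
Fixpoint cantor_cdf (N : nat) (x : R) : R :=
  match N with
  | 0 => Num.max 0 (Num.min x 1)
  | N'.+1 => (cantor_cdf N' (trisect 0 x) + cantor_cdf N' (trisect 2 x)) / 2
  end.

Lemma cantor_cdf_homo N : {homo cantor_cdf N : x y / x <= y}.
Proof.
elim: N => [|N IH] x y xy /=.
  by case: (leP x 1) => ?; case: (leP y 1) => ?; rewrite ?(max_r ler01);
    case: (leP 0 x) => ?; case: (leP 0 y) => ?; lra.
by rewrite ler_pM2r ?invr_gt0 // lerD // IH // /trisect; lra.
Qed.

Lemma cantor_cdf_le0 N x : x <= 0 -> cantor_cdf N x = 0.
Proof.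
elim: N x => [|N IH] x x0 /=.
  by case: (leP x 1) => ?; [case: (leP 0 x) => ?|]; lra.
by rewrite !IH ?addr0 ?mul0r // /trisect; lra.
Qed.

Lemma cantor_cdf_ge1 N x : 1 <= x -> cantor_cdf N x = 1.
Proof.
elim: N x => [|N IH] x x0 /=.
  by rewrite min_r // max_r.
by rewrite !IH /trisect; lra.
Qed.

Lemma cantor_cdf_itv N x : 0 <= cantor_cdf N x <= 1.
Proof.
have x0 : Num.min 0 x <= 0 by rewrite ge_min lexx.
have x1 : 1 <= Num.max 1 x by rewrite le_max lexx.
rewrite -{1}(cantor_cdf_le0 N x0) -(cantor_cdf_ge1 N x1).
by rewrite !cantor_cdf_homo // ?le_max ?ge_min lexx orbT.
Qed.

(** The ranges of this formula and of the next one overlap in the middle third, where the value is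
    1/2. An interval meeting the middle third can thus use this one at its left end and the other at
    its right end. *)
Lemma cantor_cdfS_left N x : x <= 2 / 3 -> cantor_cdf N.+1 x = cantor_cdf N (trisect 0 x) / 2.
Proof. by move=> x3; rewrite /= [X in _ + X]cantor_cdf_le0 ?addr0 //; rewrite /trisect; lra. Qed.

Lemma cantor_cdfS_right N x : 3^-1 <= x ->
  cantor_cdf N.+1 x = (1 + cantor_cdf N (trisect 2 x)) / 2.
Proof. by move=> x3; rewrite /= [X in X + _]cantor_cdf_ge1 //; rewrite /trisect; lra. Qed.

Definition unit_bump : R -> R := \1_(`[0, 1]%classic).

(* Starting from the indicator of the unit interval keeps the values at least [1] there, which
   bounds the oscillation around [1]; the iterates from [0], used for the limit, are monotone. *)
Definition cantor_approx (N : nat) : R -> R := iter N cantor_step unit_bump.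

Lemma measurable_cantor_approx N : measurable_fun [set: R] (cantor_approx N).
Proof.
elim: N => [|N IH] /=; first exact: measurable_indic.
exact: measurable_cantor_step.
Qed.

Lemma cantor_approx_ge0 N x : 0 <= cantor_approx N x.
Proof.
elim: N x => [|N IH] x /=; first by rewrite /unit_bump.
exact: cantor_step_ge0.
Qed.

Lemma supp01_cantor_approx N : supp01 (cantor_approx N).
Proof.
elim: N => [|N IH] /=; last exact: supp01_cantor_step.
move=> x x01; rewrite /unit_bump indicE (_ : _ \in _ = false) //.
apply/negP => /set_mem /=; rewrite in_itv /= => /andP[x0 x1].
by move/orP: x01 => [|]; lra.
Qed.

Lemma cantor_approx_ge1 N x : 0 <= x <= 1 -> 1 <= cantor_approx N x.
Proof.
elim: N x => [|N IH] x x01 /=.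
  by rewrite /unit_bump indicE mem_set //= in_itv.
have /andP[x0 x1] := x01.
have h b : 0 <= trisect b x <= 1 -> 1 <= cantor_ratio * cantor_approx N (trisect b x).
  move=> /IH h; rewrite -[leLHS]mulr1; apply: ler_pM => //.
  exact: cantor_ratio_ge1.
case: (cantor_stepP x (@supp01_cantor_approx N)) => // h'; apply: h; rewrite /trisect;
  by apply/andP; split; lra.
Qed.

(** The fixed point of [m = 1/3 + (2 r / 3) m], the recursion that [cantor_step] induces on
    integrals. *)
Definition cantor_mass : R := (3 - 2 * cantor_ratio)^-1.

Let mass_denom_gt0 : 0 < 3 - 2 * cantor_ratio.
Proof. by have := cantor_ratio_lt; lra. Qed.

Lemma cantor_mass_ge1 : 1 <= cantor_mass.
Proof. by rewrite invf_ge1 //; have := cantor_ratio_ge1; lra. Qed.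

Lemma cantor_massE : 3^-1 + 2 * cantor_ratio / 3 * cantor_mass = cantor_mass.
Proof.
rewrite /cantor_mass; have := mass_denom_gt0; set r := cantor_ratio => r0.
have r1 : 3 - 2 * r != 0 by rewrite gt_eqF.
by field.
Qed.

Lemma integral_unit_bump_le (D : set R) (x y : R) :
  measurable (D : set (measurableTypeR R)) -> x <= y ->
  (forall t, 0 <= t <= 1 -> D t -> x <= t <= y) ->
  (\int[mu]_(t in D) (unit_bump t)%:E <= (y - x)%:E)%E.
Proof.
move=> mD xy Dxy; rewrite /unit_bump integral_indic //.
have -> : (y - x)%:E = mu `[x, y]%classic.
  rewrite lebesgue_measure_itv /= lte_fin; case: ltP => [_|yx]; first by rewrite -EFinD.
  by rewrite (_ : y = x) ?subrr //; lra.
apply: le_measure; rewrite ?inE //.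
  exact: measurableI.
by move=> t [/=]; rewrite !in_itv /= => t01 Dt; exact: Dxy.
Qed.

Lemma integral_cantor_approx N :
  (\int[mu]_x (cantor_approx N x)%:E <= cantor_mass%:E)%E.
Proof.
elim: N => [|N IH] /=.
  apply: (@le_trans _ _ (1 - 0)%:E).
    by apply: integral_unit_bump_le => // t /=.
  by rewrite subr0 lee_fin cantor_mass_ge1.
rewrite integral_cantor_step; last 2 first.
- exact: measurable_cantor_approx.
- exact: cantor_approx_ge0.
have -> : (cantor_mass%:E = (3^-1)%:E + (2 * cantor_ratio / 3)%:E * cantor_mass%:E)%E.
  by rewrite -EFinM -EFinD cantor_massE.
apply: leeD; first exact: lexx.
apply: lee_wpmul2l IH.
by rewrite lee_fin divr_ge0 // mulr_ge0 // ltW // cantor_ratio_gt0.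
Qed.

(** Calibrated so that length 1/3 and increment 1/2 already pay for the total mass: an interval that
    contains an outer third then satisfies its estimate trivially. *)
Definition end_const : R := 3 * cantor_mass / cantor_ratio.

Lemma end_const_ge1 : 1 <= end_const.
Proof.
rewrite /end_const ler_pdivlMr ?cantor_ratio_gt0 // mul1r.
by have := cantor_ratio_lt; have := cantor_mass_ge1; lra.
Qed.

Lemma end_const_mass : end_const * hmean (1 / 3) (1 / 2) = cantor_mass.
Proof.
rewrite hmean_third // hmean_diag // mulr1 /end_const.
by have := cantor_ratio_gt0; set r := cantor_ratio => r0; field; rewrite gt_eqF.
Qed.

Lemma le_end_const_hmean L v : 1 / 3 <= L -> 1 / 2 <= v ->
  (cantor_mass%:E <= (end_const * hmean L v)%:E)%E.
Proof.
move=> L3 v2; rewrite lee_fin -{1}end_const_mass; apply: ler_wpM2l.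
  by rewrite (le_trans _ end_const_ge1).
by apply: hmean_le; lra.
Qed.

(** Starts the inductions: at generation 0 the increment is at most the length, and
    [hmean v v = v]. *)
Lemma le_hmean_end_const L v : 0 <= v -> v <= L -> v <= end_const * hmean L v.
Proof.
move=> v0 vL; rewrite -{1}[v]mul1r; apply: ler_pM => //; first exact: end_const_ge1.
by rewrite -{1}(hmean_diag v0) hmean_le.
Qed.

Lemma measurable_EFin_approx N (D : set R) :
  measurable_fun D (fun x => (cantor_approx N x)%:E).
Proof. by apply/measurable_EFinP; apply: measurable_funTS; exact: measurable_cantor_approx. Qed.

Lemma integral_cantor_approx_sub N (D : set R) :
  measurable (D : set (measurableTypeR R)) ->
  (\int[mu]_(x in D) (cantor_approx N x)%:E <= cantor_mass%:E)%E.
Proof.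
move=> mD; apply: le_trans (integral_cantor_approx N).
apply: ge0_subset_integral => //; first exact: measurable_EFin_approx.
by move=> x _; rewrite lee_fin cantor_approx_ge0.
Qed.

(** Near an end of the unit interval the integral itself, not only the oscillation, is controlled.
    If [b] is in the left third, self-similarity reduces to [3 b]; beyond it the increment is at
    least 1/2 and the total mass suffices. *)
Lemma integral_cantor_approx_left N b : 0 <= b ->
  (\int[mu]_(x in `]-oo, b]) (cantor_approx N x)%:E <=
   (end_const * hmean b (cantor_cdf N b))%:E)%E.
Proof.
elim: N b => [|N IH] b b0.
  have /andP[F0 F1] := cantor_cdf_itv 0 b.
  apply: (@le_trans _ _ (cantor_cdf 0 b - 0)%:E).
    apply: integral_unit_bump_le => // t /andP[t0 t1] /=; rewrite in_itv /= => tb.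
    by rewrite t0 le_max le_min tb t1 orbT.
  rewrite subr0 lee_fin le_hmean_end_const // ge_max b0 ge_min lexx //.
have [b3|b3] := leP b 3^-1; last first.
  apply: (le_trans (integral_cantor_approx_sub _ _)) => //.
  apply: le_end_const_hmean; first lra.
  rewrite (cantor_cdfS_right _ (ltW b3)).
  by have /andP[] := cantor_cdf_itv N (trisect 2 b); lra.
have tb : `]-oo, b]%classic = (trisect 0 @^-1` `]-oo, trisect 0 b]) :> set R.
  by apply/seteqP; split => x /=; rewrite /trisect !in_itv /=; lra.
rewrite (_ : integral mu _ _ = (\int[mu]_(x in trisect 0 @^-1` `]-oo, trisect 0 b])
    (cantor_ratio * cantor_approx N (trisect 0 x))%:E)%E); last first.
  rewrite -tb; apply: eq_integral => x /set_mem /=; rewrite in_itv /= => xb.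
  rewrite cantor_step_left //; first exact: supp01_cantor_approx.
  exact: le_trans b3.
rewrite integral_scaled_trisect ?(ltW cantor_ratio_gt0) //; last 2 first.
- exact: measurable_cantor_approx.
- exact: cantor_approx_ge0.
have r3 : 0 <= cantor_ratio / 3 by rewrite divr_ge0 // ltW // cantor_ratio_gt0.
apply: (@le_trans _ _ ((cantor_ratio / 3)%:E *
    (end_const * hmean (trisect 0 b) (cantor_cdf N (trisect 0 b)))%:E)%E).
  by apply: lee_wpmul2l; [rewrite lee_fin|apply: IH; rewrite /trisect; lra].
rewrite -EFinM lee_fin mulrCA -hmean_third; last 2 first.
- by rewrite /trisect; lra.
- by have /andP[] := cantor_cdf_itv N (trisect 0 b).
rewrite cantor_cdfS_left; last lra.
by rewrite (_ : trisect 0 b / 3 = b) // /trisect; lra.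
Qed.

(** The mirror image, with lengths and increments counted from 1. *)
Lemma integral_cantor_approx_right N a : a <= 1 ->
  (\int[mu]_(x in `[a, +oo[) (cantor_approx N x)%:E <=
   (end_const * hmean (1 - a) (1 - cantor_cdf N a))%:E)%E.
Proof.
elim: N a => [|N IH] a a1.
  have /andP[F0 F1] := cantor_cdf_itv 0 a.
  apply: (@le_trans _ _ (1 - cantor_cdf 0 a)%:E).
    apply: integral_unit_bump_le => // t /andP[t0 t1] /=; rewrite in_itv /= andbT => ta.
    by rewrite t1 andbT ge_max t0 ge_min ta.
  rewrite lee_fin le_hmean_end_const ?subr_ge0 // lerD2l lerN2.
  by rewrite le_max le_min lexx a1 orbT.
have [a3|a3] := leP (2 / 3) a; last first.
  apply: (le_trans (integral_cantor_approx_sub _ _)) => //.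
  apply: le_end_const_hmean; first lra.
  rewrite (cantor_cdfS_left _ (ltW a3)).
  by have /andP[] := cantor_cdf_itv N (trisect 0 a); lra.
have ta : `[a, +oo[%classic = (trisect 2 @^-1` `[trisect 2 a, +oo[) :> set R.
  by apply/seteqP; split => x /=; rewrite /trisect !in_itv /= !andbT; lra.
rewrite (_ : integral mu _ _ = (\int[mu]_(x in trisect 2 @^-1` `[trisect 2 a, +oo[)
    (cantor_ratio * cantor_approx N (trisect 2 x))%:E)%E); last first.
  rewrite -ta; apply: eq_integral => x /set_mem /=; rewrite in_itv /= andbT => xa.
  rewrite cantor_step_right //; first exact: supp01_cantor_approx.
  exact: le_trans xa.
rewrite integral_scaled_trisect ?(ltW cantor_ratio_gt0) //; last 2 first.
- exact: measurable_cantor_approx.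
- exact: cantor_approx_ge0.
have r3 : 0 <= cantor_ratio / 3 by rewrite divr_ge0 // ltW // cantor_ratio_gt0.
apply: (@le_trans _ _ ((cantor_ratio / 3)%:E *
    (end_const * hmean (1 - trisect 2 a) (1 - cantor_cdf N (trisect 2 a)))%:E)%E).
  by apply: lee_wpmul2l; [rewrite lee_fin|apply: IH; rewrite /trisect; lra].
rewrite -EFinM lee_fin mulrCA -hmean_third; last 2 first.
- by rewrite /trisect; lra.
- by have /andP[] := cantor_cdf_itv N (trisect 2 a); rewrite subr_ge0.
rewrite cantor_cdfS_right; last lra.
rewrite (_ : (1 - trisect 2 a) / 3 = 1 - a); last by rewrite /trisect; lra.
by rewrite (_ : (1 - _) / 2 = 1 - (1 + cantor_cdf N (trisect 2 a)) / 2) //; lra.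
Qed.

Lemma measurable_osc N c (D : set R) :
  measurable_fun D (fun x => `|cantor_approx N x - c|%:E).
Proof.
apply/measurable_EFinP; apply: measurable_funTS; apply: measurableT_comp => //.
by apply: measurable_funB => //; exact: measurable_cantor_approx.
Qed.

Lemma integral_osc_trisect N b (u v c K : R) :
  (forall x, u <= x <= v -> cantor_approx N.+1 x = cantor_ratio * cantor_approx N (trisect b x)) ->
  (\int[mu]_(x in `[trisect b u, trisect b v]) `|cantor_approx N x - c|%:E <= K%:E)%E ->
  (\int[mu]_(x in `[u, v]) `|cantor_approx N.+1 x - cantor_ratio * c|%:E <=
   (cantor_ratio / 3 * K)%:E)%E.
Proof.
move=> uv h; have r0 := cantor_ratio_gt0.
have tb : `[u, v]%classic = (trisect b @^-1` `[trisect b u, trisect b v]) :> set R.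
  by apply/seteqP; split => x /=; rewrite /trisect !in_itv /= => /andP[? ?]; apply/andP; split; lra.
rewrite (_ : integral mu _ _ =
    (\int[mu]_(x in trisect b @^-1` `[trisect b u, trisect b v])
    (cantor_ratio * `|cantor_approx N (trisect b x) - c|)%:E)%E); last first.
  rewrite -tb; apply: eq_integral => x /set_mem xab.
  have xuv : u <= x <= v by move: xab; rewrite /= in_itv.
  by rewrite (uv x xuv) -mulrBr normrM gtr0_norm.
rewrite (@integral_scaled_trisect cantor_ratio b _ (fun x => `|cantor_approx N x - c|)) //.
  by rewrite EFinM; apply: lee_wpmul2l h; rewrite lee_fin divr_ge0 // ltW.
  by rewrite ltW.
by apply/measurable_EFinP; exact: measurable_osc.
Qed.

(* An interval inside an outer third reduces to the previous step; one that meets the middle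
   third is compared with the value [1] there, and one that leaves the unit interval with [0]. *)
Lemma cantor_approx_osc N a b : a <= b -> exists c,
  (\int[mu]_(x in `[a, b]) `|cantor_approx N x - c|%:E <=
   (2 * end_const * hmean (b - a) (cantor_cdf N b - cantor_cdf N a))%:E)%E.
Proof.
have E1 := end_const_ge1; have r0 := cantor_ratio_gt0.
have E2 (x : R) : 0 <= x -> x <= 2 * x by lra.
have EH L v : end_const * hmean L v <= 2 * end_const * hmean L v.
  by rewrite -mulrA E2 // mulr_ge0 ?hmean_ge0 //; lra.
have int0 M a' b' : (\int[mu]_(x in `[a', b']) `|cantor_approx M x - 0|%:E =
    \int[mu]_(x in `[a', b']) (cantor_approx M x)%:E)%E.
  by apply: eq_integral => x _; rewrite subr0 ger0_norm // cantor_approx_ge0.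
elim: N a b => [|N IH] a b ab.
  exists 0; rewrite int0.
  have Fab := cantor_cdf_homo 0 ab.
  apply: (@le_trans _ _ (cantor_cdf 0 b - cantor_cdf 0 a)%:E).
    apply: integral_unit_bump_le => // t /andP[t0 t1] /=; rewrite in_itv /= => /andP[ta tb].
    by rewrite ge_max t0 ge_min ta /= le_max le_min tb t1 orbT.
  rewrite lee_fin; apply: le_trans (EH _ _); apply: le_hmean_end_const.
    by rewrite subr_ge0.
  rewrite /=; case: (leP a 1) => ?; case: (leP b 1) => ?; rewrite ?(max_r ler01);
    by case: (leP 0 a) => ?; case: (leP 0 b) => ?; lra.
have sN := @supp01_cantor_approx N.
have Fa := cantor_cdf_itv N.+1 a; have Fb := cantor_cdf_itv N.+1 b.
have Fab := cantor_cdf_homo N.+1 ab.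
have third t (F1 F2 F1' F2' : R) : trisect t a <= trisect t b -> F1 <= F2 ->
    F2' - F1' = (F2 - F1) / 2 ->
    cantor_ratio / 3 * (2 * end_const * hmean (trisect t b - trisect t a) (F2 - F1)) =
    2 * end_const * hmean (b - a) (F2' - F1').
  move=> tab FF ->; rewrite mulrCA -hmean_third ?subr_ge0 //.
  by rewrite (_ : (trisect t b - trisect t a) / 3 = b - a) // /trisect; lra.
have tri t : trisect t a <= trisect t b by rewrite /trisect; lra.
have [b3|b3] := leP b 3^-1.
  have [c hc] := IH _ _ (tri 0); exists (cantor_ratio * c).
  apply: (le_trans (@integral_osc_trisect N 0 a b c _ _ hc)).
    by move=> x /andP[_ xb] /=; apply: cantor_step_left => //; exact: le_trans b3.
  rewrite (third 0 _ _ (cantor_cdf N.+1 a) (cantor_cdf N.+1 b)) //.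
    exact: cantor_cdf_homo.
  by rewrite !cantor_cdfS_left; lra.
have [a3|a3] := leP (2 / 3) a.
  have [c hc] := IH _ _ (tri 2); exists (cantor_ratio * c).
  apply: (le_trans (@integral_osc_trisect N 2 a b c _ _ hc)).
    by move=> x /andP[ax _] /=; apply: cantor_step_right => //; exact: le_trans ax.
  rewrite (third 2 _ _ (cantor_cdf N.+1 a) (cantor_cdf N.+1 b)) //.
    exact: cantor_cdf_homo.
  by rewrite !cantor_cdfS_right; lra.
have F3a : cantor_cdf N.+1 a = cantor_cdf N (trisect 0 a) / 2.
  by rewrite cantor_cdfS_left // ltW.
have F3b : cantor_cdf N.+1 b = (1 + cantor_cdf N (trisect 2 b)) / 2.
  by rewrite cantor_cdfS_right // ltW.
have F3a' := cantor_cdf_itv N (trisect 0 a).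
have F3b' := cantor_cdf_itv N (trisect 2 b).
(* Here [a < 2/3] and [b > 1/3]. If moreover an end point is outside the unit interval, a whole
   outer third is covered: the length is at least 1/3 and the increment at least 1/2. *)
have [a0|a0] := ltP a 0.
  exists 0; rewrite int0; apply: (le_trans (integral_cantor_approx_sub _ _)) => //.
  apply: (@le_trans _ _ (end_const * hmean (b - a) (cantor_cdf N.+1 b - cantor_cdf N.+1 a))%:E).
    apply: le_end_const_hmean; first lra.
    by rewrite (cantor_cdf_le0 N.+1 (ltW a0)) F3b; lra.
  by rewrite lee_fin.
have [b1|b1] := ltP 1 b.
  exists 0; rewrite int0; apply: (le_trans (integral_cantor_approx_sub _ _)) => //.
  apply: (@le_trans _ _ (end_const * hmean (b - a) (cantor_cdf N.+1 b - cantor_cdf N.+1 a))%:E).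
    apply: le_end_const_hmean; first lra.
    by rewrite (cantor_cdf_ge1 N.+1 (ltW b1)) F3a; lra.
  by rewrite lee_fin.
(* On the unit interval the approximant is at least 1, and equal to 1 on the middle third, so its
   distance to 1 is at most the sum of the two outer parts [w 0] and [w 2]. *)
exists 1; set H := hmean _ _.
have H0 : 0 <= end_const * H by rewrite mulr_ge0 ?hmean_ge0 //; lra.
pose w t x := cantor_ratio * cantor_approx N (trisect t x).
have w0 t x : 0 <= w t x by rewrite mulr_ge0 ?cantor_approx_ge0 // ltW.
have mw t (D : set R) : measurable_fun D (fun x => (w t x)%:E).
  apply/measurable_EFinP; apply: measurable_funTS; apply: measurable_funM => //.
  exact: (measurable_comp_trisect t (@measurable_cantor_approx N)).
apply: (@le_trans _ _ (\int[mu]_(x in `[a, b]) ((w 0 x)%:E + (w 2 x)%:E))%E).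
  apply: ge0_le_integral => //.
  - exact: measurable_osc.
  - exact: emeasurable_funD (mw 0 _) (mw 2 _).
  move=> x /=; rewrite in_itv /= => /andP[ax xb]; rewrite -EFinD lee_fin.
  have h1 : 1 <= cantor_step (cantor_approx N) x.
    by apply: (@cantor_approx_ge1 N.+1 x); apply/andP; split; lra.
  have e : cantor_step (cantor_approx N) x = \1_(`]3^-1, 2 / 3[%classic) x + (w 0 x + w 2 x).
    by rewrite /cantor_step addrA.
  have := w0 0 x; have := w0 2 x; move: h1; rewrite e indicE.
  case: (x \in _) => /= h1 h2 h3; rewrite ger0_norm; lra.
have w0' t x : (0 <= (w t x)%:E)%E by rewrite lee_fin.
rewrite (ge0_integralD mu (measurable_itv _) (fun x _ => w0' 0 x) (mw 0 _)
  (fun x _ => w0' 2 x) (mw 2 _)).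
have -> : (2 * end_const * H)%:E = ((end_const * H)%:E + (end_const * H)%:E)%E.
  by rewrite -EFinD; congr EFin; lra.
(* The part of the interval in an outer third extends to the edge of the middle third; blown up, it
   lies in a half-line, where the one-sided estimates apply. Each outer third uses one of the two
   copies of [end_const * H]. *)
have piece t (D : set R) (L v : R) :
    measurable (D : set (measurableTypeR R)) -> 0 <= L -> 0 <= v -> L / 3 <= b - a ->
    v / 2 <= cantor_cdf N.+1 b - cantor_cdf N.+1 a ->
    `[a, b]%classic `<=` trisect t @^-1` D ->
    (\int[mu]_(x in D) (cantor_approx N x)%:E <= (end_const * hmean L v)%:E)%E ->
    (\int[mu]_(x in `[a, b]) (w t x)%:E <= (end_const * H)%:E)%E.
  move=> mD L0 v0 L3 v2 abD hD.
  apply: (@le_trans _ _ (\int[mu]_(x in trisect t @^-1` D) (w t x)%:E)%E).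
    have mD' : measurable (trisect t @^-1` D : set (measurableTypeR R)).
      by rewrite -[X in measurable X]setTI; exact: measurable_trisect.
    exact: (ge0_subset_integral mu (measurable_itv _) mD' (mw t _) (fun x _ => w0' t x)).
  rewrite /w integral_scaled_trisect ?(ltW cantor_ratio_gt0) //; last 2 first.
  - exact: measurable_cantor_approx.
  - exact: cantor_approx_ge0.
  apply: (@le_trans _ _ ((cantor_ratio / 3)%:E * (end_const * hmean L v)%:E)%E).
    by apply: lee_wpmul2l hD; rewrite lee_fin divr_ge0 // ltW.
  rewrite -EFinM lee_fin mulrCA -hmean_third //; apply: ler_wpM2l; first lra.
  by apply: hmean_le; rewrite ?divr_ge0.
have vanish t : (forall x, a <= x <= b -> w t x = 0) ->
    (\int[mu]_(x in `[a, b]) (w t x)%:E <= (end_const * H)%:E)%E.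
  by move=> wt0; rewrite integral0_eq ?lee_fin // => x /=; rewrite in_itv /= => /wt0 ->.
apply: leeD.
  have [a1|a1] := ltP 1 (trisect 0 a).
    apply: vanish => x /andP[ax _]; rewrite /w sN ?mulr0 //; apply/orP; right.
    by move: a1; rewrite /trisect; lra.
  apply: (piece 0 _ _ _ _ _ _ _ _ _ (integral_cantor_approx_right N a1)) => //.
  - by rewrite subr_ge0.
  - by rewrite subr_ge0; have /andP[] := F3a'.
  - by rewrite /trisect; lra.
  - by rewrite F3a F3b; lra.
  - by move=> x /=; rewrite !in_itv /= /trisect => /andP[? ?]; lra.
have [b2|b2] := ltP (trisect 2 b) 0.
  apply: vanish => x /andP[_ xb]; rewrite /w sN ?mulr0 //; apply/orP; left.
  by move: b2; rewrite /trisect; lra.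
apply: (piece 2 _ _ _ _ _ _ _ _ _ (integral_cantor_approx_left N b2)) => //.
- by have /andP[] := F3b'.
- by rewrite /trisect; lra.
- by rewrite F3a F3b; lra.
- by move=> x /=; rewrite !in_itv /= /trisect => /andP[? ?]; lra.
Qed.

End cantor_function.

(** * The limit function: integrability, approximation, divergence of its p-th power *)

Section cantor_limit.
Context {R : realType} (p : R) (p_gt1 : 1 < p).
Local Notation mu := (@lebesgue_measure R).

Let p_gt0 : 0 < p. Proof. exact: lt_trans p_gt1. Qed.

Definition cantor_iter (N : nat) : R -> R := iter N (cantor_step p) (cst 0).

Lemma cantor_iter_ge0 N x : 0 <= cantor_iter N x.
Proof. by elim: N x => [|N IH] x //=; exact: cantor_step_ge0. Qed.

Lemma supp01_cantor_iter N : supp01 (cantor_iter N).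
Proof. by elim: N => [|N IH] //=; exact: supp01_cantor_step. Qed.

Lemma measurable_cantor_iter N : measurable_fun [set: R] (cantor_iter N).
Proof. by elim: N => [|N IH] //=; exact: measurable_cantor_step. Qed.

(** Started from 0, the iterates at a point stay 0 until the blown-up point falls into a middle
    third, and the value reached then is final. Pointwise convergence is thus stationary. *)
Lemma cantor_iter_stable N x : 0 < cantor_iter N x ->
  cantor_iter N.+1 x = cantor_iter N x.
Proof.
elim: N x => [x|N IH x]; first by rewrite ltxx.
have iterS M : cantor_iter M.+1 x = cantor_step p (cantor_iter M) x by [].
rewrite !iterS.
have s1 := @supp01_cantor_iter N; have s2 := @supp01_cantor_iter N.+1.
have r0 := cantor_ratio_gt0 p.
case: (cantor_stepP p x s1) => h; rewrite ?pmulr_rgt0 //.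
- by rewrite cantor_step_left // => /IH ->.
- by rewrite cantor_step_mid.
- by rewrite cantor_step_right // => /IH ->.
Qed.

Lemma cantor_iter_homo x : {homo (fun N => cantor_iter N x) : m n / (m <= n)%N >-> m <= n}.
Proof.
apply: homo_leq => [//|y u z /le_trans|N]; first exact.
have [/cantor_iter_stable -> //|N0] := ltP 0 (cantor_iter N x).
exact: le_trans N0 (cantor_iter_ge0 _ _).
Qed.

(** If no iterate is positive at [x], as on the Cantor set and off the unit interval, [xget] returns
    0 and the value is that of the iterate 0, namely 0. *)
Definition cantor_fun (x : R) : R :=
  cantor_iter (xget 0 [set N | 0 < cantor_iter N x]) x.

Lemma cantor_fun_eventually x :
  exists N0, forall N, (N0 <= N)%N -> cantor_iter N x = cantor_fun x.
Proof.
have [[N1 N1x]|no] := pselect (exists N, 0 < cantor_iter N x).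
  exists (xget 0 [set N | 0 < cantor_iter N x]).
  have : [set N | 0 < cantor_iter N x] (xget 0 [set N | 0 < cantor_iter N x]).
    exact: (xgetPex 0 (ex_intro _ N1 N1x)).
  rewrite /cantor_fun; move: (xget _ _) => M /= M0 N /subnKC <-.
  elim: (N - M)%N => [|k IH]; first by rewrite addn0.
  by rewrite addnS cantor_iter_stable IH.
have z N : cantor_iter N x = 0.
  apply/eqP; rewrite eq_le cantor_iter_ge0 andbT leNgt; apply/negP => Nx.
  by apply: no; exists N.
by exists 0 => N _; rewrite /cantor_fun !z.
Qed.

Lemma cantor_fun_ge0 x : 0 <= cantor_fun x.
Proof. exact: cantor_iter_ge0. Qed.

Lemma supp01_cantor_fun : supp01 cantor_fun.
Proof. by move=> x x01; exact: supp01_cantor_iter. Qed.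

Lemma cantor_fun_step : cantor_step p cantor_fun = cantor_fun.
Proof.
apply/funext => x; have [N0 h0] := cantor_fun_eventually x.
have [N1 h1] := cantor_fun_eventually (trisect 0 x).
have [N2 h2] := cantor_fun_eventually (trisect 2 x).
rewrite /cantor_step -(h0 (N0 + N1 + N2).+1); last by lia.
by rewrite -(h1 (N0 + N1 + N2)%N) -?(h2 (N0 + N1 + N2)%N) //; lia.
Qed.

Lemma cantor_iter_cvg x : cantor_iter N x @[N --> \oo] --> cantor_fun x.
Proof.
have [N0 h] := cantor_fun_eventually x; apply: cvg_near_cst.
by exists N0 => // N /= N0N; exact: h.
Qed.

Lemma measurable_cantor_fun : measurable_fun [set: R] cantor_fun.
Proof.
apply: measurable_fun_cvg => [N|x _]; first exact: measurable_cantor_iter.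
exact: cantor_iter_cvg.
Qed.

Lemma integral_cantor_iter N :
  (\int[mu]_x (cantor_iter N x)%:E <= (cantor_mass p)%:E)%E.
Proof.
elim: N => [|N IH].
  by rewrite integral0_eq // lee_fin (le_trans _ (cantor_mass_ge1 p_gt1)).
rewrite integral_cantor_step; last 2 first.
- exact: measurable_cantor_iter.
- exact: cantor_iter_ge0.
have -> : ((cantor_mass p)%:E =
    (3^-1)%:E + (2 * cantor_ratio p / 3)%:E * (cantor_mass p)%:E)%E.
  by rewrite -EFinM -EFinD cantor_massE.
apply: leeD; first exact: lexx.
apply: lee_wpmul2l IH.
by rewrite lee_fin divr_ge0 // mulr_ge0 // ltW // cantor_ratio_gt0.
Qed.

Lemma integral_cantor_fun : (\int[mu]_x (cantor_fun x)%:E <= (cantor_mass p)%:E)%E.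
Proof.
have m N : measurable_fun [set: R] (fun x => (cantor_iter N x)%:E).
  by apply/measurable_EFinP; exact: measurable_cantor_iter.
have g0 N x : setT x -> (0 <= (cantor_iter N x)%:E)%E.
  by rewrite lee_fin cantor_iter_ge0.
have homo (x : R) : setT x ->
    {homo (fun N => (cantor_iter N x)%:E) : m n / (m <= n)%N >-> (m <= n)%E}.
  by move=> _ M N MN; rewrite lee_fin cantor_iter_homo.
have := @cvg_monotone_convergence _ _ _ mu setT measurableT
  (fun N x => (cantor_iter N x)%:E) m g0 homo.
have -> : (\int[mu]_x (fun x0 => limn (fun N => (cantor_iter N x0)%:E)) x =
    \int[mu]_x (cantor_fun x)%:E)%E.
  apply: eq_integral => x _; apply: cvg_lim => //.
  exact: cvg_comp (@cantor_iter_cvg x) _.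
move=> h; rewrite -(cvg_lim (@ereal_hausdorff R) h); apply: lime_le; first exact: cvgP h.
by apply: nearW => N; exact: integral_cantor_iter.
Qed.

Lemma measurable_EFin_dist (u v : R -> R) (D : set R) :
  measurable_fun [set: R] u -> measurable_fun [set: R] v ->
  measurable_fun D (fun x => `|u x - v x|%:E).
Proof.
move=> mu_ mv; apply/measurable_EFinP; apply: measurable_funTS.
by apply: measurableT_comp => //; exact: measurable_funB.
Qed.

(** The indicators cancel, and each outer term contributes [cantor_ratio / 3] times the L^1
    distance. *)
Lemma cantor_step_contraction (u v : R -> R) :
  measurable_fun [set: R] u -> measurable_fun [set: R] v ->
  (\int[mu]_x `|cantor_step p u x - cantor_step p v x|%:E <=
   (2 * cantor_ratio p / 3)%:E * \int[mu]_x `|u x - v x|%:E)%E.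
Proof.
move=> mu_ mv; set d := fun x => `|u x - v x|.
have r0 := cantor_ratio_gt0 p.
have d0 x : 0 <= d x by exact: normr_ge0.
have md : measurable_fun [set: R] d by apply/measurable_EFinP; exact: measurable_EFin_dist.
pose w t x := (cantor_ratio p * d (trisect t x))%:E.
have w0 t x : (0 <= w t x)%E by rewrite lee_fin mulr_ge0 // ltW.
have mw t : measurable_fun [set: R] (w t).
  by apply/measurable_EFinP; apply: measurable_funM => //; exact: (measurable_comp_trisect t md).
apply: (@le_trans _ _ (\int[mu]_x (w 0%R x + w 2%R x))%E).
  apply: ge0_le_integral => //.
  - by apply: measurable_EFin_dist; exact: measurable_cantor_step.
  - exact: emeasurable_funD (mw 0) (mw 2).
  move=> x _; rewrite /w -EFinD lee_fin /cantor_step.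
  have dE t : cantor_ratio p * d (trisect t x) =
      `|cantor_ratio p * (u (trisect t x) - v (trisect t x))|.
    by rewrite normrM gtr0_norm.
  rewrite !dE; apply: le_trans (ler_normD _ _).
  by rewrite le_eqVlt; apply/orP; left; apply/eqP; congr (`|_|); ring.
rewrite (ge0_integralD mu measurableT (fun x _ => w0 0 x) (mw 0) (fun x _ => w0 2 x) (mw 2)).
have i1 b : (\int[mu]_x w b x = (cantor_ratio p / 3)%:E * \int[mu]_x (d x)%:E)%E.
  by rewrite -(@integral_scaled_trisect R _ b setT) ?(ltW r0) // preimage_setT.
rewrite !i1 -ge0_muleDl ?lee_fin ?divr_ge0 ?(ltW r0) // -EFinD.
by rewrite le_eqVlt; apply/orP; left; apply/eqP; congr (_%:E * _)%E; lra.
Qed.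

Definition contraction_ratio : R := 2 * cantor_ratio p / 3.

Lemma contraction_ratio_itv : 0 <= contraction_ratio < 1.
Proof.
have := cantor_ratio_lt p_gt1; have := cantor_ratio_gt0 p; rewrite /contraction_ratio.
by move=> r0 r1; apply/andP; split; lra.
Qed.

Lemma integral_cantor_fun_approx N :
  (\int[mu]_x `|cantor_fun x - cantor_approx p N x|%:E <=
   (contraction_ratio ^+ N * (2 * cantor_mass p))%:E)%E.
Proof.
have /andP[c0 _] := contraction_ratio_itv.
elim: N => [|N IH].
  rewrite expr0 mul1r.
  have mf : measurable_fun [set: R] (fun x => (cantor_fun x)%:E).
    by apply/measurable_EFinP; exact: measurable_cantor_fun.
  have mg : measurable_fun [set: R] (fun x => (cantor_approx p 0 x)%:E).
    by apply/measurable_EFinP; exact: measurable_cantor_approx.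
  have f0 (x : R) : (0 <= (cantor_fun x)%:E)%E by rewrite lee_fin cantor_fun_ge0.
  have g0 (x : R) : (0 <= (cantor_approx p 0 x)%:E)%E by rewrite lee_fin cantor_approx_ge0.
  apply: (@le_trans _ _ (\int[mu]_x ((cantor_fun x)%:E + (cantor_approx p 0 x)%:E))%E).
    apply: ge0_le_integral => //.
    - apply: measurable_EFin_dist; first exact: measurable_cantor_fun.
      exact: measurable_cantor_approx.
    - exact: emeasurable_funD mf mg.
    move=> x _; rewrite -EFinD lee_fin (le_trans (ler_normB _ _)) //.
    by rewrite !ger0_norm ?cantor_fun_ge0 ?cantor_approx_ge0.
  rewrite (ge0_integralD mu measurableT (fun x _ => f0 x) mf (fun x _ => g0 x) mg).
  have -> : (2 * cantor_mass p)%:E = ((cantor_mass p)%:E + (cantor_mass p)%:E)%E.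
    by rewrite -EFinD; congr EFin; lra.
  by apply: leeD; [exact: integral_cantor_fun|exact: integral_cantor_approx].
rewrite exprS -mulrA EFinM.
apply: le_trans (lee_wpmul2l _ IH); last by rewrite lee_fin.
rewrite -{1}cantor_fun_step; apply: cantor_step_contraction.
- exact: measurable_cantor_fun.
- exact: measurable_cantor_approx.
Qed.

Lemma cantor_fun_approx_small (e : R) : 0 < e -> exists N,
  (\int[mu]_x `|cantor_fun x - cantor_approx p N x|%:E <= e%:E)%E.
Proof.
move=> e0; have /andP[c0 c1] := contraction_ratio_itv.
have m0 : 0 < 2 * cantor_mass p.
  by have := cantor_mass_ge1 p_gt1; lra.
have /cvgrPdist_lt /(_ (e / (2 * cantor_mass p)) (divr_gt0 e0 m0)) :
    contraction_ratio ^+ N @[N --> \oo] --> 0.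
  by apply: cvg_expr; rewrite ger0_norm.
case=> N _ /(_ N (leqnn N)) /=; rewrite sub0r normrN ger0_norm ?exprn_ge0 // => cN.
exists N; apply: (le_trans (integral_cantor_fun_approx N)).
by rewrite lee_fin -ler_pdivlMr // ltW.
Qed.

(** As [2 r^p / 3 = 1], the integral satisfies [J = 1/3 + J], which no finite value does. *)
Lemma integral_cantor_fun_powR : (\int[mu]_x (cantor_fun x `^ p)%:E = +oo)%E.
Proof.
have mfp : measurable_fun [set: R] (fun x => cantor_fun x `^ p).
  exact: (measurableT_comp (measurable_powR p) measurable_cantor_fun).
have fp0 x : 0 <= cantor_fun x `^ p by exact: powR_ge0.
have sf := supp01_cantor_fun; have pn0 : p != 0 by rewrite gt_eqF.
(* The three terms of the step have disjoint supports, so the power can be taken termwise. *)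
have step x : cantor_fun x `^ p = \1_(`]3^-1, 2 / 3[%classic) x +
    3 / 2 * cantor_fun (trisect 0 x) `^ p + 3 / 2 * cantor_fun (trisect 2 x) `^ p.
  have sfp : supp01 (fun y => cantor_fun y `^ p) by move=> y /sf ->; rewrite powR0.
  rewrite -[in LHS]cantor_fun_step -(cantor_ratio_powR p_gt1) -!powRM ?cantor_fun_ge0 //;
    try exact: (ltW (cantor_ratio_gt0 p)).
  have tri0 t : t < 0 \/ 1 < t -> cantor_ratio p * cantor_fun t = 0.
    by move=> /orP/sf ->; rewrite mulr0.
  case: (cantor_stepP p x sf) => h.
  - rewrite (tri0 (trisect 2 x)); last by left; rewrite /trisect; lra.
    rewrite powR0 // addr0 indicE (_ : (x \in _) = false) ?add0r //.
    by apply/negP => /set_mem /=; rewrite in_itv /= => /andP[? _]; lra.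
  - move/andP: (h) => [h1 h2].
    rewrite (tri0 (trisect 2 x)); last by left; rewrite /trisect; lra.
    rewrite (tri0 (trisect 0 x)); last by right; rewrite /trisect; lra.
    by rewrite powR0 // !addr0 powR1 indicE mem_set //= in_itv /= h1.
  - rewrite (tri0 (trisect 0 x)); last by right; rewrite /trisect; lra.
    rewrite powR0 // addr0 indicE (_ : (x \in _) = false) ?add0r //.
    by apply/negP => /set_mem /=; rewrite in_itv /= => /andP[_ ?]; lra.
set J := (\int[mu]_x _)%E.
have JE : (J = (3^-1)%:E + J)%E.
  rewrite {1}/J; under eq_integral do rewrite step.
  rewrite (@integral_bump_trisect R (3 / 2) (fun x => cantor_fun x `^ p)) //.
  by rewrite (_ : 2 * (3 / 2) / 3 = 1 :> R) ?mul1e //; field.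
have J0 : (0 <= J)%E by apply: integral_ge0 => x _; rewrite lee_fin.
case: J JE J0 => [r| |] //.
by rewrite -EFinD => -[rE] _; exfalso; lra.
Qed.

End cantor_limit.

Section increments.
Context {R : realType}.
Local Notation mu := (@lebesgue_measure R).

(** Two disjoint intervals are ordered on the line, so their open images under the monotone [F] are
    disjoint too; the increments are the lengths of these images, which lie in the unit interval. *)
Lemma sum_increments_le (F : R -> R) (s : seq nat) (a b : nat -> R) :
  {homo F : x y / x <= y} -> (forall x, 0 <= F x <= 1) -> uniq s ->
  (forall j, a j <= b j) -> trivIset [set` s] (fun j => `]a j, b j[%classic) ->
  (forall j, j \in s -> a j < b j) ->
  \sum_(j <- s) (F (b j) - F (a j)) <= 1.
Proof.
move=> Fh F01 us ab tI ab'; pose I j := `]F (a j), F (b j)[%classic : set R.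
have tF : trivIset [set` s] I.
  move=> i j si sj [t []]; rewrite /I /= !in_itv /= => /andP[i1 i2] /andP[j1 j2].
  apply: contrapT => ij.
  have ai := ab' i si; have aj := ab' j sj.
  have [h|h] : b i <= a j \/ b j <= a i.
    apply: contrapT => /not_orP[/negP]; rewrite -ltNge => h1 /negP; rewrite -ltNge => h2.
    apply: ij; apply: tI => //.
    (* If neither interval precedes the other, the midpoint of their intersection belongs to
       both. *)
    have lt : Num.max (a i) (a j) < Num.min (b i) (b j).
      by rewrite lt_min !gt_max ai aj h1 h2.
    exists ((Num.max (a i) (a j) + Num.min (b i) (b j)) / 2).
    have := midf_lt lt; case=> m1 m2.
    move: m1 m2; rewrite gt_max lt_min => /andP[m1 m2] /andP[m3 m4].
    by split; rewrite /= in_itv /= ?m1 ?m2 ?m3 ?m4.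
  - by have := Fh _ _ h; lra.
  - by have := Fh _ _ h; lra.
rewrite -lee_fin -sumEFin.
rewrite (_ : (\sum_(j <- s) _)%E = (\sum_(j <- s) \int[mu]_(x in I j) cst 1 x)%E); last first.
  apply: eq_bigr => j _; rewrite integral_cst ?mul1e //=; last exact: measurable_itv.
  rewrite /I lebesgue_measure_itv /= lte_fin.
  case: ltP => [_|h]; first by rewrite -EFinD.
  by congr EFin; have := Fh _ _ (ab j); lra.
have mI j : measurable (I j : set (measurableTypeR R)) by exact: measurable_itv.
rewrite -(@ge0_integral_bigsetU _ _ _ mu _ I (cst 1%E) s) //.
apply: (@le_trans _ _ (\int[mu]_(x in `[0%R, 1%R]) cst 1%E x)%E).
  apply: ge0_subset_integral => //.
    by apply: bigsetU_measurable => j _; exact: mI.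
  rewrite -bigcup_seq => t [j _]; rewrite /I /= !in_itv /= => /andP[t1 t2].
  have /andP[f1 f2] := F01 (a j); have /andP[f3 f4] := F01 (b j).
  by apply/andP; split; lra.
rewrite integral_cst //= lebesgue_measure_itv /= lte_fin ltr01 mul1e.
by rewrite -EFinD subr0.
Qed.

End increments.

(** * Part (iii) *)

Section Lp_in_jn.
Context {R : realType} (n : nat).
Implicit Types (f : Rn R n -> R) (X : domain R n) (Q : cube R n).

Lemma bounded_sub_cube (E : set (Rn R n)) : bounded_subset E ->
  exists Q : cube R n, E `<=` cube_set Q.
Proof.
move=> [M EM]; have s0 : 0 < 2 * `|M| + 1 by rewrite ltr_pwDr // mulr_ge0.
exists (@Cube R n [tuple (- `|M|) | i < n] _ xpredT xpredT s0) => x Ex i.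
rewrite in_itv /= tnth_mktuple; have := EM x Ex i.
have := ler_norm M; rewrite ler_norml => h /andP[h1 h2].
by apply/andP; split; lra.
Qed.

Lemma bounded_leb_lty (E : set (Rn R n)) : measurable E -> bounded_subset E ->
  (leb R n E < +oo)%E.
Proof.
move=> mE /bounded_sub_cube[Q EQ].
apply: (@le_lt_trans _ _ (leb R n (cube_set Q))); last by rewrite leb_cube ltry.
by apply: le_measure => //; rewrite inE //; exact: measurable_cube.
Qed.

(** By [powR_tangent] at level 1, [|f|] is at most [1 + |f|^p], and a bounded set has finite
    measure. *)
Lemma bounded_integral_lty p X (E : set (Rn R n)) f : 1 <= p ->
  measurable E -> E `<=` domain_set X -> bounded_subset E ->
  measurable_fun (domain_set X) f ->
  (\int[leb R n]_(x in domain_set X) (`|f x| `^ p)%:E < +oo)%E ->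
  (\int[leb R n]_(x in E) (`|f x| `^ 1)%:E < +oo)%E.
Proof.
move=> p1 mE EX bE mf fp; have mX := measurable_domain X.
have mfE : measurable_fun E f by apply: measurable_funS mf.
have mfp := measurable_norm_powR p mfE.
apply: (@le_lt_trans _ _ (\int[leb R n]_(x in E) (1%:E + (`|f x| `^ p)%:E))%E).
  apply: (ge0_le_integral _ mE _ (measurable_norm_powR 1 mfE)).
  - by move=> x _; rewrite lee_fin powR_ge0.
  - exact: emeasurable_funD.
  move=> x _; rewrite -EFinD lee_fin powRr1 //.
  have := powR_tangent p1 (@ltr01 R) (normr_ge0 (f x)).
  by rewrite powR1 mul1r.
have fp0 (x : Rn R n) : E x -> (0 <= (`|f x| `^ p)%:E)%E by rewrite lee_fin powR_ge0.
have m1 : measurable_fun E (fun _ : Rn R n => 1%:E : \bar R) by exact: measurable_cst.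
rewrite (ge0_integralD _ mE (fun _ _ => lee01) m1 fp0 mfp).
apply: lte_add_pinfty.
  by rewrite (integral_cst _ mE) mul1e; exact: bounded_leb_lty.
apply: le_lt_trans fp; apply: ge0_subset_integral => //.
  exact: measurable_norm_powR.
Qed.

Lemma Lq_loc1P X f : measurable_fun (domain_set X) f ->
  (forall E, measurable E -> E `<=` domain_set X -> bounded_subset E ->
    (\int[leb R n]_(x in E) (`|f x| `^ 1)%:E < +oo)%E) -> Lq_loc 1 X f.
Proof.
move=> mf fE; split; first exact: mf.
move=> E mE EX bE; have mX := measurable_domain X.
split.
  by apply: measurable_funM => //; apply: measurable_funTS; exact: measurable_indic.
change (Lp_norm 1 X (f \* \1_E)%R < +oo)%E; rewrite (Lp_norm_lty _ _ ltr01).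
by rewrite (integral_restrict_powR f ltr01 EX); exact: fE.
Qed.

Lemma scaled_mean_p10 p Q (m : \bar R) : (0 <= m)%E ->
  (scaled_mean p 1 0 Q m = (side Q ^+ n)%:E * m `^ p)%E.
Proof.
by move=> m0; rewrite /scaled_mean leb_cube oppr0 invr1 poweRe0 mul1e poweRe1.
Qed.

Lemma mean_powR1 Q f :
  mean Q (fun x => (`|f x| `^ 1)%:E) = mean Q (fun x => `|f x|%:E).
Proof. by apply: congr1; apply/funext => x; rewrite powRr1. Qed.

Lemma cube_term_p10 p P f Q : cube_term p 1 0 P f Q =
  ((side Q ^+ n)%:E * mean Q (fun x => `|f x - P Q f x|%:E) `^ p)%E.
Proof.
rewrite cube_termE (mean_powR1 Q (fun x => f x - P Q f x)) scaled_mean_p10 //.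
by apply: mean_ge0 => x; rewrite lee_fin.
Qed.

Lemma mean_proj_poly_cut_le s c0 : exists2 K : R, 0 < K &
  forall Q f, (leb R n).-integrable (cube_set Q) (EFin \o f) ->
  (mean Q (fun x => `|f x - proj_poly_cut s c0 Q f x|%:E) <=
   K%:E * mean Q (fun x => `|f x|%:E))%E.
Proof.
have [K K0 KP] := @mean_proj_poly_le R n s 1 (lexx 1).
exists (1 + K); first by rewrite ltr_pwDl // ltW.
move=> Q f fi; have m0 : (0 <= mean Q (fun x => `|f x|%:E))%E.
  by apply: mean_ge0 => x; rewrite lee_fin.
rewrite /proj_poly_cut; case: ifP => _.
  have := KP Q f 0 fi (@poly_le0 R n s).
  rewrite (mean_powR1 Q (fun x => f x - proj_poly s Q f x)).
  rewrite (mean_powR1 Q (fun x => f x - polyfun 0 x)).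
  have -> : (fun x => `|f x - polyfun 0 x|%:E) = fun x => `|f x|%:E.
    by apply/funext => x; rewrite /polyfun meval0 subr0.
  move/le_trans; apply; apply: lee_wpmul2r => //.
  by rewrite lee_fin lerDr.
have -> : (fun x => `|f x - cst 0 x|%:E) = fun x => `|f x|%:E.
  by apply/funext => x; rewrite subr0.
by rewrite -{1}[mean _ _]mul1e; apply: lee_wpmul2r => //; rewrite lee_fin lerDl ltW.
Qed.

Lemma Lp_Lq_loc1 p X f : 1 <= p -> carrier (Lp p X) f -> Lq_loc 1 X f.
Proof.
move=> p1 [mf fLp]; have p0 : 0 < p by exact: lt_le_trans p1.
have fp : (Lp_norm p X f < +oo)%E by exact: fLp.
rewrite (Lp_norm_lty _ _ p0) in fp.
apply: (Lq_loc1P mf) => E mE EX bE.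
exact: (bounded_integral_lty p1 mE EX bE mf fp).
Qed.

(** Comparison with the polynomial 0, then Jensen's inequality with its factor 2, bounds each
    summand by [(K * 2)^p] times the integral of [|f|^p] over the cube; these integrals add up. *)
Lemma Lp_cembed_jn p s c0 X : 1 < p -> cembed (Lp p X) (jn p 1 s 0 c0 X).
Proof.
move=> p1'; have p1 := ltW p1'; have p0 : 0 < p by exact: lt_le_trans p1.
have [K K0 KP] := mean_proj_poly_cut_le s c0.
have K2 : 0 < K * 2 by rewrite mulr_gt0.
have le f : carrier (Lp p X) f -> (JN_sup p 1 0 (proj_poly_cut s c0) X f <=
    (K * 2)%:E * Lp_norm p X f)%E.
  move=> fLp; have fq := Lp_Lq_loc1 p1 fLp.
  have mf : measurable_fun (domain_set X) f by case: fLp.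
  have mfp := measurable_norm_powR p mf.
  have fp0 (x : Rn R n) : (0 <= (`|f x| `^ p)%:E)%E by rewrite lee_fin powR_ge0.
  have I0 (A : set (Rn R n)) : (0 <= \int[leb R n]_(x in A) (`|f x| `^ p)%:E)%E.
    by apply: integral_ge0 => x _.
  apply: ge_ereal_sup => _ [F XF <-].
  have FX j : F.1 j -> cube_set (F.2 j) `<=` domain_set X by case: XF => + _; exact.
  pose t := ((((K * 2) `^ p)%:E *
      \int[leb R n]_(x in domain_set X) (`|f x| `^ p)%:E) `^ p^-1)%E.
  apply: (@le_trans _ _ t); last first.
    rewrite /t Lp_normE // poweRM ?lee_fin ?powR_ge0 // -poweR_EFin poweRK ?gt_eqF //.
    by rewrite lee_fin ltW.
  apply: le_poweR; first by rewrite invr_ge0 ltW.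
    by apply: esum_ge0 => j _; exact: cube_term_ge0.
  apply: (@le_trans _ _ (((K * 2) `^ p)%:E * \esum_(j in F.1)
      \int[leb R n]_(x in cube_set (F.2 j)) (`|f x| `^ p)%:E)%E); last first.
    apply: lee_wpmul2l; first by rewrite lee_fin powR_ge0.
    exact: esum_integral_cubes.
  apply: esum_le_scale => [|j|j Fj]; [by rewrite lee_fin powR_ge0|exact: I0|].
  have fi := Lq_loc_integrable (lexx 1) fq (FX j Fj).
  have mfQ : measurable_fun (cube_set (F.2 j)) f.
    exact: measurable_funS (measurable_domain X) (FX j Fj) mf.
  have V0 := cube_vol_gt0 (F.2 j).
  rewrite cube_term_p10 integral_meanE muleCA.
  apply: lee_wpmul2l; first by rewrite lee_fin ltW.
  set m := mean _ (fun x => (`|f x| `^ p)%:E).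
  have m0 : (0 <= m)%E by exact: mean_ge0.
  have -> : (((K * 2) `^ p)%:E * m = ((K * 2)%:E * m `^ p^-1) `^ p)%E.
    by rewrite poweRM ?lee_fin ?(ltW K2) ?poweR_ge0 // poweRVK ?gt_eqF.
  apply: le_poweR; first exact: ltW.
    by apply: mean_ge0 => x; rewrite lee_fin.
  apply: (le_trans (KP _ _ fi)); rewrite EFinM -muleA.
  apply: lee_wpmul2l; first by rewrite lee_fin ltW.
  exact: mean_le_poweR_mean.
split; last by exists (K * 2).
move=> f fLp; split; first exact: Lp_Lq_loc1 fLp.
apply: (le_lt_trans (le f fLp)); apply: lte_EFin_mul (ltW K2) _.
by case: fLp.
Qed.

End Lp_in_jn.

(** * The functions that separate the three spaces *)

Section strictness.
Context {R : realType}.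
Local Notation mu := (@lebesgue_measure R).
Local Notation X1 := (@WholeSpace R 1).

Definition cantor_fun1 (p : R) (x : Rn R 1) : R := cantor_fun p (tnth x ord0).

Lemma measurable_comp_tnth0 (v : R -> R) : measurable_fun [set: R] v ->
  measurable_fun [set: Rn R 1] (fun x => v (tnth x ord0)).
Proof. by move=> mv; exact: measurableT_comp mv (@measurable_tnthR R 1 ord0). Qed.

Lemma measurable_cantor_fun1 p : measurable_fun [set: Rn R 1] (cantor_fun1 p).
Proof. exact: measurable_comp_tnth0 (measurable_cantor_fun p). Qed.

Lemma integral_cantor_fun1 p : 1 < p ->
  (\int[leb R 1]_x (cantor_fun1 p x)%:E <= (cantor_mass p)%:E)%E.
Proof.
move=> p1; rewrite (@ge0_integral_leb1 R (fun t => (cantor_fun p t)%:E)).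
- exact: integral_cantor_fun.
- by apply/measurable_EFinP; exact: measurable_cantor_fun.
- by move=> t; rewrite lee_fin cantor_fun_ge0.
Qed.

Lemma cantor_fun1_notin_Lp p : 1 < p -> ~ carrier (Lp p X1) (cantor_fun1 p).
Proof.
move=> p1 [_ fLp]; have p0 : 0 < p by exact: lt_trans p1.
have fp : (Lp_norm p X1 (cantor_fun1 p) < +oo)%E by exact: fLp.
rewrite (Lp_norm_lty _ _ p0) in fp.
have E : (\int[leb R 1]_(x in domain_set X1) (`|cantor_fun1 p x| `^ p)%:E =
    \int[mu]_t (cantor_fun p t `^ p)%:E)%E.
  rewrite -(@ge0_integral_leb1 R (fun t => (cantor_fun p t `^ p)%:E)).
  - by apply: eq_integral => x _; rewrite ger0_norm // cantor_fun_ge0.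
  - apply/measurable_EFinP.
    exact: (measurableT_comp (measurable_powR p) (measurable_cantor_fun p)).
  - by move=> t; rewrite lee_fin powR_ge0.
by move: fp; rewrite E integral_cantor_fun_powR.
Qed.

Lemma cantor_fun1_Lq_loc p : 1 < p -> Lq_loc 1 X1 (cantor_fun1 p).
Proof.
move=> p1; apply: Lq_loc1P; first exact: measurable_cantor_fun1.
move=> E mE _ _; apply: (@le_lt_trans _ _ (cantor_mass p)%:E); last exact: ltry.
apply: le_trans (integral_cantor_fun1 p1).
rewrite (_ : (fun x => (`|cantor_fun1 p x| `^ 1)%:E) = EFin \o cantor_fun1 p); last first.
  by apply/funext => x /=; rewrite powRr1 // ger0_norm // cantor_fun_ge0.
apply: ge0_subset_integral => //.
  by apply/measurable_EFinP; exact: measurable_cantor_fun1.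
by move=> x _; rewrite lee_fin cantor_fun_ge0.
Qed.

Lemma cst_Lq_loc n (X : domain R n) (c : R) : Lq_loc 1 X (cst c).
Proof.
apply: Lq_loc1P; first exact: measurable_cst.
move=> E mE _ bE.
change (\int[leb R n]_(x in E) (cst (`|c| `^ 1)%R%:E) x < +oo)%E.
rewrite (integral_cst _ mE).
exact: lte_EFin_mul (powR_ge0 _ _) (bounded_leb_lty mE bE).
Qed.

Lemma mean_proj_poly_dist_cst (s n : nat) : exists2 K : R, 0 < K &
  forall (Q : cube R n) f c, (leb R n).-integrable (cube_set Q) (EFin \o f) ->
  (mean Q (fun x => `|f x - proj_poly s Q f x|%:E) <=
   K%:E * mean Q (fun x => `|f x - c|%:E))%E.
Proof.
have [K K0 KP] := @mean_proj_poly_le R n s 1 (lexx 1).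
exists K => // Q f c fi.
have sc : poly_le s (mpolyC n c) by rewrite /poly_le /= mmeasureC; case: (c != 0).
have := KP Q f _ fi sc.
rewrite (mean_powR1 Q (fun x => f x - proj_poly s Q f x)).
rewrite (mean_powR1 Q (fun x => f x - polyfun (mpolyC n c) x)).
have -> : (fun x => `|f x - polyfun (mpolyC n c) x|%:E) = fun x => `|f x - c|%:E.
  by apply/funext => x; rewrite /polyfun mevalC.
exact.
Qed.

(** The constant is its own competitor, so every summand is 0. *)
Lemma cst_in_JN p s n (X : domain R n) (c : R) : 0 < p ->
  carrier (JN p 1 s 0 X) (cst c).
Proof.
move=> p0; have fq := cst_Lq_loc X c; split; first exact: fq.
have [K K0 KP] := mean_proj_poly_dist_cst s n.
apply: (@le_lt_trans _ _ 0%E) => //.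
apply: ge_ereal_sup => _ [F [FX _] <-].
rewrite esum1 ?poweR0r ?invr_eq0 ?gt_eqF // => j Fj.
have fi := Lq_loc_integrable (lexx 1) fq (FX j Fj).
have := KP _ _ c fi; rewrite (_ : (fun x => `|cst c x - c|%:E) = cst 0%:E); last first.
  by apply/funext => x; rewrite subrr normr0.
rewrite mean_cst mule0 => m0.
rewrite cube_term_p10 (_ : mean _ _ = 0%E) ?poweR0r ?gt_eqF ?mule0 //.
by apply/le_anti; rewrite m0 /=; apply: mean_ge0 => x; rewrite lee_fin.
Qed.

(** Consecutive intervals of length exactly [c0], for which the truncated projection is already 0,
    each contribute [c0], and there are infinitely many. *)
Lemma cst1_notin_jn p s c0 : 0 < p -> 0 < c0 -> ~ carrier (jn p 1 s 0 c0 X1) (cst 1).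
Proof.
move=> p0 c00 [fq fjn].
pose P := proj_poly_cut s c0 : cube R 1 -> (Rn R 1 -> R) -> Rn R 1 -> R.
have {}fjn : (JN_sup p 1 0 P X1 (cst 1%R) < +oo)%E by exact: fjn.
pose Q (j : nat) : cube R 1 := Cube [tuple c0 *+ j] xpred0 xpred0 c00.
have Qin j x : cube_interior (Q j) x -> c0 *+ j < tnth x ord0 < c0 *+ j.+1.
  by move=> /(_ ord0); rewrite in_itv mulrSr.
have le_idx i j x : cube_interior (Q i) x -> cube_interior (Q j) x -> (i <= j)%N.
  move=> /Qin/andP[i1 _] /Qin/andP[_ j2]; rewrite -ltnS -(ltr_nat R) -(ltr_pM2r c00).
  by rewrite !mulr_natl; exact: lt_trans j2.
have XF : cube_family X1 (setT, Q).
  split=> [j _ //|i j _ _ [x [xi xj]]].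
  by apply/eqP; rewrite eqn_leq (le_idx _ _ _ xi xj) (le_idx _ _ _ xj xi).
have Qterm j : cube_term p 1 0 P (cst 1%R) (Q j) = c0%:E.
  rewrite cube_term_p10 /P /proj_poly_cut /= ltxx.
  rewrite (_ : (fun x => `|cst 1 x - cst 0 x|%:E) = cst 1%:E); last first.
    by apply/funext => x; rewrite subr0 normr1.
  by rewrite mean_cst poweR1r mule1 expr1.
have := @esum_le_JN_sup R 1 p 1 0 P X1 (cst 1%R) (setT, Q) p0 XF.
have := poweR_lty p fjn; have := poweR_ge0 (JN_sup p 1 0 P X1 (cst 1%R)) p.
case: (_ `^ p)%E => [S| |] //; rewrite lee_fin => S0 _ /= h.
pose N := (Num.truncn (S / c0)).+1.
have : (\sum_(j < N) c0%:E <= S%:E)%E.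
  apply: le_trans h; apply: esum_ge; exists `I_N => //.
  by rewrite -fsbig_ord; apply: lee_sum => j _; rewrite Qterm.
rewrite sumEFin sumr_const card_ord lee_fin -mulr_natl leNgt => /negP; apply.
by rewrite -ltr_pdivrMr // /N truncnS_gt.
Qed.

End strictness.

(** * Membership of the Cantor-type function in jn_p *)

Section cantor_in_jn.
Context {R : realType} (p : R) (p_gt1 : 1 < p).
Local Notation mu := (@lebesgue_measure R).
Local Notation X1 := (@WholeSpace R 1).

Let p_gt0 : 0 < p. Proof. exact: lt_trans p_gt1. Qed.

Let f1 := @cantor_fun1 R p.

Lemma hmean_powR V v : 0 < V -> 0 <= v -> hmean p V v `^ p = V `^ (p - 1) * v.
Proof.
move=> V0 v0; rewrite /hmean powRM ?powR_ge0 // -!powRrM mulVf ?gt_eqF // powRr1 //.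
by rewrite mulrBl mul1r mulVf ?gt_eqF.
Qed.

(** The error [e] is measured on the whole line, so one [N] serves every interval. *)
Lemma cantor_fun_osc N e a b : a <= b ->
  (\int[mu]_x `|cantor_fun p x - cantor_approx p N x|%:E <= e%:E)%E ->
  exists c, (\int[mu]_(x in `[a, b]) `|cantor_fun p x - c|%:E <=
   (e + 2 * end_const p * hmean p (b - a) (cantor_cdf N b - cantor_cdf N a))%:E)%E.
Proof.
move=> ab fN; have [c gc] := cantor_approx_osc p_gt1 N ab; exists c.
have mf := measurable_cantor_fun p; have mg := measurable_cantor_approx p N.
have mc : measurable_fun [set: R] (fun _ : R => c) by exact: measurable_cst.
have m1 := measurable_EFin_dist (D := `[a, b]) mf mg.
have m2 := measurable_EFin_dist (D := `[a, b]) mg mc.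
have ge0 (u v : R -> R) x : `[a, b]%classic x -> (0 <= `|u x - v x|%:E)%E.
  by rewrite lee_fin.
apply: (@le_trans _ _ (\int[mu]_(x in `[a, b]) (`|cantor_fun p x - cantor_approx p N x|%:E
    + `|cantor_approx p N x - c|%:E))%E).
  apply: (ge0_le_integral mu (measurable_itv _) _ (measurable_EFin_dist mf mc)).
  - exact: ge0.
  - exact: emeasurable_funD m1 m2.
  by move=> x _; rewrite -EFinD lee_fin ler_distD.
rewrite (ge0_integralD mu (measurable_itv _) (ge0 _ _) m1 (ge0 _ (cst c)) m2) EFinD.
apply: leeD gc; apply: le_trans fN.
apply: (ge0_subset_integral mu (measurable_itv _) measurableT (measurable_EFin_dist mf mg)).
- by move=> x _; rewrite lee_fin.
- by [].
Qed.

Definition cube_increment N (Q : cube R 1) : R :=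
  cantor_cdf N (tnth (corner Q) ord0 + side Q) - cantor_cdf N (tnth (corner Q) ord0).

Lemma cube_increment_ge0 N Q : 0 <= cube_increment N Q.
Proof. by rewrite subr_ge0 cantor_cdf_homo // lerDl ltW // side_gt0. Qed.

(** The main term is exact, [V * (hmean p V v / V)^p = v], whereas the error is weighted by
    [V^(1 - p)], which is unbounded as the interval shrinks. *)
Lemma small_cube_real_bound (K E e V v : R) : 0 <= K -> 0 <= E -> 0 <= e -> 0 < V -> 0 <= v ->
  V * (K * (V^-1 * (e + E * hmean p V v))) `^ p <=
  K `^ p * 2 `^ p * (E `^ p * v + V `^ (1 - p) * e `^ p).
Proof.
move=> K0 E0 e0 V0 v0; have V0' := ltW V0.
have s0 : 0 <= e + E * hmean p V v by rewrite addr_ge0 // mulr_ge0 // hmean_ge0.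
have Vi0 : 0 <= V^-1 by rewrite invr_ge0.
rewrite powRM ?mulr_ge0 // powRM // mulrCA -mulrA; apply: ler_wpM2l; first exact: powR_ge0.
have VV : V * V^-1 `^ p = V `^ (1 - p).
  rewrite powRD; last by rewrite (gt_eqF V0) implybT.
  by rewrite powRr1 // -(powR_inv1 V0') -powRrM mulN1r.
rewrite mulrA VV; apply: (@le_trans _ _ (V `^ (1 - p) *
    (2 `^ p * (e `^ p + (E * hmean p V v) `^ p)))).
  apply: ler_wpM2l; first exact: powR_ge0.
  by apply: powR_add_le; rewrite ?(ltW p_gt0) // mulr_ge0 // hmean_ge0.
rewrite powRM ?hmean_ge0 // hmean_powR //.
have V1 : V `^ (1 - p) * V `^ (p - 1) = 1.
  rewrite -powRD; last by rewrite (gt_eqF V0) implybT.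
  by rewrite (_ : 1 - p + (p - 1) = 0) ?powRr0 //; lra.
rewrite le_eqVlt; apply/orP; left; apply/eqP.
transitivity (2 `^ p * (E `^ p * v * (V `^ (1 - p) * V `^ (p - 1)) + V `^ (1 - p) * e `^ p)).
  by ring.
by rewrite V1 mulr1.
Qed.

Lemma cantor_fun1_integrable Q : (leb R 1).-integrable (cube_set Q) (EFin \o f1).
Proof. exact: (Lq_loc_integrable (lexx 1) (cantor_fun1_Lq_loc p_gt1)). Qed.

Lemma cantor_small_cube_term s : exists2 K : R, 0 < K & forall N e Q, 0 <= e ->
  (\int[mu]_x `|cantor_fun p x - cantor_approx p N x|%:E <= e%:E)%E ->
  (cube_term p 1 0 (proj_poly s) f1 Q <=
   (K * (cube_increment N Q + side Q `^ (1 - p) * e `^ p))%:E)%E.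
Proof.
have [K K0 KP] := @mean_proj_poly_dist_cst R s 1.
have E1 := end_const_ge1 p_gt1; pose E := 2 * end_const p.
have E0 : 0 <= E by rewrite /E; lra.
exists (K `^ p * 2 `^ p * (1 + E `^ p)).
  by rewrite !mulr_gt0 ?powR_gt0 // ltr_pwDl // powR_ge0.
move=> N e Q e0 fN; have V0 := side_gt0 Q.
set a := tnth (corner Q) ord0.
have ab : a <= a + side Q by rewrite lerDl ltW.
have [c hc] := cantor_fun_osc ab fN.
rewrite (_ : a + side Q - a = side Q) in hc; last by rewrite addrAC subrr add0r.
have v0 := cube_increment_ge0 N Q.
rewrite -/a -/E -/(cube_increment N Q) in hc.
apply: (@le_trans _ _ (K `^ p * 2 `^ p * (E `^ p * cube_increment N Q +
    side Q `^ (1 - p) * e `^ p))%:E); last first.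
  rewrite lee_fin -!mulrA; do 2 (apply: ler_wpM2l; first exact: powR_ge0).
  have := mulr_ge0 (powR_ge0 (side Q) (1 - p)) (powR_ge0 e p).
  have := powR_ge0 E p; move: (_ `^ p) (_ * _) => x y x0 y0; nra.
apply: le_trans (_ : (_ <= (side Q * (K * ((side Q)^-1 * (e + E * hmean p (side Q)
    (cube_increment N Q)))) `^ p)%:E)%E) _; last first.
  by rewrite lee_fin; apply: small_cube_real_bound => //; exact: ltW.
rewrite cube_term_p10 expr1 EFinM; apply: lee_wpmul2l; first by rewrite lee_fin ltW.
rewrite -poweR_EFin; apply: le_poweR; first exact: ltW.
  by apply: mean_ge0 => x; rewrite lee_fin.
apply: (le_trans (KP Q f1 c (cantor_fun1_integrable _))); rewrite EFinM.
apply: lee_wpmul2l; first by rewrite lee_fin ltW.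
rewrite meanE expr1 EFinM; apply: lee_wpmul2l; first by rewrite lee_fin invr_ge0 ltW.
apply: le_trans hc; apply: (ge0_integral_cube1_le Q (v := fun t => `|cantor_fun p t - c|%:E)).
  exact: measurable_EFin_dist (measurable_cantor_fun p) (measurable_cst c).
by move=> t; rewrite lee_fin.
Qed.

(** With [I] the integral over [Q] and [V] its length, the summand is [V^(1 - p) I^(p - 1) I].
    Bounding [V] below by [c0] and [I^(p - 1)] by the total mass leaves a bound linear in [I], hence
    additive over disjoint cubes. *)
Lemma cantor_large_cube_term s c0 Q : 0 < c0 -> c0 <= side Q ->
  (cube_term p 1 0 (proj_poly_cut s c0) f1 Q <=
   (c0 `^ (1 - p) * cantor_mass p `^ (p - 1))%:E *
     \int[leb R 1]_(x in cube_set Q) (f1 x)%:E)%E.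
Proof.
move=> c00 c0Q; have V0 := side_gt0 Q.
rewrite cube_term_p10 expr1 /proj_poly_cut ltNge c0Q /=.
rewrite (_ : (fun x => `|f1 x - cst 0 x|%:E) = EFin \o f1); last first.
  by apply/funext => x; rewrite /= subr0 ger0_norm // cantor_fun_ge0.
rewrite meanE expr1.
set I := (\int[leb R 1]_(x in cube_set Q) (EFin \o f1) x)%E.
have I0 : (0 <= I)%E by apply: integral_ge0 => x _; rewrite lee_fin cantor_fun_ge0.
have Im : (I <= (cantor_mass p)%:E)%E.
  apply: le_trans (integral_cantor_fun1 p_gt1).
  apply: ge0_subset_integral => //; first exact: measurable_cube.
    by apply/measurable_EFinP; exact: measurable_cantor_fun1.
  by move=> x _; rewrite lee_fin cantor_fun_ge0.
have Ifin : I \is a fin_num by rewrite ge0_fin_numE // (le_lt_trans Im) // ltry.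
rewrite -(fineK Ifin) -(EFinM (side Q)^-1) poweR_EFin -(EFinM (side Q)) -EFinM lee_fin.
have i0 : 0 <= fine I by exact: fine_ge0.
have im : fine I <= cantor_mass p by rewrite -lee_fin fineK.
have m1 := cantor_mass_ge1 p_gt1.
have Vi0 : 0 <= (side Q)^-1 by rewrite invr_ge0 ltW.
rewrite powRM // mulrA.
have -> : side Q * (side Q)^-1 `^ p = side Q `^ (1 - p).
  rewrite powRD; last by rewrite (gt_eqF V0) implybT.
  by rewrite powRr1 ?(ltW V0) // -(powR_inv1 (ltW V0)) -powRrM mulN1r.
rewrite -mulrA; apply: ler_pM; rewrite ?powR_ge0 //.
  rewrite -(opprB p 1) !powRN lef_pV2 ?posrE ?powR_gt0 //.
  by apply: ge0_ler_powR; rewrite ?nnegrE ?subr_ge0 ?(ltW p_gt1) ?(ltW c00) ?(ltW V0).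
rewrite -mulr_powRB1 // mulrC; apply: ler_wpM2r => //.
by apply: ge0_ler_powR; rewrite ?nnegrE ?subr_ge0 ?(ltW p_gt1) // (le_trans _ m1).
Qed.

Lemma cantor_fun1_in_jn s c0 : 0 < c0 -> carrier (jn p 1 s 0 c0 X1) f1.
Proof.
move=> c00; split; first exact: cantor_fun1_Lq_loc.
have [K K0 KP] := cantor_small_cube_term s.
pose C := c0 `^ (1 - p) * cantor_mass p `^ (p - 1).
have C0 : 0 <= C by rewrite mulr_ge0 // powR_ge0.
(* The 2 is 1 for the increments and 1 for the error of the approximation; the other term pays for
   the cubes of side at least [c0]. *)
pose B := K * 2 + C * cantor_mass p.
apply: (@le_lt_trans _ _ ((B%:E) `^ p^-1)%E); last by rewrite poweR_EFin ltry.
have f10 (x : Rn R 1) : (0 <= (f1 x)%:E)%E by rewrite lee_fin cantor_fun_ge0.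
have mf1 : measurable_fun [set: Rn R 1] (EFin \o f1).
  by apply/measurable_EFinP; exact: measurable_cantor_fun1.
apply: ge_ereal_sup => _ [F XF <-]; apply: le_poweR; first by rewrite invr_ge0 ltW.
  by apply: esum_ge0 => j _; exact: cube_term_ge0.
apply: ge_ereal_sup => _ [A [finA AF] <-].
pose Q := F.2; pose r := fset_set A.
pose W := \sum_(j <- r) side (Q j) `^ (1 - p).
have W0 : 0 <= W by apply: sumr_ge0 => j _; exact: powR_ge0.
(* the error of the approximation is taken small with respect to the finite family *)
pose e := (1 + W)^-1 `^ p^-1.
have e0 : 0 < e by rewrite powR_gt0 // invr_gt0 ltr_pwDl.
have [N fN] := cantor_fun_approx_small p_gt1 e0.
have We : W * e `^ p <= 1.
  rewrite /e -powRrM mulVf ?gt_eqF // powRr1 ?invr_ge0 ?addr_ge0 //.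
  by rewrite ler_pdivrMr ?mul1r ?lerDr // ltr_pwDl.
have inA j : j \in r -> F.1 j.
  by move=> jA; apply: AF; move: jA; rewrite in_fset_set // => /set_mem.
have incr : \sum_(j <- r) cube_increment N (Q j) <= 1.
  apply: (sum_increments_le (F := cantor_cdf N)
    (a := fun j => tnth (corner (Q j)) ord0)
    (b := fun j => tnth (corner (Q j)) ord0 + side (Q j))).
  - exact: cantor_cdf_homo.
  - exact: cantor_cdf_itv.
  - exact: fset_uniq.
  - by move=> j; rewrite lerDl ltW // side_gt0.
  - move=> i j /inA Fi /inA Fj [t [/= ti tj]]; case: XF => _ /(_ i j Fi Fj); apply.
    by exists [tuple t]; split => k; rewrite ord1 tnth0.
  - by move=> j _; rewrite ltrDl side_gt0.
rewrite fsbig_finite //.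
pose S j := K * (cube_increment N (Q j) + side (Q j) `^ (1 - p) * e `^ p).
have S0 j : 0 <= S j.
  by rewrite mulr_ge0 ?(ltW K0) // addr_ge0 ?cube_increment_ge0 // mulr_ge0 ?powR_ge0.
pose I j := (\int[leb R 1]_(x in cube_set (Q j)) (f1 x)%:E)%E.
have I0 j : (0 <= I j)%E by apply: integral_ge0.
have term j : (cube_term p 1 0 (proj_poly_cut s c0) f1 (Q j) <= (S j)%:E + C%:E * I j)%E.
  have [Qc0|c0Q] := ltP (side (Q j)) c0.
    apply: (@le_trans _ _ (S j)%:E); last by rewrite leeDl // mule_ge0.
    have := KP N e (Q j) (ltW e0) fN; rewrite /cube_term.
    by rewrite /proj_poly_cut Qc0.
  apply: (le_trans (cantor_large_cube_term s c00 c0Q)).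
  by rewrite leeDr // lee_fin.
apply: (@le_trans _ _ (\sum_(j <- r) ((S j)%:E + C%:E * I j))%E).
  by apply: lee_sum => j _; exact: term.
rewrite big_split /= sumEFin -ge0_sume_distrr // /B EFinD; apply: leeD.
  rewrite lee_fin /S -mulr_sumr ler_pM2l // big_split /= -mulr_suml.
  by rewrite (_ : 2 = 1 + 1 :> R) // lerD.
rewrite (EFinM C (cantor_mass p)); apply: lee_wpmul2l => //.
apply: le_trans (integral_cantor_fun1 p_gt1).
apply: le_trans (esum_integral_cubes XF mf1 f10).
by apply: esum_ge; exists A => //; rewrite fsbig_finite.
Qed.

End cantor_in_jn.

Lemma Lp_strict_jnp (R : realType) (p c0 : R) : 1 < p -> 0 < c0 ->
  strict_cembed (Lp p (@WholeSpace R 1)) (jnp p c0 (@WholeSpace R 1)).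
Proof.
move=> p1 c00; split; first exact: Lp_cembed_jn.
move=> E; apply: (@cantor_fun1_notin_Lp R p p1); rewrite E.
exact: cantor_fun1_in_jn.
Qed.

Lemma jnp_strict_JNp (R : realType) (p c0 : R) : 1 < p -> 0 < c0 ->
  strict_cembed (jnp p c0 (@WholeSpace R 1)) (JNp p (@WholeSpace R 1)).
Proof.
move=> p1 c00; have p0 : 0 < p by exact: lt_trans p1.
split; first exact: jn_cembed_JN.
move=> E; suff : carrier (jnp p c0 (@WholeSpace R 1)) (cst 1) by exact: cst1_notin_jn.
by rewrite E; exact: cst_in_JN.
Qed.

Theorem proposition2p10 (R : realType) (n : nat) (n_gt0 : (0 < n)%N)
    (p q alpha : R) (s : nat)
    (p_gt1 : 1 < p) (q_ge1 : 1 <= q) (alpha_ge0 : 0 <= alpha) :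
  (forall (X : domain R n) (c0 : R), 0 < c0 -> (c0%:E < domain_side X)%E ->
     cembed (jn p q s alpha c0 X) (JN p q s alpha X)) /\
  (forall (Q0 : cube R n) (c0 : R), 0 < c0 -> c0 < side Q0 ->
     eq_equiv_norms (JN p q s alpha (CubeDomain Q0))
                    (jn_quot p q s alpha c0 (CubeDomain Q0))) /\
  (forall c0 : R, 0 < c0 ->
     strict_cembed (Lp p (@WholeSpace R 1)) (jnp p c0 (@WholeSpace R 1)) /\
     strict_cembed (jnp p c0 (@WholeSpace R 1)) (JNp p (@WholeSpace R 1))).
Proof.
have p_gt0 : 0 < p by exact: lt_trans p_gt1.
split=> [X c0 _ _|]; first exact: jn_cembed_JN.
split=> [Q0 c0 c0_gt0 _|c0 c0_gt0]; first exact: JN_eq_jn_quot.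
by split; [exact: Lp_strict_jnp|exact: jnp_strict_JNp].
Qed.
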